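(* Let $k,f,\gamma_1,\gamma_2,\eta_1,\eta_2,\lambda,h_1,h_2$ satisfy assumptions $(C_1)$–$(C_6)$ listed in the context, and let $P$, $\|\cdot\|$, $\overline{f}_\rho$, $\underline{f}_\rho$, $H_{i,\rho}$, $K$, $K^*$ be as defined there. Assume there exist $r,R\in(0,+\infty)$ with $r<R$ such that the following two inequalities are satisfied: $$\max\Bigl\{\lambda \overline{f}_R K+\sum_{i=1}^{2}\eta_i\gamma_i(1)H_{i,R},\ \ \lambda \overline{f}_R K^{*}+\sum_{i=1}^{2}\eta_i\|\gamma_i'\|_{\infty}H_{i,R}\Bigr\}\leq R,$$ $$\lambda\,\underline{f}_r\,\min\{K,K^{*}\}\geq r.$$ Then the perturbed Hammerstein integral equation $$u(t)=\eta_1\gamma_1(t)h_1[u]+\eta_2\gamma_2(t)h_2[u]+\lambda\int_0^1 k(t,s)f(s,u(s),u'(s))\,ds,\qquad t\in[0,1],$$ has a solution $u\in P$ such that $r\leq\|u\|\leq R$.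
   Context: The space $C^1[0,1]$ of real-valued continuously differentiable functions on $[0,1]$ is endowed with the norm $\|u\|:=\max\{\|u\|_\infty,\|u'\|_\infty\}$, where $\|u\|_\infty:=\max_{t\in[0,1]}|u(t)|$. The cone of non-negative, non-decreasing functions is $$P:=\{u\in C^1[0,1]:\ u(t)\ge 0 \text{ and } u'(t)\ge 0\ \text{for every } t\in[0,1]\}.$$ For $\rho>0$, $P_\rho:=\{u\in P:\|u\|<\rho\}$, and $\partial P_\rho=\{u\in P:\|u\|=\rho\}$ is its boundary relative to $P$. Standing assumptions: $(C_1)$ $k:[0,1]\times[0,1]\to[0,+\infty)$ is measurable and continuous in $t$ for almost every (a.e.) $s$, that is, for every $\tau\in[0,1]$ we have $\lim_{t\to\tau}|k(t,s)-k(\tau,s)|=0$ for a.e. $s\in[0,1]$; furthermore there exists a function $\Phi\in L^1(0,1)$ such that $0\le k(t,s)\le\Phi(s)$ for $t\in[0,1]$ and a.e. $s\in[0,1]$. $(C_2)$ The partial derivative $\partial_t k(t,s)$ is non-negative and continuous in $t$ for a.e. $s$, and there exists $\Psi\in L^1(0,1)$ such that $0\le\partial_t k(t,s)\le\Psi(s)$ for $t\in[0,1]$ and a.e. $s\in[0,1]$. $(C_3)$ $f:[0,1]\times[0,+\infty)\times[0,+\infty)\to[0,+\infty)$ is continuous. $(C_4)$ $\gamma_1,\gamma_2\in C^1[0,1]$ and $\gamma_1(t),\gamma_2(t),\gamma_1'(t),\gamma_2'(t)\ge 0$ for every $t\in[0,1]$. $(C_5)$ $\eta_1,\eta_2,\lambda\in[0,+\infty)$.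 $(C_6)$ $h_1,h_2:P\to[0,+\infty)$ are (not necessarily linear) functionals which are continuous and map bounded sets into bounded sets; here $P$ carries the metric induced by $\|\cdot\|$. Quantities: for $\rho>0$ and $i=1,2$, $$\overline{f}_\rho:=\max_{[0,1]\times[0,\rho]^2}f(t,u,v),\quad \underline{f}_\rho:=\min_{[0,1]\times[0,\rho]^2}f(t,u,v),\quad H_{i,\rho}:=\sup_{u\in\partial P_\rho}h_i[u],$$ $$K:=\int_0^1 k(1,s)\,ds,\qquad K^*:=\sup_{t\in[0,1]}\int_0^1\partial_t k(t,s)\,ds.$$ *)

(* Defs.v *)
From mathcomp Require Import all_boot all_order all_algebra.
From mathcomp Require Import all_classical all_reals all_analysis.

Set Implicit Arguments.
Unset Strict Implicit.
Unset Printing Implicit Defensive.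

Import Order.TTheory GRing.Theory Num.Theory.
Import numFieldNormedType.Exports.

Local Open Scope classical_set_scope.
Local Open Scope ring_scope.

Section Defs.
Context {R : realType}.
Implicit Types (u v g : R -> R) (k : R -> R -> R) (f : R -> R -> R -> R)
  (h : (R -> R) -> R).

Local Notation mu := (@lebesgue_measure R).

(* Functions on [0,1] are represented by total functions R -> R of which only
   the values on [0,1] matter. Derivatives are therefore taken relatively to
   [0,1], hence they are one-sided at 0 and at 1. *)
Definition diffquot u (t y : R) : R := (u y - u t) / (y - t).

Definition derivable01 u (t : R) : Prop :=
  cvg (diffquot u t @ within `[0, 1] t^').

Definition deriv01 u (t : R) : R := lim (diffquot u t @ within `[0, 1] t^').

Definition continuous01_at g (t : R) : Prop :=
  g @ within `[0, 1] (nbhs t) --> g t.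

Definition C1_01 u : Prop :=
  (forall t : R, t \in `[0, 1] -> derivable01 u t) /\
  {within `[0, 1], continuous (deriv01 u)}.

(* For continuous functions the supremum is a maximum. *)
Definition supnorm g : R := sup [set `|g t| | t in `[0, 1]].

Definition C1norm u : R := Num.max (supnorm u) (supnorm (deriv01 u)).

Definition coneP : set (R -> R) := [set u | C1_01 u /\
  forall t : R, t \in `[0, 1] -> 0 <= u t /\ 0 <= deriv01 u t].

Definition sphereP (rho : R) : set (R -> R) :=
  coneP `&` [set u | C1norm u = rho].

(* Membership in L^1(0,1); a Borel representative is no loss of generality. *)
Definition L1_01 g : Prop := mu.-integrable `]0, 1[ (EFin \o g).

(* Lebesgue measurability in the plane: the sigma-algebra is that of the
   Caratheodory-measurable sets of the outer measure induced by the product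
   measure, i.e. the completion of the product (Borel) sigma-algebra. *)
Definition lebesgue_measurable2 (D : set (R * R)) (g : R * R -> R) : Prop :=
  @measurable_fun _ _ (caratheodory_type ((mu \x mu)%E^*)%mu) R D g.

Definition pderiv k (t s : R) : R := deriv01 (k ^~ s) t.

Definition kernel_assumption k : Prop :=
  [/\ forall t s : R, t \in `[0, 1] -> s \in `[0, 1] -> 0 <= k t s,
      lebesgue_measurable2 (`[0, 1] `*` `[0, 1]) (fun z => k z.1 z.2),
      forall tau : R, tau \in `[0, 1] ->
        {ae mu, forall s, s \in `[0, 1] -> continuous01_at (k ^~ s) tau}
    & exists2 Phi, L1_01 Phi & forall t : R, t \in `[0, 1] ->
        {ae mu, forall s, s \in `[0, 1] -> 0 <= k t s <= Phi s}].

(* The partial derivative exists on all of [0,1] for a.e. s. Requiring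
   existence only "for every t, for a.e. s" would be too weak: the kernel
   with k t s = 1 if s < t and 0 otherwise would then have a vanishing partial
   derivative. The remaining null sets may depend on the first variable, as
   they may in [kernel_assumption]. *)
Definition kernel_deriv_assumption k : Prop :=
  [/\ {ae mu, forall s, s \in `[0, 1] ->
        forall t : R, t \in `[0, 1] -> derivable01 (k ^~ s) t},
      forall tau : R, tau \in `[0, 1] ->
        {ae mu, forall s, s \in `[0, 1] ->
          0 <= pderiv k tau s /\ continuous01_at (pderiv k ^~ s) tau}
    & exists2 Psi, L1_01 Psi & forall t : R, t \in `[0, 1] ->
        {ae mu, forall s, s \in `[0, 1] -> 0 <= pderiv k t s <= Psi s}].

Definition uncurry3 f (z : R * R * R) : R := f z.1.1 z.1.2 z.2.

Definition nonlinearity_assumption f : Prop :=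
  let D : set (R * R * R) := `[0, 1] `*` `[0, +oo[ `*` `[0, +oo[ in
  (forall z, D z -> 0 <= uncurry3 f z) /\ {within D, continuous (uncurry3 f)}.

Definition gamma_assumption g : Prop :=
  C1_01 g /\ forall t : R, t \in `[0, 1] -> 0 <= g t /\ 0 <= deriv01 g t.

(* Continuity for the C^1 metric makes [h u] depend only on the restriction
   of [u] to [0,1]. *)
Definition functional_assumption h : Prop :=
  [/\ forall u, coneP u -> 0 <= h u,
      forall u, coneP u -> forall e : R, 0 < e -> exists2 d : R, 0 < d &
        forall v, coneP v -> C1norm (v \- u) < d -> `|h v - h u| < e
    & forall A : set (R -> R), A `<=` coneP ->
        (exists M : R, forall u, A u -> C1norm u <= M) ->
        exists M : R, forall u, A u -> `|h u| <= M].

Definition box (rho : R) : set (R * R * R) :=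
  `[0, 1] `*` `[0, rho] `*` `[0, rho].

(* Maximum and minimum over the compact box when f is continuous. *)
Definition fmax f (rho : R) : R := sup (uncurry3 f @` box rho).
Definition fmin f (rho : R) : R := inf (uncurry3 f @` box rho).

Definition Hsup h (rho : R) : R := sup (h @` sphereP rho).

(* The integral of a nonnegative function is a supremum of integrals of Borel
   simple functions below it; for a function that is only Lebesgue measurable
   this is still the usual Lebesgue integral. *)
Definition Kint k : R := \int[mu]_(s in `[0, 1]) k 1 s.

Definition Kstar k : R :=
  sup [set \int[mu]_(s in `[0, 1]) pderiv k t s | t in `[0, 1]].

End Defs.

(* Main.v *)
Require Import Defs.
From mathcomp Require Import all_boot.

(** Only Schauder's theorem is needed.  The integral operator [T] maps the closed
ball of radius [rmax] in the cone compactly into the cone, and on its boundary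
[upper] gives |Tu| <= rmax; composing [T] with the radial retraction onto the
ball, Schauder's theorem yields a fixed point, at which the retraction is not
active.  A fixed point with |u| < rmin would satisfy
u(1) = Tu(1) >= lam * fmin(rmin) * K >= rmin by [lower], a contradiction.

Schauder's theorem is derived from Scarf's combinatorial lemma applied to the
points of a fine grid of the simplex spanned by an eps-net y_i of T(K): if x is
coloured by an index i with |Tx - y_i| < eps, a fully coloured cell yields in the
limit a point x which is a convex combination of y_i's all eps-close to Tx.

Since the null sets in the hypotheses on the kernel depend on t, differentiating
under the integral sign first requires that k(.,s) be Lipschitz with constant
Psi(s) for a.e. s: by Fubini, for a.e. s the bound 0 <= dk/dt <= Psi(s) holds for
a.e. t, and a function which is differentiable everywhere, with a derivative
that is nonnegative almost everywhere, is nondecreasing. *)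

(** The bound |Tu| <= rmax is known on the sphere only, because [Hsup] is a supremum over the
    sphere; inside the ball [h1] and [h2] may be larger, so that [T] need not preserve the ball.
    Hence the retraction. Functions are total and only their values on [0,1] count, so [C1norm] is a
    seminorm, and only on the subspace of C^1 functions. The fixed point theorems are therefore
    stated for a subspace [E] with a seminorm [N], and a fixed point is a [z] with
    [N (T z - z) = 0]. Limits are taken along an ultrafilter finer than [\oo]: all bounded real
    sequences converge along it simultaneously, which replaces subsequences and diagonal arguments.
    Measurability of the kernel refers to the completed product sigma-algebra, so Fubini makes a
    section [k t] Borel measurable only off a null set and only for almost every [t]. Continuity in
    [t] extends this to all [t], and all integrals are moved to a Borel set [G] of full measure that
    is independent of [t]. *)

Set Implicit Arguments.
Unset Strict Implicit.
Unset Printing Implicit Defensive.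

(** * Scarf's lemma *)

Section Scarf.
Context (I Z : finType) (rk : I -> Z -> nat) (e : I -> Z) (c : Z -> I).
(* The slack elements [e i] play the role of the facets of the simplex. *)
Hypothesis rk_inj : forall i, injective (rk i).
Hypothesis e_min : forall i z, rk i (e i) <= rk i z.
Hypothesis e_max : forall i j z,
  i != j -> (forall l, z != e l) -> rk j z < rk j (e i).
Hypothesis ce : forall i, c (e i) = i.
Variables (i0 : I) (x0 : Z).
Hypothesis x0e : forall l, x0 != e l.

(** If the orders compare barycentric coordinates, this says that the smallest copy of the simplex
    around [S], cut out by the minima of its coordinates, has no element of [Z] in its interior. *)
Definition dominant (S : {set Z}) :=
  [forall y, exists i, forall x in S, rk i y <= rk i x].

Lemma dominantP (S : {set Z}) :
  reflect (forall y, exists i, forall x, x \in S -> rk i y <= rk i x)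
          (dominant S).
Proof.
apply: (iffP forallP) => H y.
  by have /existsP[i /forall_inP iP] := H y; exists i.
by have [i iP] := H y; apply/existsP; exists i; apply/forall_inP.
Qed.

Lemma dominantS (S T : {set Z}) : T \subset S -> dominant S -> dominant T.
Proof.
move=> /subsetP TS /dominantP domS; apply/dominantP => y.
by have [i iP] := domS y; exists i => x /TS; exact: iP.
Qed.

(** If all colours occur, they are distinct on [S] and only the element coloured [i0] can be
    removed. Otherwise a removable [x] shares its colour with exactly one other element, which is
    then the only other removable one, so that the count is 0 or 2. *)
Lemma odd_almost_full (S : {set Z}) : #|S| = #|I| ->
  odd #|[set x in S | c @: (S :\ x) == ~: [set i0]]| = (c @: S == setT).
Proof.
move=> cardS; set A := [set x in S | _].
have cardD x : x \in S -> #|S :\ x| = #|~: [set i0]|.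
  by move=> xS; rewrite cardsC1 -cardS (cardsD1 x S) xS.
have inj_of x : x \in S -> c @: (S :\ x) == ~: [set i0] -> {in S :\ x &, injective c}.
  by move=> xS /eqP cx; apply/imset_injP; rewrite cx cardD.
have [full|nfull] := eqVneq (c @: S) setT.
  have cinj : {in S &, injective c} by apply/imset_injP; rewrite full cardsT cardS.
  have /imsetP[x xS cx] : i0 \in c @: S by rewrite full inE.
  suff -> : A = [set x] by rewrite cards1.
  apply/setP => y; rewrite !inE; apply/andP/eqP => [[yS /eqP yE]|->].
    apply: contraTeq isT => yx.
    suff : i0 \in ~: [set i0] by rewrite !inE eqxx.
    by rewrite -yE {1}cx; apply: imset_f; rewrite !inE eq_sym yx.
  split=> //; apply/eqP/setP => i; rewrite !inE; apply/imsetP/idP.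
    move=> [z]; rewrite !inE => /andP[zx zS] ->; apply: contra zx => /eqP.
    by rewrite cx => /cinj -> //.
  move=> ii0; have /imsetP[z zS iz] : i \in c @: S by rewrite full inE.
  exists z => //; rewrite !inE zS andbT; apply: contra ii0 => /eqP zx.
  by rewrite iz zx -cx.
have [->|/set0Pn[x]] := eqVneq A set0; first by rewrite cards0.
rewrite inE => /andP[xS xA].
have SE : S = x |: (S :\ x) by rewrite setD1K.
have cxi0 : c x != i0.
  apply: contra nfull => /eqP cx; rewrite SE imsetU1 (eqP xA) cx.
  by rewrite setUCr.
have /imsetP[x' x'S cxx'] : c x \in c @: (S :\ x) by rewrite (eqP xA) !inE.
move: (x'S); rewrite !inE => /andP[x'x x'S'].
suff -> : A = [set x; x'] by rewrite cards2 eq_sym x'x.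
apply/setP => y; rewrite !inE; apply/andP/idP; last first.
  case/orP => /eqP ->; split => //.
  rewrite -(eqP xA); apply/eqP/setP => i; apply/imsetP/imsetP => -[z].
    rewrite !inE => /andP[zx' zS] ->.
    have [->|zx] := eqVneq z x; first by exists x'.
    by exists z => //; rewrite !inE zx.
  rewrite !inE => /andP[zx zS] ->.
  have [->|zx'] := eqVneq z x'; first by exists x; rewrite ?inE 1?eq_sym ?x'x.
  by exists z => //; rewrite !inE zx'.
move=> [yS yA]; apply: contraT; rewrite negb_or => /andP[yx yx'].
have := inj_of _ yS yA x x'; rewrite !inE ![_ == y]eq_sym yx yx' xS x'S'.
by move=> /(_ isT isT cxx') E; rewrite -E eqxx in x'x.
Qed.

(** This is the boundary facet from which the parity argument starts. An [x] that extends it must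
    dominate the non-slack elements in order [i0], because in any other order [i] the slack [e i] is
    already the minimum; so [x] is the largest non-slack element of order [i0]. *)
Lemma card_rooms_slack :
  #|[set x | (x \notin e @: ~: [set i0]) && dominant (x |: e @: ~: [set i0])]| = 1.
Proof.
set T := e @: _.
have nsl z : (forall l, z != e l) -> z \notin T.
  by move=> ze; apply/imsetP => -[l _ zE]; have := ze l; rewrite zE eqxx.
have nslP z : reflect (forall l, z != e l) [forall l, z != e l] by exact: forallP.
have Px0 : [forall l, x0 != e l] by apply/nslP.
case: (@arg_maxnP _ x0 (fun z => [forall l, z != e l]) (rk i0) Px0) => w /nslP we wmax.
suff -> : [set x | (x \notin T) && dominant (x |: T)] = [set w] by rewrite cards1.
apply/setP => x; rewrite !inE; apply/andP/eqP => [[xT /dominantP dom]|->].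
  have [i iP] := dom w.
  have ii0 : i = i0.
    apply/eqP; apply: contraT => ii0.
    have le : rk i w <= rk i (e i) by apply: iP; rewrite in_setU imset_f ?orbT// !inE.
    have : w == e i by rewrite -(inj_eq (@rk_inj i)) eqn_leq le e_min.
    by rewrite (negPf (we i)).
  have {}iP : rk i0 w <= rk i0 x by rewrite -ii0 iP// !inE eqxx.
  apply: (@rk_inj i0); apply/eqP; rewrite eqn_leq iP andbT.
  apply: wmax; apply: contraNT xT; rewrite negb_forall => /existsP[l].
  rewrite negbK => /eqP xl; rewrite xl imset_f// !inE.
  apply: contraTneq iP => li0; rewrite -ltnNge xl li0 ltn_neqAle e_min andbT.
  by rewrite (inj_eq (@rk_inj i0)) eq_sym we.
split; first exact: nsl.
apply/dominantP => y.
have [/nslP ye|] := boolP [forall l, y != e l].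
  exists i0 => z; rewrite !inE => /orP[/eqP ->|/imsetP[l li0 ->]].
    by apply: wmax; apply/nslP.
  by apply: ltnW; apply: e_max => //; rewrite !inE in li0.
rewrite negb_forall => /existsP[l]; rewrite negbK => /eqP ->.
by exists l => z _.
Qed.

(* A set [T] with one element less than needed contains the minimum of each
   order, so that exactly two orders share their minimum; a dominant extension of
   [T] lowers one of these two minima, in the best possible way. *)
Lemma odd_rooms (T : {set Z}) :
  #|T| = #|I|.-1 -> c @: T = ~: [set i0] ->
  odd #|[set x | (x \notin T) && dominant (x |: T)]| = (T == e @: ~: [set i0]).
Proof.
move=> cardT cT.
have [->|TT0] := eqVneq T; first by rewrite card_rooms_slack.
have [x1 x1T x1e] : exists2 x, x \in T & forall l, x != e l.
  case: (pickP [pred x | (x \in T) && [forall l, x != e l]]) => [x|no].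
    by move=> /andP[xT /forallP xe]; exists x.
  case/negP: TT0; rewrite eqEcard cardT card_imset ?cardsC1 ?leqnn ?andbT.
    apply/subsetP => z zT; have /= := no z; rewrite zT/= => /negbT.
    rewrite negb_forall => /existsP[l]; rewrite negbK => /eqP ze.
    by rewrite ze imset_f// -cT -(ce l) -ze imset_f.
  by move=> l l' /(congr1 c); rewrite !ce.
have [domT|ndom] := boolP (dominant T); last first.
  rewrite (_ : [set x | _] = set0) ?cards0//.
  apply/setP => x; rewrite !inE; apply: contraNF ndom => /andP[_].
  by apply: dominantS; exact: subsetU1.
pose m j := [arg min_(z < x1 in T) rk j z].
have mT j : m j \in T by rewrite /m; case: arg_minnP.
have mmin j z : z \in T -> rk j (m j) <= rk j z.
  by rewrite /m; case: arg_minnP => // ? _; apply.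
have m_eq j z : z \in T -> (forall y, y \in T -> rk j z <= rk j y) -> z = m j.
  by move=> zT zm; apply: (@rk_inj j); apply/eqP; rewrite eqn_leq zm// mmin.
have imm : m @: setT = T.
  apply/eqP; rewrite eqEsubset; apply/andP; split; apply/subsetP => z.
    by move=> /imsetP[j _ ->].
  move=> zT; have [i iP] := dominantP _ domT z.
  by rewrite (m_eq i z zT iP) imset_f.
have I0 : 0 < #|I| by rewrite (cardD1 i0).
have cardC i : #|T| = #|~: [set i : I]| by rewrite cardT cardsC1.
have inj_off i : T \subset m @: (~: [set i]) -> {in ~: [set i] &, injective m}.
  move=> sub; apply/imset_injP; rewrite eqn_leq leq_imset_card.
  by rewrite -(cardC i) subset_leq_card.
have [i1 [i2 i12 mi12]] : exists i1, exists2 i2, i1 != i2 & m i1 = m i2.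
  apply/injectivePn/injectiveP => /card_imset -/(_ setT).
  rewrite imm cardsT cardT => E.
  by have := ltn_predL #|I|; rewrite E ltnn I0.
(* If [x] is the minimum of the extended set in order [i], the other orders must supply all elements
   of [T] as minima; so [m] is injective on them, which forces [i] to be one of the two colliding
   orders. *)
have only i x : x \notin T -> (forall z, z \in T -> rk i x <= rk i z) ->
    dominant (x |: T) ->
    i \in [set i1; i2] /\ forall j, j != i -> rk j (m j) < rk j x.
  move=> xT xmin /dominantP dom.
  have idx z : z \in T -> exists2 j, j != i & m j = z /\ rk j z <= rk j x.
    move=> zT; have [j jP] := dom z; exists j; last first.
      split; last by apply: jP; rewrite !inE eqxx.
      by apply/esym/m_eq => // y yT; apply: jP; rewrite inE yT orbT.
    apply: contraNneq xT => ji; suff -> : x = z by [].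
    apply: (@rk_inj i); apply/eqP; rewrite eqn_leq xmin//= -ji.
    by apply: jP; rewrite !inE eqxx.
  have minj : {in ~: [set i] &, injective m}.
    apply: inj_off; apply/subsetP => z /idx[j ji [<- _]].
    by apply: imset_f; rewrite !inE.
  split.
    rewrite !inE; apply: contraNT i12; rewrite negb_or => /andP[ii1 ii2].
    by apply/eqP/minj => //; rewrite !inE eq_sym.
  move=> j ji; have [j' j'i [mm le]] := idx _ (mT j).
  have jj' : j' = j by apply: minj => //; rewrite !inE.
  rewrite jj' in le; rewrite ltn_neqAle le andbT.
  by apply: contraNneq xT => /rk_inj <-; exact: mT.
(* [M i] holds the elements that can change no minimum of [T] but that of order [i], among them the
   slack [e i]; only the best one, [w i], yields a dominant set. *)
pose M i := [pred y | [forall j, (j != i) ==> (rk j (m j) < rk j y)]].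
have MP i y : reflect (forall j, j != i -> rk j (m j) < rk j y) (M i y).
  by apply: (iffP forallP) => H j; [move=> ji; apply: (implyP (H j)) |
    apply/implyP; exact: H].
have Me i : M i (e i).
  apply/MP => j ji; apply: leq_ltn_trans (mmin j _ x1T) _.
  by apply: e_max; rewrite // eq_sym.
pose w i := [arg max_(y > e i | M i y) rk i y].
have wM i : M i (w i) by rewrite /w; case: arg_maxnP.
have wmax i y : M i y -> rk i y <= rk i (w i).
  by rewrite /w; case: arg_maxnP => // ? _; apply.
have wmP i i' : i != i' -> m i = m i' ->
    [/\ w i \notin T, rk i (w i) < rk i (m i) & dominant (w i |: T)].
  move=> ii' mii'; have wP := elimT (MP _ _) (wM i).
  have wT : w i \notin T.
    apply/negP => wT; have /imsetP[j _ wj] : w i \in m @: setT by rewrite imm.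
    have [ji|ji] := eqVneq j i; last by have := wP _ ji; rewrite wj ltnn.
    by have := wP i'; rewrite wj ji mii' ltnn eq_sym ii' => /(_ isT).
  have lt : rk i (w i) < rk i (m i).
    have [j jP] := elimT (dominantP _) domT (w i).
    have [ji|ji] := eqVneq j i; last first.
      by have := jP _ (mT j); rewrite leqNgt wP.
    rewrite ji in jP; rewrite ltn_neqAle jP// andbT.
    by apply: contraNneq wT => /rk_inj ->.
  split => //; apply/dominantP => y.
  have [yM|] := boolP (M i y).
    exists i => z; rewrite !inE => /orP[/eqP ->|zT]; first exact: wmax.
    by apply: leq_trans (wmax _ _ yM) _; apply: leq_trans (ltnW lt) (mmin _ _ zT).
  rewrite negb_forall => /existsP[j]; rewrite negb_imply -leqNgt => /andP[ji le].
  exists j => z; rewrite !inE => /orP[/eqP ->|zT].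
    by apply: leq_trans le _; apply: ltnW; exact: wP.
  by apply: leq_trans le (mmin _ _ zT).
have [w1T w1m w1d] := wmP _ _ i12 mi12.
have [w2T w2m w2d] : [/\ w i2 \notin T, rk i2 (w i2) < rk i2 (m i2) &
    dominant (w i2 |: T)] by apply: (wmP _ i1); rewrite // eq_sym.
suff -> : [set x | (x \notin T) && dominant (x |: T)] = [set w i1; w i2].
  rewrite cards2; suff -> : w i1 != w i2 by [].
  have /MP/(_ i2) := wM i1; rewrite eq_sym i12 => /(_ isT) lt.
  by apply: contraTneq lt => ->; rewrite -leqNgt ltnW.
apply/setP => x; rewrite !inE; apply/andP/orP => [[xT dom]|[]/eqP -> //].
have [i iP] := elimT (dominantP _) dom x.
have [iI Mx] := only i x xT (fun z zT => iP z (setU1r _ zT)) dom.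
suff xw : x = w i.
  by move: iI; rewrite !inE => /orP[]/eqP <-; rewrite -xw eqxx; [left|right].
have [j jP] := elimT (dominantP _) dom (w i).
have ji : j = i.
  apply/eqP; apply: contraT => ji; have := jP (m j).
  by rewrite leqNgt (elimT (MP _ _) (wM i) j ji) inE mT orbT => /(_ isT).
apply: (@rk_inj i); apply/eqP; rewrite eqn_leq wmax; last exact/MP.
by rewrite ji in jP; rewrite jP ?setU11.
Qed.

(* Count modulo 2 the pairs of a dominant set [S] and [x \in S] such that [S :\ x]
   has all the colours but [i0]. *)
Theorem scarf : exists2 S : {set Z}, dominant S & c @: S = setT.
Proof.
pose P (S : {set Z}) x := [&& dominant S, x \in S, #|S| == #|I|
  & c @: (S :\ x) == ~: [set i0]].
pose Q (T : {set Z}) x := [&& dominant (x |: T), x \notin T, #|T| == #|I|.-1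
  & c @: T == ~: [set i0]].
have I0 : 0 < #|I| by rewrite (cardD1 i0).
(* Removing [x] from [S] turns a pair counted on the left into one counted on the right, and adding
   it back inverts this. *)
have PQ : \sum_S \sum_x P S x = \sum_T \sum_x Q T x.
  rewrite exchange_big [RHS]exchange_big /=; apply: eq_bigr => x _.
  rewrite (bigID (fun S : {set Z} => x \in S)) /= [X in _ + X]big1 ?addn0; last first.
    by move=> S xS; rewrite /P (negPf xS) andbF.
  rewrite [RHS](bigID (fun S : {set Z} => x \notin S)) /= [X in _ = _ + X]big1 ?addn0; last first.
    by move=> S xS; rewrite /Q (negPf xS) andbF.
  rewrite (reindex_onto (fun T => x |: T) (fun S => S :\ x)) /=; last first.
    by move=> S xS; rewrite setD1K.
  apply: eq_big => [T|T /andP[_ /eqP TE]].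
    rewrite setU11/=; apply/eqP/idP => [<-|]; first by rewrite !inE eqxx.
    exact: setU1K.
  have xT : x \notin T by rewrite -TE !inE eqxx.
  by rewrite /P /Q setU11 TE xT cardsU1 xT /= -[#|I|]prednK// eqSS.
have sumP S : \sum_x P S x = if dominant S && (#|S| == #|I|)
    then #|[set x in S | c @: (S :\ x) == ~: [set i0]]| else 0.
  case: ifPn => [/andP[dS cS]|nS].
    rewrite -sum1_card [RHS]big_mkcond; apply: eq_bigr => x _.
    by rewrite /P dS cS inE /=; case: (x \in S); case: (_ == _).
  rewrite big1// => x _; rewrite /P; apply/eqP; rewrite eqb0.
  by apply: contra nS => /and4P[-> _ ->].
have sumQ T : \sum_x Q T x = if (#|T| == #|I|.-1) && (c @: T == ~: [set i0])
    then #|[set x | (x \notin T) && dominant (x |: T)]| else 0.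
  case: ifPn => [/andP[cT cS]|nS].
    rewrite -sum1_card [RHS]big_mkcond; apply: eq_bigr => x _.
    by rewrite /Q cT cS inE !andbT; case: (x \in T); case: (dominant _).
  rewrite big1// => x _; rewrite /Q; apply/eqP; rewrite eqb0.
  by apply: contra nS => /and4P[_ _ -> ->].
have even_sum (A : finType) (p : pred A) (F : A -> nat) :
    (forall i, p i -> ~~ odd (F i)) -> ~~ odd (\sum_(i | p i) F i).
  by move=> Fi; elim/big_ind: _ => // x y; rewrite oddD => /negPf -> /negPf ->.
set T0 := e @: ~: [set i0].
have cT0 : c @: T0 = ~: [set i0].
  by rewrite -imset_comp -[RHS]imset_id; apply: eq_imset => l /=; exact: ce.
have cardT0 : #|T0| = #|I|.-1.
  by rewrite card_imset ?cardsC1// => l l' /(congr1 c); rewrite !ce.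
(* The facet [T0] contributes an odd number and every other [T] an even one; were no dominant [S]
   fully coloured, the left-hand sum of [PQ] would be even. *)
have : odd (\sum_T \sum_x Q T x).
  rewrite (bigD1 T0)//= oddD sumQ cT0 cardT0 !eqxx/= odd_rooms// eqxx.
  apply: even_sum => T TT0; rewrite sumQ; case: ifPn => // /andP[/eqP cT /eqP c0].
  by rewrite odd_rooms.
rewrite -PQ; case: (pickP [pred S | dominant S && (c @: S == setT)]) => [S|no].
  by move=> /andP[dS /eqP cS] _; exists S.
move=> odd_sum; exfalso; apply: (elimN idP _ odd_sum).
apply: even_sum => S _; rewrite sumP.
case: ifPn => // /andP[dS /eqP cS]; rewrite odd_almost_full//.
by have /= := no S; rewrite dS/= => ->.
Qed.
End Scarf.

(** The slack elements are adjoined as [inl i], coloured [i], and [C] consists of the indices whose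
    slack is missing from the set found by [scarf]: these colours have to be supplied by points of
    [X]. An order [i] whose slack belongs to the set cannot bound a point [y], since in it the slack
    is strictly below all points. *)
Lemma scarf_cell (I X : finType) (r : I -> X -> nat) (c : X -> I)
    (i0 : I) (x0 : X) :
  (forall i, injective (r i)) ->
  exists (S : {set X}) (C : {set I}),
    (forall i, i \in C -> exists2 x, x \in S & c x = i) /\
    forall y, exists2 i, i \in C & forall x, x \in S -> r i y <= r i x.
Proof.
(* [rk] shifts the points by one to make room for the slack at 0; thanks to [.+2] the other slacks
   still lie above all points. *)
move=> r_inj; pose B j := (\max_x r j x).+2.
have rB j x : r j x < (B j).-1 by rewrite ltnS; exact: leq_bigmax.
pose rk j (z : I + X) := match z with
  | inl i => if i == j then 0 else B j + enum_rank i
  | inr x => (r j x).+1 end.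
pose c' (z : I + X) := match z with inl i => i | inr x => c x end.
have rk_inj j : injective (rk j).
  have ltB x k : (r j x).+1 < B j + k by apply: leq_trans (leq_addr _ _); exact: rB.
  move=> [i|x] [i'|x'] /=.
  - case: (eqVneq i j) => [->|_]; case: (eqVneq i' j) => [->|_] //.
    by move=> /addnI/val_inj/enum_rank_inj ->.
  - case: (eqVneq i j) => // _ E.
    by have := ltB x' (enum_rank i); rewrite -E ltnn.
  - case: (eqVneq i' j) => // _ E.
    by have := ltB x (enum_rank i'); rewrite E ltnn.
  - by move=> [] /r_inj ->.
have e_max i j z : i != j -> (forall l, z != inl l) -> rk j z < rk j (inl i).
  case: z => [l|x] ij; first by move=> /(_ l); rewrite eqxx.
  by move=> _ /=; rewrite (negPf ij); apply: leq_trans (leq_addr _ _); exact: rB.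
have e_min i z : rk i (inl i) <= rk i z by rewrite /= eqxx.
have [S dS cS] := @scarf _ _ rk inl c' rk_inj e_min e_max (fun=> erefl) i0 (inr x0) (fun=> isT).
exists [set x | inr x \in S], [set i | inl i \notin S]; split.
  move=> i; rewrite inE => iS.
  have /imsetP[[l|x] zS /= ic] : i \in c' @: S by rewrite cS inE.
    by rewrite ic zS in iS.
  by exists x; rewrite ?inE.
move=> y; have [i iP] := elimT (dominantP _ _) dS (inr y).
exists i => [|x]; rewrite inE; last exact: (iP (inr x)).
by apply/negP => /iP /=; rewrite eqxx.
Qed.

(** In order [i] grid points are compared by their [i]-th coordinate. Dominance makes the minima
    [a i] over the cell, for [i] in [C], sum to almost [m]; each point of the cell has coordinates
    summing to [m] as well, so it exceeds these minima by at most [#|I|]. *)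
Lemma grid_cell (I : finType) (i0 : I) (m : nat) (c : (I -> nat) -> I) :
  exists (C : {set I}) (p : I -> I -> nat), [/\ exists i, i \in C,
    forall i, i \in C -> \sum_j p i j = m,
    forall i, i \in C -> c (p i) = i,
    forall i j, i \in C -> j \notin C -> p i j <= #|I|
  & forall i i' j, i \in C -> i' \in C -> p i j <= p i' j + #|I|].
Proof.
pose X : finType := {x : {ffun I -> 'I_m.+1} | \sum_i x i == m}.
pose v (x : X) i : nat := \val x i.
have vsum x : \sum_i v x i = m by exact/eqP/(valP x).
have mkX (f : I -> nat) : \sum_i f i = m -> exists x : X, forall i, v x i = f i.
  move=> fm; have fle i : f i < m.+1 by rewrite ltnS -fm (bigD1 i)//= leq_addr.
  have fP : \sum_i ([ffun i => Ordinal (fle i)] : {ffun _}) i == m.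
    by apply/eqP; rewrite -[RHS]fm; apply: eq_bigr => i _; rewrite ffunE.
  by exists (exist (fun x : {ffun I -> 'I_m.+1} => \sum_i x i == m) _ fP) => i; rewrite /v ffunE.
have [x0 _] : exists x0 : X, True.
  have [|x _] := mkX (fun i => if i == i0 then m else 0); last by exists x.
  by rewrite (bigD1 i0)//= eqxx big1 ?addn0// => i /negPf ->.
(* The second term breaks ties, so that the order is linear; being smaller than [#|X|], it never
   overrides a difference of coordinates. *)
pose r i (x : X) := v x i * #|X| + enum_rank x.
have r_inj i : injective (r i).
  move=> x y /(congr1 (modn^~ #|X|)).
  by rewrite /r !modnMDl !modn_small// => /val_inj/enum_rank_inj.
have r_le i x y : r i y <= r i x -> v y i <= v x i.
  move=> le; rewrite -ltnS; have X0 : 0 < #|X| by apply/card_gt0P; exists x.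
  rewrite -(ltn_pmul2r X0); apply: leq_ltn_trans (leq_addr (enum_rank y) _) _.
  by apply: leq_ltn_trans le _; rewrite /r mulSn addnC ltn_add2r.
have [S [C [cS dom]]] := scarf_cell (fun x => c (v x)) i0 x0 r_inj.
have [iC iCC _] := dom x0.
have [xS xSS _] := cS _ iCC.
pose a i := v [arg min_(x < xS in S) v x i] i.
have aP i x : x \in S -> a i <= v x i.
  by rewrite /a; case: arg_minnP => // ? _; apply.
have aE i : exists2 x, x \in S & v x i = a i.
  by rewrite /a; case: arg_minnP => // x xs _; exists x.
(* Otherwise raising each minimum with index in [C] by one, and putting the remaining mass [d] on
   [iC], gives a grid point above the minimum of the cell in every order of [C]. *)
have big : m < \sum_(i in C) (a i).+1.
  rewrite ltnNge; apply/negP => le.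
  pose d := m - \sum_(i in C) (a i).+1.
  have [|y yE] := mkX (fun i => if i \in C then (a i).+1 + (if i == iC then d else 0) else 0).
    rewrite -big_mkcond big_split/= -big_mkcondr/= [X in _ + X](big_pred1 iC) ?subnKC//.
    by move=> i /=; case: eqVneq => [->|_]; rewrite ?iCC// andbF.
  have [i iC' /= iP] := dom y.
  have [x xs xa] := aE i; have := r_le _ _ _ (iP x xs).
  by rewrite xa yE iC' leqNgt ltnS leq_addr.
have excess j x : x \in S -> v x j <= (if j \in C then a j else 0) + #|I|.
  move=> xs; have aC (P : pred I) :
      \sum_(i in C | P i) a i <= \sum_(i in C | P i) v x i.
    by apply: leq_sum => l _; exact: aP.
  have : m < \sum_(i in C) a i + #|I|.
    apply: leq_trans big _; under eq_bigr do rewrite -addn1.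
    by rewrite big_split/= leq_add2l sum1_card max_card.
  rewrite -(vsum x) (bigD1 j)//= => h; case: ifPn => jC.
    move: h; rewrite [X in _ < X + _](bigD1 j)//= addnAC => h.
    rewrite -(leq_add2r (\sum_(i in C | i != j) a i)); apply: leq_trans (ltnW h).
    rewrite leq_add2l; apply: leq_trans (aC _) _.
    by rewrite [X in _ <= X](bigID (mem C))/= [X in _ <= X + _](eq_bigl _ _ (fun=> andbC _ _)) leq_addr.
  rewrite -(leq_add2r (\sum_(i in C) a i)) add0n [X in _ <= X]addnC.
  apply: leq_trans (ltnW h); rewrite leq_add2l.
  have := aC xpredT; under eq_bigl do rewrite andbT.
  under [X in _ <= X -> _]eq_bigl do rewrite andbT.
  move/leq_trans; apply; rewrite [X in _ <= X](bigID (mem C))/=.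
  rewrite [X in _ <= X + _](eq_bigl (mem C)) ?leq_addr// => l /=.
  by rewrite andbC; case: eqVneq => [->|]; rewrite ?(negPf jC)// andbT.
(* The default [x0] is not reached for [i] in [C]. *)
pose q i := odflt x0 [pick x in S | c (v x) == i].
have qP i : i \in C -> q i \in S /\ c (v (q i)) = i.
  move=> /cS[x xs xi]; rewrite /q; case: pickP => [y /andP[? /eqP]//|/(_ x)].
  by rewrite xs xi eqxx.
exists C, (fun i => v (q i)); split => [|i _|i /qP[]//|i j /qP[qs _] jC|i i' j /qP[qs _] /qP[qs' _]].
- by exists iC.
- exact: vsum.
- by have := excess j _ qs; rewrite (negPf jC).
apply: leq_trans (excess j _ qs) _; rewrite leq_add2r.
by case: ifP => // _; exact: aP.
Qed.

From mathcomp Require Import all_order all_algebra.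
From mathcomp Require Import all_classical all_reals all_analysis.
From mathcomp Require Import measurable_realfun.
From mathcomp Require Import ring lra.

Import Order.TTheory GRing.Theory Num.Theory.
Import numFieldNormedType.Exports.

Local Open Scope classical_set_scope.
Local Open Scope ring_scope.

(** * Schauder's fixed point theorem *)

(** A cluster point exists by compactness of [[-M, M]]; the ultrafilter contains each ball around it
    or the complement, and the complement would contradict clustering. *)
Lemma ultra_bounded_cvg (R : realType) (T : Type) (U : set_system T)
    (f : T -> R) (M : R) : UltraFilter U -> (forall n, `|f n| <= M) ->
  exists l, forall e : R, 0 < e -> \forall n \near U, `|f n - l| < e.
Proof.
move=> UU fM; have UP := @ultra_proper _ _ UU.
have /(_ (f @ U) (fmap_proper_filter f UP))[|p [_ pcl]] := @segment_compact R (- M) M.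
  by apply: (@filterE _ U _ (f @^-1` _)) => n /=; rewrite in_itv/= -ler_norml.
exists p => e e0; have [//|Un] := in_ultra_setVsetC [set n | `|f n - p| < e] UU.
have [] := pcl (~` ball p e) (ball p e); last by move=> x [].
  suff : U (f @^-1` ~` ball p e) by [].
  by apply: filterS Un => n /= h; rewrite /ball/= distrC.
exact: nbhsx_ballx.
Qed.

Lemma near_and (T : Type) (U : set_system T) (P Q : T -> Prop) : Filter U ->
  (\forall n \near U, P n) -> (\forall n \near U, Q n) ->
  \forall n \near U, P n /\ Q n.
Proof. by move=> FU; exact: filterI. Qed.

Lemma near_ex (T : Type) (U : set_system T) (P : T -> Prop) : ProperFilter U ->
  (\forall n \near U, P n) -> exists n, P n.
Proof. by move=> FU; exact: filter_ex. Qed.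

Lemma ultra_ge (R : realType) (T : Type) (U : set_system T) (f : T -> R) (l a : R) :
  ProperFilter U -> (forall e : R, 0 < e -> \forall n \near U, `|f n - l| < e) ->
  (\forall n \near U, a <= f n) -> a <= l.
Proof.
move=> UP fl af; apply/ler_addgt0Pl => e e0.
have /near_ex[n [h1 h2]] := near_and UP (fl e e0) af.
apply: le_trans h2 _; move: h1; rewrite ltr_norml; lra.
Qed.

Lemma ultra_le (R : realType) (T : Type) (U : set_system T) (f : T -> R) (l a : R) :
  ProperFilter U -> (forall e : R, 0 < e -> \forall n \near U, `|f n - l| < e) ->
  (\forall n \near U, f n <= a) -> l <= a.
Proof.
move=> UP fl af; apply/ler_addgt0Pl => e e0.
have /near_ex[n [h1 h2]] := near_and UP (fl e e0) af.
move: h1 h2; rewrite ltr_norml; lra.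
Qed.

Section Schauder.
Context (R : realType) (V : lmodType R) (E : set V) (N : V -> R).
Hypothesis E0 : E 0.
Hypothesis E_lin : forall a x y, E x -> E y -> E (a *: x + y).
Hypothesis N_tri : forall x y, E x -> E y -> N (x + y) <= N x + N y.
Hypothesis N_hom : forall a x, E x -> N (a *: x) = `|a| * N x.

Lemma linD x y : E x -> E y -> E (x + y).
Proof. by move=> Ex Ey; rewrite -[x]scale1r; exact: E_lin. Qed.

Lemma linZ a x : E x -> E (a *: x).
Proof. by move=> Ex; rewrite -[_ *: _]addr0; exact: E_lin. Qed.

Lemma linB x y : E x -> E y -> E (x - y).
Proof. by move=> Ex Ey; rewrite addrC -scaleN1r; exact: E_lin. Qed.

Lemma N0 : N 0 = 0.
Proof. by have := N_hom 0 E0; rewrite scale0r normr0 mul0r. Qed.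

Lemma N_ge0 x : E x -> 0 <= N x.
Proof.
move=> Ex; have Enx : E (- x) by rewrite -scaleN1r; exact: linZ.
have := N_tri Ex Enx; rewrite subrr N0 -[- x]scaleN1r N_hom// normrN1; lra.
Qed.

Lemma N_distC x y : E x -> E y -> N (x - y) = N (y - x).
Proof.
by move=> Ex Ey; rewrite -opprB -[- _]scaleN1r N_hom ?normrN1 ?mul1r//; exact: linB.
Qed.

Lemma N_distD y x z : E x -> E y -> E z -> N (x - z) <= N (x - y) + N (y - z).
Proof.
move=> Ex Ey Ez; rewrite -[x - z](subrKA y); apply: N_tri; exact: linB.
Qed.

Lemma N_sum n (w : 'I_n -> R) (F : 'I_n -> V) : (forall i, E (F i)) ->
  N (\sum_i w i *: F i) <= \sum_i `|w i| * N (F i).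
Proof.
move=> EF; have : E (\sum_i w i *: F i) /\
    N (\sum_i w i *: F i) <= \sum_i `|w i| * N (F i).
  elim/big_rec2: _ => [|i y z _ [Ey le]]; first by rewrite N0.
  split; first exact: E_lin.
  by apply: le_trans (N_tri (linZ _ (EF i)) Ey) _; rewrite N_hom// lerD2l.
by case.
Qed.

Variables (K : set V) (T : V -> V).
Hypothesis KE : K `<=` E.
Hypothesis K_convex : forall n (w : 'I_n -> R) (y : 'I_n -> V),
  (forall i, 0 <= w i) -> \sum_i w i = 1 -> (forall i, K (y i)) ->
  K (\sum_i w i *: y i).
Hypothesis TK : forall x, K x -> K (T x).
Hypothesis T_cont : forall x, K x -> forall e : R, 0 < e ->
  exists2 d : R, 0 < d & forall y, K y -> N (y - x) < d -> N (T y - T x) < e.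

(** The limit point [x] satisfies T x - x = sum_i w_i (T x - y_i), where w_i = 0 unless the colour
    [i] occurs in the cells for [U]-almost all [m]; in that case grid points coloured [i] come
    arbitrarily close to [x], and [T x] is within [e] of [y i] by continuity. *)
Lemma approx_fixed_point n (y : 'I_n.+1 -> V) (e : R) :
  (forall i, K (y i)) -> (forall x, K x -> exists i, N (T x - y i) < e) ->
  exists2 x, K x & N (T x - x) <= e.
Proof.
move=> Ky net.
pose comb (w : 'I_n.+1 -> R) := \sum_i w i *: y i.
pose grid m (p : 'I_n.+1 -> nat) (i : 'I_n.+1) : R := (p i)%:R / m.+1%:R.
have /choice[c cP] : forall x, exists i, K x -> N (T x - y i) < e.
  move=> x; have [Kx|nKx] := pselect (K x); last by exists ord0.
  by have [i iP] := net x Kx; exists i.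
have := fun m => grid_cell ord0 m.+1 (fun p => c (comb (grid m p))).
move=> /choice[C] /choice[p Pp].
have gridP m i : i \in C m -> (forall j, 0 <= grid m (p m i) j) /\
    \sum_j grid m (p m i) j = 1.
  have [_ ps _ _ _] := Pp m => /ps sE; split=> [j|].
    by rewrite divr_ge0// ler0n.
  by rewrite -mulr_suml -natr_sum sE divff// pnatr_eq0.
(* Any vertex may represent its cell, the vertices being within [q m] of one another in each
   coordinate. *)
have /choice[b bC] : forall m, exists i, i \in C m by move=> m; have [] := Pp m.
pose w m := grid m (p m (b m)).
have w_le1 m j : `|w m j| <= 1.
  have [w0 w1] := gridP m _ (bC m); rewrite ger0_norm ?w0//.
  by rewrite -w1 (bigD1 j)//= lerDl sumr_ge0.
have [U [UU Uoo]] := ultraFilterLemma (@eventually_filter).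
have UP := @ultra_proper _ _ UU.
have /choice[wl wlP] j := ultra_bounded_cvg UU (fun m => w_le1 m j).
pose q m : R := #|'I_n.+1|%:R / m.+1%:R.
have q_small (d : R) : 0 < d -> \forall m \near U, q m < d.
  move=> d0; apply: Uoo; have c0 : 0 < #|'I_n.+1|%:R :> R by rewrite card_ord ltr0n.
  have := near_infty_natSinv_lt (PosNum (divr_gt0 d0 c0)).
  by apply: filterS => m /=; rewrite ltr_pdivlMr// mulrC.
have wl_ge0 j : 0 <= wl j.
  apply: (ultra_ge UP (wlP j)); apply: filterE => m.
  by have [h _] := gridP m _ (bC m); exact: h.
have near_w (d : R) : 0 < d -> \forall m \near U, \sum_j `|w m j - wl j| <= d.
  move=> d0; pose d' := d / n.+1%:R.
  have d'0 : 0 < d' by rewrite divr_gt0// ltr0n.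
  have : \forall m \near U, forall j, `|w m j - wl j| < d'.
    by apply: filter_forall => j; exact: wlP.
  apply: filterS => m h; apply: (@le_trans _ _ (\sum_(j < n.+1) d')).
    by apply: ler_sum => j _; exact: ltW.
  by rewrite sumr_const card_ord -mulr_natr divfK// pnatr_eq0.
have wl_sum : \sum_j wl j = 1.
  apply/eqP; rewrite -subr_eq0 -normr_eq0 eq_le normr_ge0 andbT.
  apply/ler_addgt0Pl => d d0; rewrite addr0.
  have /near_ex[m mP] := near_w d d0.
  have [_ <-] := gridP m _ (bC m); rewrite distrC -sumrB.
  exact: le_trans (ler_norm_sum _ _ _) mP.
pose D j := U [set m | j \in C m].
have wlD j : ~ D j -> wl j = 0.
  move=> nD; have [//|Uj] := in_ultra_setVsetC [set m | j \in C m] UU.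
  apply/eqP; rewrite eq_le wl_ge0 andbT; apply/ler_addgt0Pl => d d0; rewrite addr0.
  apply: (ultra_le UP (wlP j)).
  have := near_and UP Uj (q_small d d0); apply: filterS => m [/= /negP jC qd].
  have [_ _ _ le _] := Pp m; apply: le_trans (ltW qd).
  by rewrite ler_pM2r ?invr_gt0 ?ltr0n// ler_nat le.
have Ey i : E (y i) by apply: KE.
have comb_dist v v' : N (comb v - comb v') <= \sum_j `|v j - v' j| * N (y j).
  rewrite /comb -sumrB; under eq_bigr do rewrite -scalerBl.
  exact: N_sum.
have Kx : K (comb wl) by exact: K_convex.
have ETx := KE (TK Kx).
have close j : D j -> N (T (comb wl) - y j) <= e.
  move=> Dj; apply/ler_addgt0Pl => d d0.
  have [r r0 rP] := T_cont Kx d0.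
  pose B := 1 + \sum_j N (y j).
  have NyB i : N (y i) <= B.
    by rewrite /B (bigD1 i)//= addrCA lerDl addr_ge0// sumr_ge0// => *; exact: N_ge0.
  have B0 : 0 < B by rewrite ltr_pwDl// sumr_ge0// => *; exact: N_ge0.
  (* With [r2] for each coordinate of [v - w m], the weights [v] and [wl] differ by at most [2 * r1]
     in total, which moves the combination by at most [2 * r1 * B = r / 2]; the 1 in [B] keeps it
     positive. *)
  pose r1 := r / (4 * B); pose r2 := r1 / n.+1%:R.
  have r10 : 0 < r1 by rewrite divr_gt0// mulr_gt0.
  have r20 : 0 < r2 by rewrite divr_gt0// ltr0n.
  have := near_and UP Dj (near_and UP (q_small r2 r20) (near_w r1 r10)).
  move=> /near_ex[m [/= jC [qm wm]]].
  pose v := grid m (p m j).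
  have Kv : K (comb v) by have [] := gridP m j jC; move=> ? ?; exact: K_convex.
  have vw i : `|v i - w m i| <= q m.
    have [_ _ _ _ le] := Pp m.
    rewrite /v /w /grid -mulrBl normrM (@ger0_norm _ _^-1) ?invr_ge0 ?ler0n//.
    rewrite ler_pM2r ?invr_gt0 ?ltr0n// ler_norml.
    have := le _ _ i jC (bC m); have := le _ _ i (bC m) jC.
    rewrite -!(ler_nat R) !natrD; lra.
  have vwl : \sum_i `|v i - wl i| <= r1 + r1.
    apply: (@le_trans _ _ (\sum_i (`|v i - w m i| + `|w m i - wl i|))).
      by apply: ler_sum => i _; exact: ler_distD.
    rewrite big_split lerD//=.
    apply: (@le_trans _ _ (\sum_(i < n.+1) r2)).
      by apply: ler_sum => i _; exact: le_trans (vw i) (ltW qm).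
    by rewrite sumr_const card_ord -mulr_natr divfK// pnatr_eq0.
  have : N (comb v - comb wl) < r.
    apply: le_lt_trans (comb_dist _ _) _.
    apply: (@le_lt_trans _ _ ((r1 + r1) * B)).
      apply: (@le_trans _ _ (\sum_i `|v i - wl i| * B)).
        by apply: ler_sum => i _; rewrite ler_wpM2l.
      by rewrite -mulr_suml ler_pM2r.
    rewrite /r1 -mulrDl mulrAC -mulf_div divff ?gt_eqF// mulr1; lra.
  move=> /(rP _ Kv) dT.
  apply: le_trans (N_distD ETx (KE (TK Kv)) (Ey j)) _.
  rewrite N_distC//; last exact/KE/TK.
  apply: ltW; rewrite ltrD//.
  have [_ _ cC _ _] := Pp m; have := cP _ Kv.
  by rewrite (cC j jC).
exists (comb wl) => //.
have -> : T (comb wl) - comb wl = \sum_i wl i *: (T (comb wl) - y i).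
  under eq_bigr do rewrite scalerBr.
  by rewrite sumrB -scaler_suml wl_sum scale1r.
apply: le_trans (N_sum _ _) _ => [i|]; first exact: linB.
apply: (@le_trans _ _ (\sum_i wl i * e)); last by rewrite -mulr_suml wl_sum mul1r.
apply: ler_sum => i _; rewrite ger0_norm//.
have [/close|/wlD ->] := pselect (D i); last by rewrite !mul0r.
exact: ler_wpM2l.
Qed.

Hypothesis T_compact : forall x : nat -> V, (forall n, K (x n)) ->
  forall U : set_system nat, UltraFilter U -> \oo `<=` U ->
  exists2 z, K z & forall e : R, 0 < e -> \forall n \near U, N (T (x n) - z) < e.
Hypothesis K_neq0 : K !=set0.

(** Without a finite net, points can be chosen one after the other with images pairwise at distance
    at least [e], and such images have no limit along an ultrafilter finer than [\oo]. The list
    [s k] holds the first [k] images. *)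
Lemma finite_net (e : R) : 0 < e -> exists n (y : 'I_n.+1 -> V),
  (forall i, K (y i)) /\ forall x, K x -> exists i, N (T x - y i) < e.
Proof.
move=> e0; apply: contrapT => nonet; have [x0 Kx0] := K_neq0.
have /choice[F FP] : forall s : seq V, exists x, K x /\
    ((forall y, y \in s -> K y) -> forall y, y \in s -> e <= N (T x - y)).
  move=> s; have [Ks|] := pselect (forall y, y \in s -> K y); last by exists x0.
  case: s Ks => [_|y0 s Ks]; first by exists x0.
  apply: contrapT => nx; apply: nonet.
  exists (size s), (fun i => nth 0 (y0 :: s) i); split => [i|x Kx].
    by apply: Ks; apply: mem_nth; exact: ltn_ord.
  apply: contrapT => nexi; apply: nx; exists x; split => // _ y ys.
  rewrite leNgt; apply/negP => lt; apply: nexi.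
  have ys' := ys; rewrite -index_mem in ys'.
  by exists (Ordinal ys') => /=; rewrite nth_index.
pose s := fix s k := if k is k'.+1 then T (F (s k')) :: s k' else [::].
have Ks k y : y \in s k -> K y.
  elim: k y => //= k ih y; rewrite inE => /orP[/eqP ->|/ih//].
  by apply: TK; have [] := FP (s k).
have sm i j : (i < j)%N -> T (F (s i)) \in s j.
  elim: j => // j ih; rewrite ltnS leq_eqVlt => /orP[/eqP ->|/ih] /=.
    by rewrite inE eqxx.
  by rewrite inE orbC => ->.
have KF k : K (F (s k)) by have [] := FP (s k).
have [U [UU Uoo]] := ultraFilterLemma (@eventually_filter).
have UP := @ultra_proper _ _ UU.
have [z Kz zP] := T_compact KF UU Uoo.
have e20 : 0 < e / 2 by rewrite divr_gt0.
have [i iP] := near_ex UP (zP _ e20).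
have [j [jP ij]] := near_ex UP (near_and UP (zP _ e20) (Uoo _ (nbhs_infty_gt i))).
have [_ /(_ (Ks j) _ (sm _ _ ij))] := FP (s j).
apply/negP; rewrite -ltNge; have ET k := KE (TK (KF k)).
apply: le_lt_trans (N_distD (ET j) (KE Kz) (ET i)) _.
rewrite (N_distC (KE Kz) (ET i)); move: iP jP => /=; lra.
Qed.

(** A limit of the images of approximate fixed points is also a limit of the points themselves,
    hence fixed by continuity. *)
Theorem schauder : exists2 z, K z & N (T z - z) = 0.
Proof.
have /choice[x xP] : forall k : nat, exists x, K x /\ N (T x - x) <= k.+1%:R^-1.
  move=> k; have k0 : 0 < k.+1%:R^-1 :> R by rewrite invr_gt0 ltr0n.
  have [n [y [Ky net]]] := finite_net k0.
  by have [x ? ?] := approx_fixed_point Ky net; exists x.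
have Kx k : K (x k) by have [] := xP k.
have [U [UU Uoo]] := ultraFilterLemma (@eventually_filter).
have UP := @ultra_proper _ _ UU.
have [z Kz zP] := T_compact Kx UU Uoo.
have [Ez ETz] := (KE Kz, KE (TK Kz)).
exists z => //; apply/eqP; rewrite eq_le N_ge0 ?andbT; last exact: linB.
apply/ler_addgt0Pl => e e0; rewrite addr0.
have e20 : 0 < e / 2 by rewrite divr_gt0.
have [d d0 dP] := T_cont Kz e20.
have d20 : 0 < Num.min (d / 2) (e / 2) by rewrite lt_min e20 divr_gt0.
have := near_and UP (zP _ d20) (Uoo _ (near_infty_natSinv_lt (PosNum d20))).
move=> /(near_ex UP)[k [/= Tz kd]]; have [_ Txx] := xP k.
have [Ex ETx] := (KE (Kx k), KE (TK (Kx k))).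
move: Tz; rewrite lt_min => /andP[Tzd Tze].
move: kd; rewrite lt_min => /andP[kd _].
have {}Txx := le_lt_trans Txx kd.
have /(dP _ (Kx k)) : N (x k - z) < d.
  apply: le_lt_trans (N_distD Ex ETx Ez) _; rewrite (N_distC Ex ETx); lra.
rewrite N_distC// => lt.
apply: le_trans (N_distD ETz ETx Ez) _; lra.
Qed.

End Schauder.

(** * Fixed points under a boundary condition *)

Section Rothe.
Context (R : realType) (V : lmodType R) (E : set V) (N : V -> R).
Hypothesis E0 : E 0.
Hypothesis E_lin : forall a x y, E x -> E y -> E (a *: x + y).
Hypothesis N_tri : forall x y, E x -> E y -> N (x + y) <= N x + N y.
Hypothesis N_hom : forall a x, E x -> N (a *: x) = `|a| * N x.
Variables (C : set V) (r : R) (T : V -> V).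
Hypothesis CE : C `<=` E.
Hypothesis C0 : C 0.
Hypothesis C_lin : forall a x y, 0 <= a -> C x -> C y -> C (a *: x + y).
Hypothesis r_gt0 : 0 < r.
Hypothesis TC : forall x, C x -> N x <= r -> C (T x).
Hypothesis T_cont : forall x, C x -> N x <= r -> forall e : R, 0 < e ->
  exists2 d : R, 0 < d &
    forall y, C y -> N y <= r -> N (y - x) < d -> N (T y - T x) < e.
Hypothesis T_compact : forall x : nat -> V, (forall n, C (x n) /\ N (x n) <= r) ->
  forall U : set_system nat, UltraFilter U -> \oo `<=` U ->
  exists2 z, C z & forall e : R, 0 < e -> \forall n \near U, N (T (x n) - z) < e.
Hypothesis T_bdry : forall x, C x -> N x = r -> N (T x) <= r.

Let theta x := r / Num.max r (N x).
Let Nge0 := N_ge0 E0 E_lin N_tri N_hom.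

Let theta01 x : 0 < theta x <= 1.
Proof.
have m0 : 0 < Num.max r (N x) by rewrite lt_max r_gt0.
by rewrite /theta divr_gt0//= ler_pdivrMr// mul1r le_max lexx.
Qed.

Let rho x := theta x *: x.

Let E_rho x : E x -> E (rho x).
Proof. by move=> Ex; exact: (linZ E0 E_lin). Qed.

(** The difference is [theta x *: (x - y) + (theta x - theta y) *: y]. Both summands have norm at
    most [N (x - y)]: in the second, [theta x - theta y] carries the factor [1 / Num.max r (N y)],
    which compensates [N y]. *)
Let rho_lip x y : E x -> E y -> N (rho x - rho y) <= 2 * N (x - y).
Proof.
move=> Ex Ey; have EB := linB E_lin.
have [mx my] : r <= Num.max r (N x) /\ r <= Num.max r (N y) by rewrite !le_max lexx.
have mx0 := lt_le_trans r_gt0 mx; have my0 := lt_le_trans r_gt0 my.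
have d1 : N x <= N y + N (x - y).
  by rewrite addrC -{1}(subrK y x) N_tri//; exact: EB.
have d2 : N y <= N x + N (x - y).
  by rewrite (N_distC E_lin N_hom Ex Ey) addrC -{1}(subrK x y) N_tri//; exact: EB.
have d0 : 0 <= N (x - y) by apply: Nge0; exact: EB.
have dm : `|Num.max r (N y) - Num.max r (N x)| <= N (x - y).
  rewrite ler_norml; case: (leP r (N x)) => h1; case: (leP r (N y)) => h2;
  apply/andP; split; lra.
have -> : rho x - rho y = theta x *: (x - y) + (theta x - theta y) *: y.
  by rewrite /rho scalerBr scalerBl addrA subrK.
have /andP[tx0 tx1] := theta01 x; have /andP[ty0 ty1] := theta01 y.
apply: le_trans (N_tri (linZ E0 E_lin _ (EB _ _ Ex Ey)) (linZ E0 E_lin _ Ey)) _.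
rewrite !N_hom//; last exact: EB.
rewrite mulr2n mulrDl mul1r lerD//.
  by rewrite (ger0_norm (ltW tx0)) ler_piMl.
have -> : theta x - theta y =
    theta x * ((Num.max r (N y) - Num.max r (N x)) / Num.max r (N y)).
  by rewrite /theta; field; rewrite !gt_eqF.
move: (theta x) tx0 tx1 => t t0 t1; rewrite normrM (ger0_norm (ltW t0)) -mulrA normrM -mulrA.
set A := `|_ - _| * _.
have A0 : 0 <= A by rewrite !mulr_ge0// Nge0.
apply: (@le_trans _ _ A); first by apply: ler_piMl.
apply: le_trans dm; rewrite /A ler_piMr// normfV (gtr0_norm my0).
by rewrite mulrC ler_pdivrMr// mul1r le_max lexx orbT.
Qed.

Let rho_le x : E x -> N (rho x) <= r.
Proof.
move=> Ex; have m0 : 0 < Num.max r (N x) by rewrite lt_max r_gt0.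
have /andP[/ltW tx0 _] := theta01 x.
rewrite N_hom// ger0_norm// /theta mulrAC ler_pdivrMr// ler_wpM2l ?(ltW r_gt0)//.
by rewrite le_max lexx orbT.
Qed.

Let CZ a x : 0 <= a -> C x -> C (a *: x).
Proof. by move=> a0 Cx; rewrite -[_ *: _]addr0; exact: C_lin. Qed.

(* The boundary condition ensures that the radial retraction onto the ball is
   not active at a fixed point of its composition with [T]. *)
Theorem rothe : exists x, [/\ C x, N x <= r & N (T x - x) = 0].
Proof.
pose K := C `&` [set x | N x <= r].
have KE : K `<=` E by move=> x [/CE].
have ET x : K x -> E (T x) by move=> [Cx Nx]; exact/CE/TC.
have EB := linB E_lin.
have Krho x : C x -> K (rho x).
  move=> Cx; have /andP[/ltW t0 _] := theta01 x.
  by split; [exact: CZ|apply: rho_le; exact: CE].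
have [|||||x [Cx Nx] fx] := @schauder _ _ E N E0 E_lin N_tri N_hom K (rho \o T) KE.
- move=> n w y w0 w1 Ky; split.
    elim/big_ind: _ => // [u v Cu Cv|i _]; first by rewrite -[u]scale1r; exact: C_lin.
    by apply: CZ => //; have [] := Ky i.
  apply: le_trans (N_sum E0 E_lin N_tri N_hom _ (fun i => KE _ (Ky i))) _.
  apply: (@le_trans _ _ (\sum_i w i * r)); last by rewrite -mulr_suml w1 mul1r.
  apply: ler_sum => i _; rewrite ger0_norm// ler_wpM2l//.
  by have [] := Ky i.
- by move=> x [Cx Nx]; apply/Krho/TC.
- move=> x Kx e e0; have e20 : 0 < e / 2 by rewrite divr_gt0.
  have [Cx Nx] := Kx; have [d d0 dP] := T_cont Cx Nx e20.
  exists d => // y Ky yx; have [Cy Ny] := Ky; have := dP y Cy Ny yx.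
  have /= := rho_lip (ET _ Ky) (ET _ Kx); lra.
- move=> x Kx U UU Uoo; have [z Cz zP] := T_compact Kx UU Uoo.
  exists (rho z); first exact: Krho.
  move=> e e0; have e20 : 0 < e / 2 by rewrite divr_gt0.
  have UP := @ultra_proper _ _ UU.
  apply: filterS (zP _ e20) => n /=.
  have /= := rho_lip (ET _ (Kx n)) (CE Cz); lra.
- by exists 0; split => //=; rewrite (N0 E0 N_hom) ltW.
have Ex := CE Cx; have ETx := ET x (conj Cx Nx).
exists x; split => //.
have [le|gt] := leP (N (T x)) r.
  move: fx; rewrite /= /rho /theta; move/max_idPl: (le) => ->.
  by rewrite divff ?gt_eqF// scale1r.
exfalso; have Nrho : N (rho (T x)) = r.
  have /andP[/ltW tx0 _] := theta01 (T x).
  rewrite N_hom// ger0_norm// /theta; move/ltW/max_idPr: (gt) => ->.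
  by rewrite divfK// gt_eqF// (lt_trans r_gt0).
have : r <= N x.
  rewrite -Nrho -(subrK x (rho (T x))).
  apply: le_trans (N_tri (EB _ _ (E_rho ETx) Ex) Ex) _.
  by rewrite -/(rho _) (fx : N (rho (T x) - x) = 0) add0r.
move=> rx; have /T_bdry : N x = r by apply/eqP; rewrite eq_le Nx.
by move=> /(_ Cx); rewrite leNgt gt.
Qed.
End Rothe.

(** * One-sided calculus on [0,1] *)

Section Deriv01.
Context {R : realType}.
Implicit Types (u v g : R -> R) (t y l : R).

(** Free of division, so that [y = t] needs no exclusion and errors simply add up; [diffquot_cvgP]
    identifies it with the limit of difference quotients. *)
Definition has_deriv01 u t l := forall e : R, 0 < e -> exists2 d : R, 0 < d &
  forall y, y \in `[0, 1] -> `|y - t| < d ->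
  `|u y - u t - l * (y - t)| <= e * `|y - t|.

Definition cont01 g t := forall e : R, 0 < e -> exists2 d : R, 0 < d &
  forall y, y \in `[0, 1] -> `|y - t| < d -> `|g y - g t| < e.

Lemma near_dnbhs01 t (P : R -> Prop) :
  (within `[0, 1] t^') P <-> exists2 d : R, 0 < d &
    forall y, y \in `[0, 1] -> y != t -> `|y - t| < d -> P y.
Proof.
split=> [/nbhs_ballP[d /= d0 dP]|[d d0 dP]].
  exists d => // y yI yt ytd; apply: dP => //.
  by rewrite /ball/= distrC.
apply/nbhs_ballP; exists d => //= y ytd yt yI; apply: dP => //.
by rewrite distrC.
Qed.

(** This is what makes the limit in [deriv01] unique. Near [t] there is always a point of [0,1] on
    the side of the farther endpoint. *)
Lemma dnbhs01_proper t : t \in `[0, 1] -> ProperFilter (within (`[0, 1] : set R) t^').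
Proof.
move=> tI; split; last exact: within_filter.
move=> /near_dnbhs01[d d0] dP; have := tI; rewrite in_itv/= => /andP[t0 t1].
have d1 : 0 < Num.min d 1 by rewrite lt_min d0/=.
have dd : Num.min d 1 <= d by rewrite ge_min lexx.
have dd1 : Num.min d 1 <= 1 by rewrite ge_min lexx orbT.
set m := Num.min d 1 in d1 dd dd1.
have [t2|t2] := leP t (1 / 2).
  apply: (dP (t + m / 2)).
  - by rewrite in_itv/=; apply/andP; split; lra.
  - by rewrite gt_eqF//; lra.
  - by rewrite ger0_norm; lra.
apply: (dP (t - m / 2)).
- by rewrite in_itv/=; apply/andP; split; lra.
- by rewrite lt_eqF//; lra.
- by rewrite ler0_norm; lra.
Qed.

Lemma diffquot_cvgP u t l :
  diffquot u t @ within `[0, 1] t^' --> l <-> has_deriv01 u t l.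
Proof.
split=> [cv e e0|H].
  have /near_dnbhs01[d d0 dP] :
      (within `[0, 1] t^') (fun y => `|l - diffquot u t y| <= e).
    by move/cvgrPdist_le : cv; apply.
  exists d => // y yI yd; have [->|yt] := eqVneq y t.
    by rewrite !subrr mulr0 subrr normr0 mulr0.
  have := dP y yI yt yd; have yt0 : y - t != 0 by rewrite subr_eq0.
  rewrite -(ler_pM2r (_ : 0 < `|y - t|)) ?normr_gt0// -normrM /diffquot.
  by rewrite mulrBl divfK// distrC.
apply/cvgrPdist_le => e e0; have [d d0 dP] := H e e0.
apply/near_dnbhs01; exists d => // y yI yt yd.
have yt0 : y - t != 0 by rewrite subr_eq0.
rewrite -(ler_pM2r (_ : 0 < `|y - t|)) ?normr_gt0// -normrM /diffquot.
by rewrite mulrBl divfK// -normrN opprB; exact: dP.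
Qed.

Lemma has_deriv01P u t l : t \in `[0, 1] -> has_deriv01 u t l ->
  derivable01 u t /\ deriv01 u t = l.
Proof.
move=> tI /diffquot_cvgP H; have PF := dnbhs01_proper tI.
split; first by apply/cvg_ex; exists l.
exact/cvg_lim.
Qed.

Lemma derivable01P u t : derivable01 u t -> has_deriv01 u t (deriv01 u t).
Proof. by move=> ?; exact/diffquot_cvgP. Qed.

Lemma lin_funE a u v y : (a *: u + v) y = a * u y + v y.
Proof. by []. Qed.

Lemma lin_scaleE a u y : (a *: u) y = a * u y.
Proof. by []. Qed.

Lemma has_deriv01_lin a u v t l l' : has_deriv01 u t l -> has_deriv01 v t l' ->
  has_deriv01 (a *: u + v) t (a * l + l').
Proof.
move=> ul vl e e0; have a0 : 0 < `|a| + 1 by rewrite ltr_pwDr.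
have e1 : 0 < e / 2 / (`|a| + 1) by rewrite !divr_gt0.
have e2 : 0 < e / 2 by rewrite divr_gt0.
have [d d0 dP] := ul _ e1; have [d' d'0 d'P] := vl _ e2.
exists (Num.min d d') => [|y yI]; first by rewrite lt_min d0.
rewrite lt_min => /andP[/(dP _ yI) h1 /(d'P _ yI) h2].
have -> : (a *: u + v) y - (a *: u + v) t - (a * l + l') * (y - t) =
  a * (u y - u t - l * (y - t)) + (v y - v t - l' * (y - t)).
  by rewrite !lin_funE; ring.
apply: le_trans (ler_normD _ _) _; rewrite normrM.
have : `|a| * `|u y - u t - l * (y - t)| <= e / 2 * `|y - t|.
  apply: (@le_trans _ _ ((`|a| + 1) * (e / 2 / (`|a| + 1) * `|y - t|))).
    by apply: ler_pM => //; lra.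
  by rewrite mulrA mulrCA divff ?gt_eqF// mulr1.
lra.
Qed.

Lemma has_deriv01_cont u t l : has_deriv01 u t l -> cont01 u t.
Proof.
move=> ul e e0; have [d d0 dP] := ul 1 ltr01.
have l0 : 0 < `|l| + 1 by rewrite ltr_pwDr.
exists (Num.min d (e / (`|l| + 1))) => [|y yI]; first by rewrite lt_min d0 divr_gt0.
rewrite lt_min ltr_pdivlMr// => /andP[/(dP _ yI) h1 h2].
have := ler_normD (u y - u t - l * (y - t)) (l * (y - t)).
rewrite subrK normrM; lra.
Qed.

Lemma cont01P g t : continuous01_at g t <-> cont01 g t.
Proof.
split=> [/cvgrPdist_lt H e e0|H].
  have /nbhs_ballP[d /= d0 dP] := H e e0; exists d => // y yI yd.
  by rewrite distrC; apply: dP => //; rewrite /ball/= distrC.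
apply/cvgrPdist_lt => e e0; have [d d0 dP] := H e e0.
apply/nbhs_ballP; exists d => //= y yd yI.
by rewrite distrC; apply: dP => //; rewrite distrC.
Qed.

Lemma within_cont01P g : {within `[0, 1], continuous g} <->
  forall t, t \in `[0, 1] -> cont01 g t.
Proof.
split=> [/subspace_continuousP H t tI|H].
  by apply/cont01P; exact: H.
by apply/subspace_continuousP => t tI; exact/cont01P/H.
Qed.

Lemma cont01_lin a u v t : cont01 u t -> cont01 v t -> cont01 (a *: u + v) t.
Proof.
move=> ul vl e e0; have a0 : 0 < `|a| + 1 by rewrite ltr_pwDr.
have e1 : 0 < e / 2 / (`|a| + 1) by rewrite !divr_gt0.
have e2 : 0 < e / 2 by rewrite divr_gt0.
have [d d0 dP] := ul _ e1; have [d' d'0 d'P] := vl _ e2.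
exists (Num.min d d') => [|y yI]; first by rewrite lt_min d0.
rewrite lt_min => /andP[/(dP _ yI) h1 /(d'P _ yI) h2].
have -> : (a *: u + v) y - (a *: u + v) t = a * (u y - u t) + (v y - v t).
  by rewrite !lin_funE; ring.
apply: le_lt_trans (ler_normD _ _) _; rewrite normrM.
have : `|a| * `|u y - u t| <= e / 2.
  apply: (@le_trans _ _ ((`|a| + 1) * (e / 2 / (`|a| + 1)))).
    by apply: ler_pM => //; lra.
  by rewrite mulrC divfK ?gt_eqF.
lra.
Qed.

Lemma cont01_bounded g : (forall t, t \in `[0, 1] -> cont01 g t) ->
  exists M, forall t, t \in `[0, 1] -> `|g t| <= M.
Proof.
move=> gc; have /within_cont01P gw := gc.
have ngw : {within `[0, 1], continuous (- g)}.
  apply/within_cont01P => t /gc h e /h[d d0 dP]; exists d => // y yI /(dP _ yI).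
  by rewrite !opprfctE -opprD normrN.
have [c _ cP] := EVT_max (@ler01 R) gw.
have [c' _ c'P] := EVT_max (@ler01 R) ngw.
exists (Num.max (g c) (- g c')) => t tI; rewrite le_max.
by case: (ger0P (g t)) => _; rewrite ?cP ?c'P ?orbT.
Qed.

(** Membership in [C1_01] can thus be checked with any candidate derivative on [0,1], as [deriv01 u]
    agrees with it there. *)
Lemma C1_01P u : C1_01 u <-> exists2 u' : R -> R,
  forall t, t \in `[0, 1] -> has_deriv01 u t (u' t) &
  forall t, t \in `[0, 1] -> cont01 u' t.
Proof.
split=> [[ud /within_cont01P uc]|[u' ud uc]].
  by exists (deriv01 u) => // t /ud/derivable01P.
have E t : t \in `[0, 1] -> deriv01 u t = u' t.
  by move=> tI; have [] := has_deriv01P tI (ud t tI).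
split=> [t tI|]; first by have [] := has_deriv01P tI (ud t tI).
apply/within_cont01P => t tI e e0; have [d d0 dP] := uc t tI e e0.
by exists d => // y yI yd; rewrite !E//; exact: dP.
Qed.

Lemma C1_has_deriv u t : C1_01 u -> t \in `[0, 1] -> has_deriv01 u t (deriv01 u t).
Proof. by move=> [ud _] /ud/derivable01P. Qed.

Lemma C1_cont u t : C1_01 u -> t \in `[0, 1] -> cont01 u t.
Proof. by move=> uC tI; exact: has_deriv01_cont (C1_has_deriv uC tI). Qed.

Lemma C1_cont_deriv u t : C1_01 u -> t \in `[0, 1] -> cont01 (deriv01 u) t.
Proof. by move=> [_ /within_cont01P h] /h. Qed.

Lemma C1_lin a u v : C1_01 u -> C1_01 v -> C1_01 (a *: u + v).
Proof.
move=> uC vC; apply/C1_01P; exists (a *: deriv01 u + deriv01 v) => t tI.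
  by apply: has_deriv01_lin; exact: C1_has_deriv.
by apply: cont01_lin; exact: C1_cont_deriv.
Qed.

Lemma deriv01_lin a u v t : t \in `[0, 1] -> C1_01 u -> C1_01 v ->
  deriv01 (a *: u + v) t = a * deriv01 u t + deriv01 v t.
Proof.
move=> tI uC vC; have [] := has_deriv01P tI (has_deriv01_lin a
  (C1_has_deriv uC tI) (C1_has_deriv vC tI)); by [].
Qed.

Lemma has_deriv01_id t : has_deriv01 (id : R -> R) t 1.
Proof.
by move=> e e0; exists 1 => // z _ _; rewrite mul1r subrr normr0 mulr_ge0// ltW.
Qed.

Lemma has_deriv01_cst a t : has_deriv01 (cst a) t 0.
Proof.
by move=> e e0; exists 1 => // y _ _; rewrite /cst subrr mul0r subrr normr0 mulr_ge0// ltW.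
Qed.

Lemma cont01_cst a t : cont01 (cst a) t.
Proof. by move=> e e0; exists 1 => // y _ _; rewrite /cst subrr normr0. Qed.

Lemma C1_0 : C1_01 (0 : R -> R).
Proof.
by apply/C1_01P; exists (cst 0) => t _; [exact: has_deriv01_cst|exact: cont01_cst].
Qed.

Lemma deriv01_0 t : t \in `[0, 1] -> deriv01 (0 : R -> R) t = 0.
Proof. by move=> tI; have [] := has_deriv01P tI (has_deriv01_cst 0 t). Qed.

Lemma itv01_0 : (0 : R) \in `[0, 1]. Proof. by rewrite in_itv/= lexx ler01. Qed.

Lemma itv01_1 : (1 : R) \in `[0, 1]. Proof. by rewrite in_itv/= lexx ler01. Qed.

Lemma supnorm_le g M : (forall t, t \in `[0, 1] -> `|g t| <= M) -> supnorm g <= M.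
Proof.
move=> gM; apply: ge_sup; first by exists `|g 0|, 0 => //; exact: itv01_0.
by move=> _ [t tI <-]; exact: gM.
Qed.

Lemma le_supnorm g M t : (forall t, t \in `[0, 1] -> `|g t| <= M) ->
  t \in `[0, 1] -> `|g t| <= supnorm g.
Proof.
move=> gM tI; apply: ub_le_sup; last by exists t.
by exists M => _ [s sI <-]; exact: gM.
Qed.

Lemma cont_le_supnorm g t : (forall t, t \in `[0, 1] -> cont01 g t) ->
  t \in `[0, 1] -> `|g t| <= supnorm g.
Proof. by move=> /cont01_bounded[M]; exact: le_supnorm. Qed.

Lemma C1norm_le u M : (forall t, t \in `[0, 1] -> `|u t| <= M /\ `|deriv01 u t| <= M) ->
  C1norm u <= M.
Proof. by move=> h; rewrite ge_max !supnorm_le// => t /h[]. Qed.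

Lemma le_C1norm u t : C1_01 u -> t \in `[0, 1] -> `|u t| <= C1norm u.
Proof.
move=> uC tI; rewrite le_max cont_le_supnorm// => s; exact: C1_cont.
Qed.

Lemma le_C1norm_deriv u t : C1_01 u -> t \in `[0, 1] -> `|deriv01 u t| <= C1norm u.
Proof.
move=> uC tI; rewrite le_max orbC cont_le_supnorm// => s; exact: C1_cont_deriv.
Qed.

Lemma C1norm_ge0 u : C1_01 u -> 0 <= C1norm u.
Proof. by move=> uC; exact: le_trans (le_C1norm uC itv01_0). Qed.

Lemma C1norm_tri u v : C1_01 u -> C1_01 v -> C1norm (u + v) <= C1norm u + C1norm v.
Proof.
move=> uC vC; apply: C1norm_le => t tI; split.
  by apply: le_trans (ler_normD _ _) _; apply: lerD; exact: le_C1norm.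
have := deriv01_lin 1 tI uC vC; rewrite scale1r mul1r => ->.
by apply: le_trans (ler_normD _ _) _; apply: lerD; exact: le_C1norm_deriv.
Qed.

Lemma C1norm_hom a u : C1_01 u -> C1norm (a *: u) = `|a| * C1norm u.
Proof.
have le (b : R) (w : R -> R) : C1_01 w -> C1norm (b *: w) <= `|b| * C1norm w.
  move=> wC; apply: C1norm_le => t tI; split.
    by rewrite normrM ler_wpM2l// le_C1norm.
  have := deriv01_lin b tI wC C1_0; rewrite addr0 deriv01_0// addr0 => ->.
  by rewrite normrM ler_wpM2l// le_C1norm_deriv.
move=> uC; apply/eqP; rewrite eq_le le//=.
have [->|a0] := eqVneq a 0.
  by rewrite normr0 mul0r scale0r C1norm_ge0//; exact: C1_0.
have aC : C1_01 (a *: u) by rewrite -[_ *: _]addr0; exact: C1_lin uC C1_0.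
have := le a^-1 (a *: u) aC; rewrite scalerA mulVf// scale1r.
by rewrite normfV ler_pdivlMl// normr_gt0.
Qed.
End Deriv01.

(** * Monotonicity from the sign of the derivative almost everywhere *)

Section Monotone.
Context {R : realType}.
Local Notation mu := (@lebesgue_measure R).
Local Notation mR := (measurableTypeR R).

(** Cover the null set by open sets [W k] of measure at most [1 / 2 ^ k.+1] and let [g x] be the sum
    of the measures of the [W k] inside [[0, x]]. Each of the first [n] sets contains a
    neighbourhood of [z], so it contributes slope 1 to the right of [z]; thus [g] has an infinite
    right derivative there. *)
Lemma null_set_majorant (Z : set R) : mu.-negligible Z ->
  exists g : R -> R, [/\ forall x, 0 <= g x <= 1,
    forall x y, 0 <= x -> x <= y -> g x <= g y
  & forall z, Z z -> 0 <= z -> forall n : nat, exists2 d : R, 0 < d &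
      forall y, z < y -> y < z + d -> n%:R * (y - z) <= g y - g z].
Proof.
move=> [A [mA A0 ZA]].
have hp (n : nat) : 0 < 1 / (2 ^ n.+1)%:R :> R by rewrite divr_gt0// ltr0n expn_gt0.
have /choice[W WP] : forall n, exists W : set R,
    [/\ open W, A `<=` W & (mu W <= (1 / (2 ^ n.+1)%:R)%:E)%E].
  move=> n; have [|W [oW AW We]] := lebesgue_regularity_outer mA _ (hp n).
    by rewrite [X in (X < _)%E]A0 ltry.
  exists W; split => //; have mW := open_measurable oW.
  rewrite -(setDUK AW) measureU//; last 2 first.
  - exact: measurableD.
  - by rewrite setDE setICA setICr setI0.
  by rewrite [X in (X + _)%E]A0 add0e ltW.
have mW k : measurable (W k : set mR) by have [oW _ _] := WP k; exact: open_measurable.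
pose G (B : set mR) : \bar R := (\sum_(k <oo) mu (W k `&` B))%E.
have G_ge0 B : (0 <= G B)%E by apply: nneseries_ge0.
have G_le1 B : measurable B -> (G B <= 1)%E.
  move=> mB; apply: le_trans (@epsilon_trick0 R 1 predT ler01).
  apply: lee_nneseries => // k _; have [_ _] := WP k; apply: le_trans.
  apply: le_measure; rewrite ?inE; [exact: measurableI|exact: mW|exact: subIsetl].
have G_fin B : measurable B -> G B \is a fin_num.
  by move=> mB; rewrite ge0_fin_numE// (le_lt_trans (G_le1 B mB))// ltry.
have mI (i : interval R) : measurable ([set` i] : set mR) by exact: measurable_itv.
pose g (x : R) := fine (G `[0, x]%classic).
have gD (x y : R) : 0 <= x -> x <= y -> g y = g x + fine (G `]x, y]%classic).
  move=> x0 xy; rewrite /g -fineD ?G_fin//; congr fine.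
  rewrite /G -nneseriesD//; apply: eq_eseriesr => k _.
  rewrite -measureU; last 3 first.
  - exact: measurableI.
  - exact: measurableI.
  - rewrite setIACA setIid; apply/seteqP; split => // s /= [_].
    by rewrite !in_itv/= => -[]; lra.
  rewrite -setIUr; congr (mu (_ `&` _)); apply/seteqP; split => s /=; rewrite !in_itv/=.
    by move=> h; case: (leP s x) => sx; [left|right]; lra.
  by case; lra.
exists g; split=> [x|x y x0 xy|z Zz z0 n].
- by rewrite fine_ge0//= -lee_fin fineK ?G_le1 ?G_fin.
- by rewrite (gD x y)// lerDl fine_ge0.
have : \forall y \near z, forall k : 'I_n, W k y.
  apply: (@filter_forall _ _ (fun k : 'I_n => W k) (nbhs z) _) => k.
  have [oW AW _] := WP k.
  by apply: open_nbhs_nbhs; split => //; exact/AW/ZA.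
move=> /nbhs_ballP[d /= d0 dP]; exists d => // y zy yd.
rewrite (gD z y z0 (ltW zy)) addrAC subrr add0r -lee_fin fineK ?G_fin//.
apply: le_trans (@nneseries_lim_ge _ _ predT 0%N n _); last by [].
rewrite big_mkord (eq_bigr (fun=> (y - z)%:E)) => [|k _].
  by rewrite sumEFin sumr_const card_ord mulr_natl.
rewrite (_ : _ `&` _ = `]z, y]%classic); last first.
  apply/seteqP; split => [s [] //|s /[dup] + sI] /=; rewrite in_itv/= => /andP[]; rewrite !bnd_simp => zs sy.
  split => //; apply: dP; rewrite /ball/= ler0_norm ?subr_le0 ?(ltW zs)//.
  by rewrite opprB ltrBlDl; exact: le_lt_trans sy yd.
by rewrite lebesgue_measure_itv/= lte_fin zy.
Qed.

(** The supremum of the points [x] with [H a <= H x] is such a point by the condition from the left,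
    and by the condition from the right it can only be [b]. The left condition merely excludes
    downward jumps, so that a nondecreasing summand satisfies it without being continuous. *)
Lemma right_nondecreasing (H : R -> R) (a b : R) : a <= b ->
  (forall x, a <= x -> x < b -> exists2 d : R, 0 < d &
    forall y, x < y -> y < x + d -> y <= b -> H x <= H y) ->
  (forall x, a <= x -> x <= b -> forall e : R, 0 < e -> exists2 d : R, 0 < d &
    forall y, a <= y -> y <= x -> x - d < y -> H y <= H x + e) ->
  H a <= H b.
Proof.
move=> ab Hr Hl; pose S := [set x | a <= x <= b /\ H a <= H x].
have S0 : S a by split => //; rewrite lexx.
have Sb : ubound S b by move=> x [/andP[]].
have hS : has_sup S by split; [exists a|exists b].
have ac : a <= sup S by apply: ub_le_sup => //; exists b.
have cb : sup S <= b by apply: ge_sup => //; exists a.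
have Hc : H a <= H (sup S).
  apply/ler_addgt0Pl => e e0; have [d d0 dP] := Hl _ ac cb _ e0.
  have [x Sx xs] := sup_adherent d0 hS; have [/andP[ax _] Hax] := Sx.
  rewrite addrC; apply: le_trans Hax (dP _ ax _ xs).
  by apply: ub_le_sup => //; exists b.
have [cb'|bc] := ltP (sup S) b; last first.
  by rewrite (_ : b = sup S)//; apply/eqP; rewrite eq_le bc cb.
have [d d0 dP] := Hr _ ac cb'.
pose m := Num.min d (b - sup S).
have m0 : 0 < m by rewrite lt_min d0 subr_gt0.
have md : m <= d by rewrite ge_min lexx.
have mb : m <= b - sup S by rewrite ge_min lexx orbT.
have : sup S + m / 2 <= sup S; last by lra.
apply: ub_le_sup; first by exists b.
split; first by apply/andP; split; lra.
by apply: le_trans Hc (dP _ _ _ _); lra.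
Qed.

(* The exceptional null set is harmless since the derivative is finite there:
   adding [eps] times a majorant makes the right derivatives positive. *)
Lemma has_deriv01_ae_ge0 (F F' : R -> R) (a b : R) :
  (forall t, t \in `[0, 1] -> has_deriv01 F t (F' t)) ->
  {ae mu, forall t, a <= t <= b -> 0 <= F' t} ->
  0 <= a -> a <= b -> b <= 1 -> F a <= F b.
Proof.
move=> FF' aeF' a0 ab b1.
have [g [g01 gmono gZ]] := null_set_majorant aeF'.
(* The term [e * x] absorbs the error of the difference quotient where [F' x >= 0], and [e * g x]
   outweighs a negative [F' x] on the null set. *)
suff step (e : R) : 0 < e -> F a + e * a + e * g a <= F b + e * b + e * g b.
  apply/ler_addgt0Pl => e e0; have e20 : 0 < e / 2 by rewrite divr_gt0.
  have := step _ e20; have /andP[ga ga'] := g01 a; have /andP[gb gb'] := g01 b.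
  have : e / 2 * b <= e / 2 by rewrite ler_piMr// ltW.
  have : e / 2 * g b <= e / 2 by rewrite ler_piMr// ltW.
  have : 0 <= e / 2 * a by rewrite mulr_ge0// ltW.
  have : 0 <= e / 2 * g a by rewrite mulr_ge0// ltW.
  lra.
move=> e0; apply: (@right_nondecreasing (fun x => F x + e * x + e * g x)) => //.
  move=> x ax xb; have xI : x \in `[0, 1] by rewrite in_itv/=; apply/andP; split; lra.
  have [Fx|Fx] := leP 0 (F' x).
    have [d d0 dP] := FF' x xI e e0; exists d => // y xy yd yb.
    have yI : y \in `[0, 1] by rewrite in_itv/=; apply/andP; split; lra.
    have := dP y yI; rewrite ger0_norm ?subr_ge0 ?(ltW xy)// ltrBlDl => /(_ yd).
    rewrite ler_norml => /andP[h _].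
    have : e * g x <= e * g y by rewrite ler_wpM2l ?(ltW e0)//; apply: gmono; lra.
    have : 0 <= F' x * (y - x) by rewrite mulr_ge0//; lra.
    lra.
  have Zx : (~` [set t | a <= t <= b -> 0 <= F' t]) x.
    by move=> /=; rewrite ax (ltW xb) => /(_ isT); lra.
  have x0 : 0 <= x by lra.
  have [d d0 dP] := FF' x xI 1 ltr01.
  (* So large that the slope [n.+1%:R * e] of [e * g] compensates [F' x]; the 1 is the error allowed
     to the difference quotient of [F]. *)
  pose n := Num.truncn ((1 - F' x) / e).
  have nP : 1 - F' x < n.+1%:R * e by rewrite -ltr_pdivrMr// truncnS_gt.
  have [d' d'0 d'P] := gZ x Zx x0 n.+1.
  exists (Num.min d d') => [|y xy]; first by rewrite lt_min d0.
  rewrite -ltrBlDl lt_min => /andP[yd yd'] yb.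
  have yI : y \in `[0, 1] by rewrite in_itv/=; apply/andP; split; lra.
  have := dP y yI; rewrite ger0_norm ?subr_ge0 ?(ltW xy)// => /(_ yd).
  rewrite ler_norml => /andP[h _].
  have : e * (n.+1%:R * (y - x)) <= e * (g y - g x).
    by rewrite ler_wpM2l ?(ltW e0)//; apply: d'P => //; lra.
  have : (1 - F' x) * (y - x) <= n.+1%:R * e * (y - x).
    by rewrite ler_wpM2r ?(ltW nP)// subr_ge0 ltW.
  have : 0 < e * (y - x) by rewrite mulr_gt0// subr_gt0.
  lra.
move=> x ax xb r r0; have xI : x \in `[0, 1] by rewrite in_itv/=; apply/andP; split; lra.
have [d d0 dP] := has_deriv01_cont (FF' x xI) r0.
exists d => // y ay yx xdy.
have yI : y \in `[0, 1] by rewrite in_itv/=; apply/andP; split; lra.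
have := dP y yI; rewrite ler0_norm ?subr_le0// opprB.
have -> : x - y < d by lra.
move=> /(_ isT); rewrite ltr_norml => /andP[_ h].
have : e * g y <= e * g x by rewrite ler_wpM2l ?(ltW e0)//; apply: gmono; lra.
have : e * y <= e * x by rewrite ler_wpM2l ?(ltW e0).
lra.
Qed.
End Monotone.

(** * Null sets of the kernel *)

Section Hull.
Context d (T : measurableType d) (R : realType) (m : {measure set T -> \bar R}).
Local Open Scope ereal_scope.
Local Notation "m^*" := (mu_ext m).

(** Intersect covers whose measures are within [1 / (n + 1)] of the outer measure. *)
Lemma outer_hull (X : set T) : m^* X < +oo ->
  exists A, [/\ measurable A, X `<=` A & m A <= m^* X].
Proof.
move=> Xoo; have X0 : 0 <= m^* X by apply: mu_ext_ge0 => ?; exact: measure_ge0.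
have Xfin : m^* X \is a fin_num by rewrite ge0_fin_numE.
have /choice[A AP] : forall n : nat, exists A : set T,
    [/\ measurable A, X `<=` A & m A <= m^* X + n.+1%:R^-1%:E].
  move=> n; have n0 : (0 < n.+1%:R^-1 :> R)%R by rewrite invr_gt0 ltr0n.
  have [_ [F [mF XF] <-] lt] := lb_ereal_inf_adherent n0 Xfin.
  exists (\bigcup_k F k); split => //; first exact: bigcup_measurable.
  apply: le_trans (ltW lt).
  by apply: measure_sigma_subadditive => //; exact: bigcup_measurable.
have mA n : measurable (A n) by have [] := AP n.
have mI : measurable (\bigcap_n A n) by exact: bigcap_measurable.
exists (\bigcap_n A n); split => // [x Xx n _|]; first by have [_ /(_ x Xx)] := AP n.
apply/lee_addgt0Pr => e e0.
have [n _ nP] := near_infty_natSinv_lt (PosNum e0).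
have [_ _ le] := AP n; apply: (@le_trans _ _ (m (A n))).
  by apply: le_measure; rewrite ?inE//; exact: bigcap_inf.
by apply: le_trans le _; rewrite leeD2l// lee_fin ltW//; apply: (nP n) => /=.
Qed.

(** This brings the completed sigma-algebra of [lebesgue_measurable2] back to the product Borel one,
    up to null sets. Splitting a hull [A] of [D] along [D] leaves outer measure 0 for the
    difference, by finiteness, and [B] is a hull of that difference. *)
Lemma caratheodory_measurable_hull (D : set T) :
  (m^*)%mu.-cara.-measurable (D : set (caratheodory_type (m^*)%mu)) -> m^* D < +oo ->
  exists A B, [/\ measurable A, measurable B, m B = 0, D `<=` A & A `\` D `<=` B].
Proof.
move=> cD Doo; have [A [mA DA Ale]] := outer_hull Doo.
have D0 : 0 <= m^* D by apply: mu_ext_ge0 => ?; exact: measure_ge0.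
have AD0 : 0 <= m^* (A `\` D) by apply: mu_ext_ge0 => ?; exact: measure_ge0.
have Dfin : m^* D \is a fin_num by rewrite ge0_fin_numE.
have : m^* A = m^* (A `&` D) + m^* (A `&` ~` D) := cD A.
rewrite -setDE (setIidr DA) measurable_mu_extE// => mAE.
have AD : m^* (A `\` D) = 0.
  apply/eqP; rewrite eq_le AD0 andbT.
  by move: Ale; rewrite [X in (X <= _)%E]mAE -[X in _ <= X]adde0 leeD2lE.
have [|B [mB ADB Ble]] := @outer_hull (A `\` D); first by rewrite AD ltry.
exists A, B; split => //; apply/eqP; rewrite eq_le measure_ge0 andbT.
by rewrite -AD.
Qed.
End Hull.

(** * Sections of plane sets *)

Section Sections.
Context {R : realType}.
Local Notation mu := (@lebesgue_measure R).
Local Notation mR := (measurableTypeR R).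

Lemma ae_imply (P Q : R -> Prop) : (forall t, P t -> Q t) ->
  {ae mu, forall t, P t} -> {ae mu, forall t, Q t}.
Proof. by move=> PQ; apply: negligibleS; exact: subsetC. Qed.

Lemma null_xsection (B : set (mR * mR)) : measurable B ->
  (mu \x mu)%E B = 0%E <-> {ae mu, forall t, mu (xsection B t) = 0%E}.
Proof.
move=> mB; have mf := measurable_fun_xsection mu mB.
have := ae_eq_integral_abs mu measurableT mf.
rewrite (_ : (\int[mu]_x `|_| = (mu \x mu) B)%E); last first.
  by apply: eq_integral => x _; rewrite gee0_abs.
move=> ->; split; apply: filterS => t /=; last by [].
exact.
Qed.

Lemma null_ysection (B : set (mR * mR)) : measurable B ->
  (mu \x mu)%E B = 0%E <-> {ae mu, forall s, mu (ysection B s) = 0%E}.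
Proof.
move=> mB; have mf := measurable_fun_ysection mu mB.
have := ae_eq_integral_abs mu measurableT mf.
rewrite (_ : (\int[mu]_x `|_| = (mu \x mu) B)%E); last first.
  rewrite (@product_measure_unique _ _ _ _ _ mu mu (mu \x^ mu)%E)//; last first.
    by move=> *; exact: product_measure2E.
  by apply: eq_integral => x _; rewrite gee0_abs.
move=> ->; split; apply: filterS => t /=; last by [].
exact.
Qed.

(** The exchange of quantifiers: null sets of [s] that depend on [t] become, for almost every [s],
    null sets of [t]. *)
Lemma null_sections (B : set (mR * mR)) : measurable B ->
  (forall t, mu (xsection B t) = 0%E) -> {ae mu, forall s, mu (ysection B s) = 0%E}.
Proof.
move=> mB B0; apply/(null_ysection mB)/(null_xsection mB).
exact: nearW.
Qed.

Lemma mitv (i : interval R) : measurable ([set` i] : set mR).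
Proof. exact: measurable_itv. Qed.

Let square : set (mR * mR) := `[0, 1]%classic `*` `[0, 1]%classic.

Let msquare : measurable square.
Proof. by apply: measurableX; exact: mitv. Qed.

(** [D] differs from a Borel set only inside a Borel null set, almost all of whose sections are
    null. *)
Lemma caratheodory_section (D : set (mR * mR)) :
  ((mu \x mu)%E^*)%mu.-cara.-measurable D -> D `<=` square ->
  {ae mu, forall t, exists S N : set mR, [/\ measurable S, measurable N,
    mu N = 0%E & forall s, ~ N s -> D (t, s) <-> S s]}.
Proof.
move=> cD Dsq.
have [|A [B [mA mB B0 DA ADB]]] := caratheodory_measurable_hull cD.
  apply: le_lt_trans (le_mu_ext _ Dsq) _.
  rewrite measurable_mu_extE//= product_measure1E; [|exact: mitv|exact: mitv].
  have E : mu `[0, 1]%classic = 1%E.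
    by rewrite lebesgue_measure_itv/= lte_fin ltr01 sube0.
  change (mu `[0%R, 1%R]%classic * mu `[0%R, 1%R]%classic < +oo)%E.
  by rewrite E mule1 ltry.
have /(null_xsection mB) := B0; apply: filterS => t Bt.
exists (xsection A t), (xsection B t); split => //.
- exact: measurable_xsection.
- exact: measurable_xsection.
move=> s nB; rewrite /xsection/= inE; split=> [/DA//|Ats].
apply: contrapT => nD; apply: nB; rewrite /xsection/= inE.
exact: ADB.
Qed.

Lemma ae_countable (I : countType) (P : I -> R -> Prop) :
  (forall i, {ae mu, forall t, P i t}) -> {ae mu, forall t, forall i, P i t}.
Proof.
move=> H; have : mu.-negligible (\bigcup_n ~` [set t | forall i, pickle i = n -> P i t]).
  apply: negligible_bigcup => n.
  have [[i in']|no] := pselect (exists i : I, pickle i = n); last first.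
    rewrite (_ : ~` _ = set0); first exact: negligible_set0.
    apply/seteqP; split => // t /= h; apply: h => i in'; case: no; by exists i.
  by apply: negligibleS (H i) => t /= nh Pi; apply: nh => j; rewrite -in' => /(pcan_inj pickleK) ->.
apply: negligibleS => t /= h; apply: contrapT => h'; apply: h => i.
by apply: contrapT => nP; apply: h'; exists (pickle i) => //= /(_ i erefl).
Qed.

Lemma ae_null_set (P : R -> Prop) : {ae mu, forall t, P t} ->
  exists N : set mR, [/\ measurable N, mu N = 0%E & forall t, ~ N t -> P t].
Proof.
move=> [N [mN N0 PN]]; exists N; split => // t Nt; apply: contrapT => nP.
exact/Nt/PN.
Qed.

Lemma null_set_ae (N : set mR) (P : R -> Prop) : measurable N -> mu N = 0%E ->
  (forall t, ~ N t -> P t) -> {ae mu, forall t, P t}.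
Proof.
move=> mN N0 NP; exists N; split => // t /= nP; apply: contrapT => Nt.
exact/nP/NP.
Qed.

(** Lebesgue measurability on [0,1], expressed through the Borel sigma-algebra carried by [mR]. *)
Definition ae_measurable_section (g : R -> R) := exists N : set mR,
  [/\ measurable N, mu N = 0%E &
      measurable_fun (`[0, 1]%classic `\` N : set mR) (g : mR -> mR)].

(** Sublevel sets at rational levels suffice, which leaves countably many null sets to discard,
    first of [t] and then of [s]. *)
Lemma kernel_section (k : R -> R -> R) :
  lebesgue_measurable2 (`[0, 1] `*` `[0, 1]) (fun z => k z.1 z.2) ->
  {ae mu, forall t, t \in `[0, 1] -> ae_measurable_section (k t)}.
Proof.
move=> mk; pose D (q : rat) : set (mR * mR) := square `&` [set z | k z.1 z.2 < ratr q].
have cD q : ((mu \x mu)%E^*)%mu.-cara.-measurable (D q).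
  have mI : measurable (`]-oo, (ratr q : R)[%classic : set R) by exact: measurable_itv.
  exact: mk (caratheodory_measurable_mu_ext (mu \x mu)%E msquare) _ mI.
have := ae_countable (fun q => caratheodory_section (cD q) (@subIsetl _ _ _)).
apply: ae_imply => t Dt tI.
have /choice[S /choice[N SN]] := Dt.
pose N0 : set mR := \bigcup_(q : rat) N q.
have mS q : measurable (S q) by have [] := SN q.
exists N0; split.
- by apply: bigcupT_measurable_rat => q; have [] := SN q.
- apply: measure_negligible; first by apply: bigcupT_measurable_rat => q; have [] := SN q.
  have : {ae mu, forall t, forall q, ~ N q t}.
    apply: ae_countable => q; have [_ mN N00 _] := SN q.
    exact: null_set_ae mN N00 (fun t h => h).
  by apply: negligibleS => s /= [q _ Nq] /(_ q).
have mD : measurable (`[0, 1]%classic `\` N0 : set mR).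
  apply: measurableD; first exact: mitv.
  by apply: bigcupT_measurable_rat => q; have [] := SN q.
apply: (measurability _ (RGenInftyO.measurableE R)) => _ [_ [y ->] <-].
rewrite (_ : _ `&` _ = \bigcup_(q : rat) (if ratr q < y then
    (`[0, 1]%classic `\` N0) `&` S q else set0)).
  apply: bigcupT_measurable_rat => q; case: ifP => // _.
  exact: measurableI.
apply/seteqP; split => s.
  move=> [[sI nN]] /=; rewrite in_itv/= => /rat_in_itvoo[q].
  rewrite in_itv/= => /andP[kq qy]; exists q => //; rewrite qy; split => //.
  have [_ _ _ /(_ s) h] := SN q; apply/h; last by split.
  by move=> Nq; apply: nN; exists q.
move=> [q _]; case: ifP => // qy [[sI nN] Sq]; split => //=; rewrite in_itv/=.
have [_ _ _ /(_ s) h] := SN q; apply: lt_trans qy.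
have /h : ~ N q s by move=> Nq; apply: nN; exists q.
by case=> _ /(_ Sq)[].
Qed.
End Sections.

(** * Regularity of the kernel off a common null set *)

Section Kernel.
Context {R : realType}.
Local Notation mu := (@lebesgue_measure R).
Local Notation mR := (measurableTypeR R).
Implicit Types (k : R -> R -> R).

Lemma ae_and (P Q : R -> Prop) : {ae mu, forall t, P t} -> {ae mu, forall t, Q t} ->
  {ae mu, forall t, P t /\ Q t}.
Proof.
move=> hP hQ; have := negligibleU hP hQ; apply: negligibleS => t /= h.
apply: contrapT => /not_orP[/contrapT Pt /contrapT Qt]; exact: h.
Qed.

Lemma ae_neq (a : R) : {ae mu, forall t, t <> a}.
Proof.
apply: (@null_set_ae _ [set a : mR]) => //.
exact: lebesgue_measure_set1.
Qed.

Lemma null_set_complement_dense (N : set mR) (t d : R) :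
  measurable N -> mu N = 0%E -> t \in `[0, 1] -> 0 < d ->
  exists2 t', t' \in `[0, 1] & `|t' - t| < d /\ ~ N t'.
Proof.
move=> mN N0; rewrite in_itv/= => /andP[t0 t1] d0.
apply: contrapT => nex.
have [a [b [ab sub]]] : exists a b : R, a < b /\ `]a, b[%classic `<=` N.
  pose e := Num.min d (1 / 2).
  have e0 : 0 < e by rewrite lt_min d0/=; lra.
  have ed : e <= d by rewrite ge_min lexx.
  have e1 : e <= 1 / 2 by rewrite ge_min lexx orbT.
  have inN s : 0 <= s <= 1 -> `|s - t| < d -> N s.
    by move=> sI sd; apply: contrapT => nN; apply: nex; exists s; rewrite ?in_itv.
  have [t2|t2] := leP t (1 / 2).
    exists t, (t + e); split; first by lra.
    move=> s /=; rewrite in_itv/= => /andP[ts st]; apply: inN; first by lra.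
    by rewrite ger0_norm; lra.
  exists (t - e), t; split; first by lra.
  move=> s /=; rewrite in_itv/= => /andP[ts st]; apply: inN; first by lra.
  by rewrite ler0_norm; lra.
have : (mu `]a, b[%classic <= mu N)%E.
  by apply: le_measure => //; rewrite inE//; exact: mitv.
have -> : mu `]a, b[%classic = (b - a)%:E.
  by rewrite lebesgue_measure_itv/= lte_fin ab.
by rewrite N0 lee_fin; lra.
Qed.

Lemma measurable_section_lim k (t : R) (a : nat -> R) (G : set mR) :
  (forall n, a n \in `[0, 1]) -> (forall n, `|a n - t| < n.+1%:R^-1) ->
  (forall s, G s -> cont01 (k ^~ s) t) ->
  (forall n, measurable_fun G (k (a n) : mR -> mR)) ->
  measurable_fun G (k t : mR -> mR).
Proof.
move=> aI at_ kc mk; apply: (measurable_fun_cvg mk) => s Gs.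
apply/cvgrPdist_lt => e e0; have [d d0 dP] := kc s Gs e e0.
apply: filterS (near_infty_natSinv_lt (PosNum d0)) => n /= nd.
by rewrite distrC; apply: dP => //; exact: lt_trans nd.
Qed.

(** Every [t] is a limit of parameters [a n] outside the exceptional null set, and continuity in [t]
    makes [k t] an almost everywhere limit of the sections [k (a n)]. *)
Lemma ae_measurable_section_all k :
  {ae mu, forall t, t \in `[0, 1] -> ae_measurable_section (k t)} ->
  (forall tau : R, tau \in `[0, 1] ->
    {ae mu, forall s, s \in `[0, 1] -> continuous01_at (k ^~ s) tau}) ->
  forall t, t \in `[0, 1] -> ae_measurable_section (k t).
Proof.
move=> /ae_null_set[N [mN N0 kN]] kc t tI.
have n0 n : 0 < n.+1%:R^-1 :> R by rewrite invr_gt0 ltr0n.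
have /choice[a aP] : forall n : nat, exists a, [/\ a \in `[0, 1],
    `|a - t| < n.+1%:R^-1 & ~ N a].
  move=> n; have [a aI [aN aNn]] := null_set_complement_dense mN N0 tI (n0 n).
  by exists a.
have aI n : a n \in `[0, 1] by have [] := aP n.
have /choice[M MP] : forall n, exists M : set mR, [/\ measurable M, mu M = 0%E &
    measurable_fun (`[0, 1]%classic `\` M : set mR) (k (a n) : mR -> mR)].
  by move=> n; have [_ _ nN] := aP n; exact: (kN _ nN (aI n)).
have [C [mC C0 kC]] := ae_null_set (kc t tI).
have mM n : measurable (M n) by have [] := MP n.
pose B : set mR := (\bigcup_n M n) `|` C.
have mB : measurable B by apply: measurableU => //; exact: bigcup_measurable.
exists B; split => //.
  apply: measure_negligible => //; apply: negligibleU; last by exists C; split.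
  by apply: negligible_bigcup => n; exists (M n); split => //; have [] := MP n.
apply: (@measurable_section_lim k t a) => // [n|s [sI nB]|n].
- by have [] := aP n.
- by apply/cont01P/kC => // Cs; apply: nB; right.
have [_ _] := MP n; apply: measurable_funS.
- by apply: measurableD => //; exact: mitv.
- by move=> s [sI nB]; split => // Ms; apply: nB; left; exists n.
Qed.

Definition dyadic (n j : nat) : R := j%:R / 2 ^+ n.

Lemma dyadic_itv n j : (j <= 2 ^ n)%N -> dyadic n j \in `[0, 1].
Proof.
move=> jn; rewrite in_itv/= /dyadic divr_ge0//= ler_pdivrMr ?exprn_gt0//.
by rewrite mul1r -natrX ler_nat.
Qed.

Lemma exp2_gt0 n : 0 < 2 ^+ n :> R. Proof. exact: exprn_gt0. Qed.

Lemma exp2V_lt n : (2 ^+ n)^-1 <= n.+1%:R^-1 :> R.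
Proof.
rewrite lef_pV2 ?posrE ?exp2_gt0 ?ltr0n// -natrX ler_nat.
exact: ltn_expl.
Qed.

Definition cell n (t : R) : nat := Num.truncn (t * 2 ^+ n).

Lemma cellP n t : 0 <= t -> dyadic n (cell n t) <= t < dyadic n (cell n t).+1.
Proof.
move=> t0; rewrite /dyadic ler_pdivrMr ?exp2_gt0// ltr_pdivlMr ?exp2_gt0//.
by apply: truncn_itv; rewrite mulr_ge0.
Qed.

Lemma cell_lt n t : 0 <= t < 1 -> (cell n t < 2 ^ n)%N.
Proof.
move=> /andP[t0 t1]; rewrite -(ltr_nat R) natrX.
have /andP[+ _] := cellP n t0; rewrite /dyadic ler_pdivrMr ?exp2_gt0//.
by move=> /le_lt_trans; apply; rewrite -[ltRHS]mul1r ltr_pM2r ?exp2_gt0.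
Qed.

Lemma cell_uniq n j t : dyadic n j <= t < dyadic n j.+1 -> cell n t = j.
Proof.
rewrite /dyadic ler_pdivrMr ?exp2_gt0// ltr_pdivlMr ?exp2_gt0// => h.
exact: truncn_def.
Qed.

Lemma dyadicS n j : dyadic n j.+1 - dyadic n j = (2 ^+ n)^-1.
Proof. by rewrite /dyadic -mulrBl -natrB// subSnn mul1r. Qed.

(** The endpoints straddle [t], and their errors [e * (t - a)] and [e * (b - t)] add up to
    [e * (b - a)]. For a kernel these quotients are constant in [t] on each dyadic interval, which
    yields the joint measurability of the partial derivative. *)
Lemma straddle_cvg u (t l : R) : 0 <= t < 1 -> has_deriv01 u t l ->
  (fun n => 2 ^+ n * (u (dyadic n (cell n t).+1) - u (dyadic n (cell n t)))) @ \oo --> l.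
Proof.
move=> t01 ul; apply/cvgrPdist_le => e e0; have [d d0 dP] := ul e e0.
apply: filterS (near_infty_natSinv_lt (PosNum d0)) => n /= nd.
have t0 : 0 <= t by case/andP: t01.
have /andP[at_ tb] := cellP n t0; have ab := dyadicS n (cell n t).
have cn := cell_lt n t01.
have aI := dyadic_itv (ltnW cn); have bI := dyadic_itv cn.
have nd' := le_lt_trans (exp2V_lt n) nd.
move: (dyadic n (cell n t)) (dyadic n (cell n t).+1) at_ tb ab aI bI => a b at_ tb ab aI bI.
have Ea : `|a - t| = t - a by rewrite ler0_norm ?subr_le0// opprB.
have Eb : `|b - t| = b - t by rewrite ger0_norm// subr_ge0 ltW.
have ta : t - a < d by lra.
have bt : b - t < d by lra.
have := dP _ aI; rewrite Ea => /(_ ta) ha.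
have := dP _ bI; rewrite Eb => /(_ bt) hb.
have -> : l - 2 ^+ n * (u b - u a) = 2 ^+ n *
    ((u a - u t - l * (a - t)) - (u b - u t - l * (b - t))).
  have E : 2 ^+ n * (b - a) = 1 by rewrite ab divff// gt_eqF// exp2_gt0.
  by transitivity (l * (2 ^+ n * (b - a)) - 2 ^+ n * (u b - u a)); [rewrite E mulr1|ring].
rewrite normrM gtr0_norm ?exp2_gt0// -ler_pdivlMl ?exp2_gt0//.
apply: le_trans (ler_normB _ _) _; rewrite -ab; lra.
Qed.

Let mset (i : interval R) := mitv i.

(** Over each dyadic interval the function depends on the second variable alone, so a preimage is a
    union of rectangles. *)
Lemma measurable_straddle k (G : set mR) n : measurable G ->
  (forall t, t \in `[0, 1] -> measurable_fun G (k t : mR -> mR)) ->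
  measurable_fun (`[0, 1[%classic `*` G : set (mR * mR))
    ((fun z => 2 ^+ n * (k (dyadic n (cell n z.1).+1) z.2 - k (dyadic n (cell n z.1)) z.2))
      : mR * mR -> mR).
Proof.
move=> mG mk _ Y mY.
pose g j (s : mR) : mR := 2 ^+ n * (k (dyadic n j.+1) s - k (dyadic n j) s).
rewrite (_ : _ `&` _ = \bigcup_j (if (j < 2 ^ n)%N
    then `[dyadic n j, dyadic n j.+1[%classic `*` (G `&` g j @^-1` Y) else set0)).
  apply: bigcup_measurable => j _; case: ifPn => // jn.
  apply: measurableX; first exact: mset.
  have : measurable_fun G (g j).
    apply: measurable_funM; first exact: measurable_cst.
    apply: measurable_funB; apply: mk; apply: dyadic_itv => //; exact: ltnW.
  exact.
apply/seteqP; split=> [[t s] [[tI Gs] /= Yg]|[t s] [j _]].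
  have t01 : 0 <= t < 1 by move: tI; rewrite /= in_itv.
  have t0 : 0 <= t by case/andP: t01.
  exists (cell n t) => //; rewrite cell_lt//; split => //=.
  by rewrite in_itv/= cellP.
case: ifPn => // jn [/=]; rewrite in_itv/= => jt [Gs Yg].
rewrite /= (cell_uniq jt); split => //; split => //=; rewrite in_itv/=.
have := dyadic_itv (ltnW jn); have := dyadic_itv jn; rewrite !in_itv/=; lra.
Qed.

Lemma measurable_pderiv k (G : set mR) : measurable G ->
  (forall t, t \in `[0, 1] -> measurable_fun G (k t : mR -> mR)) ->
  (forall t s, t \in `[0, 1] -> G s -> has_deriv01 (k ^~ s) t (pderiv k t s)) ->
  measurable_fun (`[0, 1[%classic `*` G : set (mR * mR))
    ((fun z => pderiv k z.1 z.2) : mR * mR -> mR).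
Proof.
move=> mG mk kd; apply: (measurable_fun_cvg (fun n => measurable_straddle n mG mk)).
move=> [t s] [/= tI Gs]; move: tI; rewrite in_itv/= => tI.
apply: (straddle_cvg (u := k ^~ s)) => //; apply: kd => //.
by rewrite in_itv/=; lra.
Qed.

Lemma measurable_snd_rect (G : set mR) (g : mR -> mR) : measurable G ->
  measurable_fun G g ->
  measurable_fun (`[0, 1[%classic `*` G : set (mR * mR)) (fun z : mR * mR => g z.2).
Proof.
move=> mG mg _ Y mY.
rewrite (_ : _ `&` _ = `[0, 1[%classic `*` (G `&` g @^-1` Y)).
  by apply: measurableX; [exact: mset|exact: mg].
by apply/seteqP; split=> [[t s] [[]]|[t s] [? []]].
Qed.

(** The set [B] of the points where a bound fails is measurable by [measurable_pderiv], and its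
    section at each [t] is null by assumption, so [null_sections] applies. *)
Lemma pderiv_section_bounds k (G : set mR) (Psi : mR -> mR) : measurable G ->
  G `<=` `[0, 1]%classic ->
  (forall t, t \in `[0, 1] -> measurable_fun G (k t : mR -> mR)) ->
  (forall t s, t \in `[0, 1] -> G s -> has_deriv01 (k ^~ s) t (pderiv k t s)) ->
  measurable_fun G Psi ->
  (forall t, t \in `[0, 1] ->
     {ae mu, forall s, s \in `[0, 1] -> 0 <= pderiv k t s <= Psi s}) ->
  {ae mu, forall s, G s ->
     {ae mu, forall t, t \in `[0, 1] -> 0 <= pderiv k t s <= Psi s}}.
Proof.
move=> mG GI mk kd mPsi kPsi.
pose D : set (mR * mR) := `[0, 1[%classic `*` G.
have mD : measurable D by apply: measurableX => //; exact: mset.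
pose p (z : mR * mR) : mR := pderiv k z.1 z.2.
have mp : measurable_fun D p by exact: measurable_pderiv.
have mq : measurable_fun D ((fun z => Psi z.2) \- p).
  by apply: measurable_funB => //; exact: measurable_snd_rect.
pose N0 : set mR := `]-oo, 0[%classic.
pose B := (D `&` p @^-1` N0) `|` (D `&` ((fun z => Psi z.2) \- p) @^-1` N0).
have mB : measurable B.
  by apply: measurableU; [apply: mp|apply: mq] => //; exact: mset.
have BP t s : B (t, s) <-> [/\ 0 <= t < 1, G s & ~~ (0 <= pderiv k t s <= Psi s)].
  rewrite /B /D /N0 /p /=; split.
    by case=> -[[/=]]; rewrite !in_itv/= => tI Gs h; split => //; rewrite negb_and -!ltNge;
      apply/orP; [left|right]; lra.
  move=> [tI Gs]; rewrite negb_and -!ltNge => /orP[h|h]; [left|right];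
    split => //=; rewrite !in_itv//=; lra.
have B0 t : mu (xsection B t) = 0%E.
  apply: measure_negligible; first exact: measurable_xsection.
  have [tI|tI] := boolP (t \in `[0, 1]); last first.
    rewrite (_ : xsection _ _ = set0); first exact: negligible_set0.
    apply/seteqP; split => // s; rewrite /xsection/= inE => /BP[t01].
    by move: tI; rewrite in_itv/=; lra.
  apply: negligibleS (kPsi t tI) => s; rewrite /xsection/= inE => /BP[_ Gs nb] h.
  by move: nb; rewrite h//; exact: GI.
apply: ae_imply (null_sections mB B0) => s Bs Gs.
have : {ae mu, forall t, ~ ysection B s t}.
  exists (ysection B s); split => //; first exact: measurable_ysection.
  by move=> t /= /contrapT.
(* [B] lies over [[0, 1[], so the point 1 is discarded. *)
move=> /(ae_and (ae_neq 1)); apply: ae_imply => t [t1 nB] tI.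
apply: contrapT => /negP h; apply: nB; rewrite /ysection/= inE; apply/BP; split => //.
by move: tI; rewrite in_itv/= => /andP[-> t1']; rewrite lt_neqAle t1' andbT; apply/eqP.
Qed.

(* [G] has full measure in [0,1], and the exceptional null sets of the
   assumptions on the kernel are avoided simultaneously by all of its points,
   except the ones on which the continuity of the partial derivative fails. *)
Record regular_on (G : set mR) k (Phi Psi : R -> R) : Prop := RegularOn {
  reg_measurable : measurable G;
  reg_sub : G `<=` `[0, 1]%classic;
  reg_null : mu (`[0, 1]%classic `\` G) = 0%E;
  reg_section : forall t, t \in `[0, 1] -> measurable_fun G (k t : mR -> mR);
  reg_Phi : mu.-integrable G (EFin \o Phi);
  reg_Psi : mu.-integrable G (EFin \o Psi);
  reg_bound : forall t s, t \in `[0, 1] -> G s -> 0 <= k t s <= Phi s;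
  reg_deriv : forall t s, t \in `[0, 1] -> G s ->
    has_deriv01 (k ^~ s) t (pderiv k t s);
  reg_lip : forall s, G s -> forall a b, 0 <= a -> a <= b -> b <= 1 ->
    0 <= k b s - k a s <= Psi s * (b - a);
  reg_cont_deriv : forall tau, tau \in `[0, 1] ->
    {ae mu, forall s, s \in `[0, 1] -> cont01 (pderiv k ^~ s) tau} }.

(** Measurability and the bound by [Phi] are secured at the countably many dyadic [t], and
    continuity in [t] carries them to all of [0,1]. The bound by [Psi] cannot be carried over in
    this way, since the null set off which the derivative is continuous at [tau] depends on [tau];
    it enters through [pderiv_section_bounds] and the Lipschitz estimate. *)
Lemma regular_kernel k : kernel_assumption k -> kernel_deriv_assumption k ->
  exists (G : set mR) (Phi Psi : R -> R), regular_on G k Phi Psi.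
Proof.
move=> [k0 mk kc [Phi iPhi kPhi]] [kd kdc [Psi iPsi kPsi]].
have sec := ae_measurable_section_all (kernel_section mk) kc.
have /choice[M MP] : forall z : nat * nat, exists M : set mR, [/\ measurable M, mu M = 0%E &
    (z.2 <= 2 ^ z.1)%N ->
    measurable_fun (`[0, 1]%classic `\` M : set mR) (k (dyadic z.1 z.2) : mR -> mR)].
  move=> [n j] /=; have [jn|jn] := leqP j (2 ^ n); last by exists set0.
  by have [M [? ? ?]] := sec _ (dyadic_itv jn); exists M.
have aeM : {ae mu, forall s, forall z, ~ M z s}.
  apply: ae_countable => z; have [mM M0 _] := MP z.
  exact: null_set_ae mM M0 (fun _ h => h).
have aePhi : {ae mu, forall s, forall z : nat * nat, (z.2 <= 2 ^ z.1)%N ->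
    s \in `[0, 1] -> 0 <= k (dyadic z.1 z.2) s <= Phi s}.
  apply: (@ae_countable _ _ (fun z s => _)) => -[n j].
  have [jn|jn] := leqP j (2 ^ n).
    by apply: ae_imply (kPhi _ (dyadic_itv jn)) => s h _.
  exact: (@null_set_ae _ set0).
(* The endpoints are discarded because [L1_01] speaks of the open interval. *)
have [N0 [mN0 N00 HN0]] := ae_null_set (ae_and (ae_and aeM aePhi)
  (ae_and kd (ae_and (ae_neq 0) (ae_neq 1)))).
pose G0 : set mR := `[0, 1]%classic `\` N0.
have mG0 : measurable G0 by apply: measurableD => //; exact: mset.
have kd0 t s : t \in `[0, 1] -> G0 s -> has_deriv01 (k ^~ s) t (pderiv k t s).
  move=> tI [sI nN]; have [_ [h _]] := HN0 s nN.
  by apply: derivable01P; exact: h.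
have G0o : G0 `<=` `]0, 1[%classic.
  move=> s [+ nN]; have [_ [_ [/eqP s0 /eqP s1]]] := HN0 s nN.
  by rewrite /= !in_itv/= !lt_neqAle eq_sym s0 s1.
have kc0 t s : t \in `[0, 1] -> G0 s -> cont01 (k ^~ s) t.
  by move=> tI Gs; exact: has_deriv01_cont (kd0 t s tI Gs).
have iPhi0 : mu.-integrable G0 (EFin \o Phi) by apply: integrableS iPhi => //; exact: mset.
have iPsi0 : mu.-integrable G0 (EFin \o Psi) by apply: integrableS iPsi => //; exact: mset.
pose a (t : R) n : R := if t < 1 then dyadic n (cell n t) else dyadic n (2 ^ n).
have aE t n : t \in `[0, 1] -> exists2 j, (j <= 2 ^ n)%N & a t n = dyadic n j.
  rewrite in_itv/= /a => /andP[t0 t1]; case: (ltP t 1) => h; last by exists (2 ^ n)%N.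
  by exists (cell n t) => //; apply/ltnW/cell_lt; rewrite t0.
have aI t n : t \in `[0, 1] -> a t n \in `[0, 1].
  by move=> tI; have [j jn ->] := aE t n tI; exact: dyadic_itv.
have a_near t n : t \in `[0, 1] -> `|a t n - t| < n.+1%:R^-1.
  rewrite in_itv/= /a => /andP[t0 t1]; case: (ltP t 1) => h.
    have := cellP n t0; have : dyadic n (cell n t).+1 - dyadic n (cell n t) <= n.+1%:R^-1.
      by rewrite dyadicS exp2V_lt.
    move: (n.+1%:R^-1) => w ab /andP[at_ tb].
    by rewrite ltr_norml; apply/andP; split; lra.
  have -> : dyadic n (2 ^ n) = 1 by rewrite /dyadic natrX divff// gt_eqF// exp2_gt0.
  have -> : t = 1 by apply/eqP; rewrite eq_le t1.
  by rewrite subrr normr0 invr_gt0 ltr0n.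
have mk0 t : t \in `[0, 1] -> measurable_fun G0 (k t : mR -> mR).
  move=> tI; apply: (@measurable_section_lim k t (a t)) => [n|n|s Gs|n].
  - exact: aI.
  - exact: a_near.
  - exact: kc0.
  have [j jn ->] := aE t n tI; have [mM M0 mkM] := MP (n, j).
  apply: measurable_funS (mkM jn) => //; first by apply: measurableD => //; exact: mset.
  by move=> s [sI nN]; split => //; have [[nM _] _] := HN0 s nN; exact: nM.
have kPhi0 t s : t \in `[0, 1] -> G0 s -> 0 <= k t s <= Phi s.
  move=> tI Gs; have [sI nN] := Gs; have [[_ h] _] := HN0 s nN.
  have cv : (fun n => k (a t n) s) @ \oo --> k t s.
    apply/cvgrPdist_lt => e e0; have [d d0 dP] := kc0 t s tI Gs e e0.
    apply: filterS (near_infty_natSinv_lt (PosNum d0)) => n /= nd.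
    by rewrite distrC; apply: dP; [exact: aI|apply: lt_trans nd; exact: a_near].
  have bnd n : 0 <= k (a t n) s <= Phi s.
    by have [j jn ->] := aE t n tI; exact: (h (n, j)).
  apply/andP; split; rewrite -(cvg_lim _ cv)//.
    by apply: limr_ge; [apply/cvg_ex; exists (k t s)|apply: nearW => n; case/andP: (bnd n)].
  by apply: limr_le; [apply/cvg_ex; exists (k t s)|apply: nearW => n; case/andP: (bnd n)].
have mPsi : measurable_fun G0 (Psi : mR -> mR).
  by apply/measurable_EFinP; exact: measurable_int iPsi0.
have G0I : G0 `<=` `[0, 1]%classic by exact: subIsetl.
have kd0' t s : t \in `[0, 1] -> G0 s -> has_deriv01 (k ^~ s) t (pderiv k t s) by exact: kd0.
have [N1 [mN1 N10 HN1]] := ae_null_set (pderiv_section_bounds mG0 G0I mk0 kd0' mPsi kPsi).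
have lip s : G0 s -> ~ (N0 `|` N1) s -> forall a b, 0 <= a -> a <= b -> b <= 1 ->
    0 <= k b s - k a s <= Psi s * (b - a).
  move=> Gs0 nN x y x0 xy y1.
  have nN1 : ~ N1 s by move=> ?; apply: nN; right.
  have bnd := HN1 s nN1 Gs0.
  apply/andP; split.
    rewrite subr_ge0; apply: (@has_deriv01_ae_ge0 _ (k ^~ s) (pderiv k ^~ s) x y) => // [t tI|].
      exact: kd0.
    apply: ae_imply bnd => t h tI.
    by have /h/andP[] : t \in `[0, 1] by rewrite in_itv/=; lra.
  (* [F t] is [Psi s * t - k t s], with derivative [Psi s - pderiv k t s]. *)
  pose F : R -> R := (- 1) *: (k ^~ s) + (Psi s *: (id : R -> R) + cst 0).
  have : F x <= F y.
    apply: (@has_deriv01_ae_ge0 _ F (fun t => -1 * pderiv k t s + (Psi s * 1 + 0))) => //.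
      move=> t tI; apply: has_deriv01_lin; first exact: kd0.
      by apply: has_deriv01_lin; [exact: has_deriv01_id|exact: has_deriv01_cst].
    apply: ae_imply bnd => t h tI.
    have /h/andP[] : t \in `[0, 1] by rewrite in_itv/=; lra.
    lra.
  rewrite /F !lin_funE /cst; lra.
pose G : set mR := `[0, 1]%classic `\` (N0 `|` N1); exists G, Phi, Psi.
have mG : measurable G by apply: measurableD; [exact: mset|exact: measurableU].
have GG0 : G `<=` G0 by move=> s [sI nN]; split => // ?; apply: nN; left.
split => //.
- exact: subIsetl.
- apply: measure_negligible; first by apply: measurableD => //; exact: mset.
  apply: (@negligibleS _ _ _ _ (N0 `|` N1)).
    by move=> s [sI nG]; apply: contrapT => nN; apply: nG.
  by apply: negligibleU; [exists N0; split|exists N1; split].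
- by move=> t tI; apply: measurable_funS (mk0 t tI).
- exact: integrableS iPhi0.
- exact: integrableS iPsi0.
- by move=> t s tI /GG0 Gs; exact: kPhi0.
- by move=> t s tI /GG0 Gs; exact: kd0.
- move=> s Gs; exact: lip (GG0 s Gs) (proj2 Gs).
by move=> tau tI; apply: ae_imply (kdc tau tI) => s h /h[_] /cont01P.
Qed.
End Kernel.

(** * The linear integral operator *)

Section NullDiff.
Context d (T : measurableType d) (R : realType) (m : {measure set T -> \bar R}).
Local Open Scope ereal_scope.
Import HBNNSimple.

(** No measurability of [f] or [g] is assumed: the integral is a supremum over simple functions, and
    one below [f] comes below [g], with the same integral, once it is set to 0 on [N]. This serves
    on [0,1], where the sections of the kernel are measurable only off a null set. *)
Lemma ge0_le_integral_off_null (N : set T) (f g : T -> \bar R) :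
  measurable N -> m N = 0 -> (forall x, 0 <= f x) -> (forall x, 0 <= g x) ->
  (forall x, ~ N x -> f x = g x) -> \int[m]_x f x <= \int[m]_x g x.
Proof.
move=> mN N0 f0 g0 fg; rewrite ge0_integralTE// ge0_integralTE//.
apply: ge_ereal_sup => _ [h /= hf <-].
pose h' := proj_nnsfun h (measurableC mN).
have h'E x : h' x = (h \_ (~` N)) x by rewrite (mrestrict h (measurableC mN)).
have h'g x : (h' x)%:E <= g x.
  rewrite h'E patchE; case: ifPn => [|_]; last exact: g0.
  by rewrite inE => nNx; rewrite -fg.
apply: (@le_trans _ _ (sintegral m h')); last by apply: ereal_sup_ubound; exists h'.
rewrite -!integralT_nnsfun (@ge0_negligible_integral _ _ _ _ setT N)//; last 2 first.
- exact/measurable_EFinP.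
- by move=> x _; rewrite lee_fin.
rewrite setTD integral_mkcond; apply: ge0_le_integral => //.
- by move=> x _; rewrite patchE; case: ifP => // _; rewrite lee_fin.
- apply/(measurable_restrictT _ _).1; first exact: measurableC.
  by apply: measurable_funTS; exact/measurable_EFinP.
- by apply/measurable_EFinP.
by move=> x _; rewrite h'E !patchE; case: ifP.
Qed.

Lemma integral_setD_null (D N : set T) (f : T -> \bar R) :
  measurable N -> m N = 0 -> \int[m]_(x in D) f x = \int[m]_(x in D `\` N) f x.
Proof.
move=> mN N0; rewrite integralE [RHS]integralE.
suff E (g : T -> \bar R) : (forall x, 0 <= g x) ->
    \int[m]_(x in D) g x = \int[m]_(x in D `\` N) g x by rewrite !E.
move=> g0; rewrite [LHS]integral_mkcond [RHS]integral_mkcond.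
have r0 B x : 0 <= (g \_ B) x by rewrite patchE; case: ifP.
have rE x : ~ N x -> (g \_ D) x = (g \_ (D `\` N)) x.
  move=> Nx; rewrite !patchE; congr (if _ then _ else _).
  by apply/idP/idP; rewrite !inE; [move=> Dx; split|case].
by apply/eqP; rewrite eq_le !(@ge0_le_integral_off_null N)// => x /rE.
Qed.
End NullDiff.

(** * Differentiation under the integral sign *)

Section Operator.
Context {R : realType}.
Local Notation mu := (@lebesgue_measure R).
Local Notation mR := (measurableTypeR R).

Lemma Rintegral_setD_null (D N : set mR) (f : mR -> R) :
  measurable N -> mu N = 0%E ->
  \int[mu]_(x in D) f x = \int[mu]_(x in D `\` N) f x.
Proof. by move=> mN N0; rewrite /Rintegral (integral_setD_null _ _ mN N0). Qed.

(** Passes from sequences to a continuous parameter by contradiction. The value [t = tau] is left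
    out because the lemma is also applied to difference quotients at [tau]. *)
Lemma dominated_convergence_within (G : set mR) (q : R -> R -> R) (p Psi : R -> R) (tau : R) :
  measurable G ->
  (forall t, t \in `[0, 1] -> t != tau -> measurable_fun G (q t : mR -> mR)) ->
  measurable_fun G (p : mR -> mR) -> mu.-integrable G (EFin \o Psi) ->
  (forall t s, t \in `[0, 1] -> t != tau -> G s -> `|q t s| <= Psi s) ->
  {ae mu, forall s, G s -> forall e : R, 0 < e -> exists2 d : R, 0 < d &
    forall t, t \in `[0, 1] -> t != tau -> `|t - tau| < d -> `|q t s - p s| <= e} ->
  forall e : R, 0 < e -> exists2 d : R, 0 < d &
    forall t, t \in `[0, 1] -> t != tau -> `|t - tau| < d ->
    \int[mu]_(s in G) `|q t s - p s| < e.
Proof.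
move=> mG mq mp iPsi qPsi qp e e0; apply: contrapT => nd.
have /choice[t tP] : forall n : nat, exists t, [/\ t \in `[0, 1], t != tau,
    `|t - tau| < n.+1%:R^-1 & e <= \int[mu]_(s in G) `|q t s - p s| ].
  move=> n; apply: contrapT => nt; apply: nd; exists n.+1%:R^-1 => // t tI tt td.
  by rewrite ltNge; apply/negP => le; apply: nt; exists t.
have [|||||_ + _] := @dominated_convergence _ mR R mu G mG
    (fun n => EFin \o q (t n)) (EFin \o p) (EFin \o Psi).
- by move=> n; have [tI tt _ _] := tP n; apply/measurable_EFinP; exact: mq.
- exact/measurable_EFinP.
- apply: ae_imply qp => s h Gs; apply/cvg_EFin; first exact: nearW.
  apply/cvgrPdist_le => r r0; have [d' d0 dP] := h Gs r r0.
  apply: filterS (near_infty_natSinv_lt (PosNum d0)) => n /= nd'.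
  have [tI tt td _] := tP n.
  by rewrite distrC; apply: dP => //; exact: lt_trans nd'.
- exact: iPsi.
- by apply: nearW => s n Gs; have [tI tt _ _] := tP n; rewrite /= lee_fin qPsi.
move=> /fine_cvgP[_ /cvgrPdist_lt/(_ e e0)][n _ /(_ n (leqnn n))].
have [tI tt _ le] := tP n; rewrite /= sub0r normrN ltNge => /negP; apply.
by apply: le_trans le _; exact: ler_norm.
Qed.

Lemma le_Rintegrable (G : set mR) (f g : R -> R) : measurable G -> measurable_fun G (f : mR -> mR) ->
  mu.-integrable G (EFin \o g) -> (forall s, G s -> `|f s| <= g s) ->
  mu.-integrable G (EFin \o f).
Proof.
move=> mG mf ig fg; apply: le_integrable ig => //; first exact/measurable_EFinP.
move=> s Gs /=; rewrite lee_fin; apply: le_trans (fg s Gs) _; exact: ler_norm.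
Qed.

Variables (G : set mR) (k : R -> R -> R) (Phi Psi : R -> R).
Hypothesis reg : regular_on G k Phi Psi.

Let mG := reg_measurable reg.
Let GI := reg_sub reg.
Let mk := reg_section reg.
Let iPhi := reg_Phi reg.
Let iPsi := reg_Psi reg.
Let kPhi := reg_bound reg.
Let kd := reg_deriv reg.
Let kPsi := reg_lip reg.
Let kdc := reg_cont_deriv reg.

Lemma Rintegral_regular (F : R -> R) :
  \int[mu]_(s in `[0, 1]) F s = \int[mu]_(s in G) F s.
Proof.
rewrite (Rintegral_setD_null _ _ (measurableD (mitv `[0, 1]) mG) (reg_null reg)).
congr Rintegral; rewrite setDD; exact/setIidr.
Qed.

Let q tau t s := diffquot (k ^~ s) tau t.

Let q_bounds tau t s : tau \in `[0, 1] -> t \in `[0, 1] -> t != tau -> G s ->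
  0 <= q tau t s <= Psi s.
Proof.
rewrite !in_itv/= /q /diffquot => /andP[a0 a1] /andP[t0 t1]; rewrite neq_lt => /orP[lt|lt] Gs.
  rewrite -opprB -[t - tau]opprB invrN mulrNN.
  have tt : 0 < tau - t by rewrite subr_gt0.
  have /andP[h1 h2] := kPsi Gs t0 (ltW lt) a1.
  by rewrite divr_ge0 ?(ltW tt)//= ler_pdivrMr.
have tt : 0 < t - tau by rewrite subr_gt0.
have /andP[h1 h2] := kPsi Gs a0 (ltW lt) t1.
by rewrite divr_ge0 ?(ltW tt)//= ler_pdivrMr.
Qed.

Let q_cvg tau s : tau \in `[0, 1] -> G s -> forall e : R, 0 < e ->
  exists2 d : R, 0 < d & forall t, t \in `[0, 1] -> t != tau -> `|t - tau| < d ->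
    `|q tau t s - pderiv k tau s| <= e.
Proof.
move=> tI Gs e e0; have [d d0 dP] := kd tI Gs e0; exists d => // t tI' tt td.
have t0 : t - tau != 0 by rewrite subr_eq0.
have h := dP t tI' td; rewrite -(ler_pM2r (_ : 0 < `|t - tau|)) ?normr_gt0//.
by rewrite -normrM mulrBl /q /diffquot divfK.
Qed.

Let mq tau t : tau \in `[0, 1] -> t \in `[0, 1] ->
  measurable_fun G (q tau t : mR -> mR).
Proof.
move=> tI tI'; apply: measurable_funM; last exact: measurable_cst.
by apply: measurable_funB; exact: mk.
Qed.

Let approach tau : tau \in `[0, 1] -> exists t : nat -> R, forall n,
  [/\ t n \in `[0, 1], t n != tau & `|t n - tau| < n.+1%:R^-1].
Proof.
move=> tI; suff /choice[t tP] : forall n, exists t,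
    [/\ t \in `[0, 1], t != tau & `|t - tau| < n.+1%:R^-1] by exists t.
move=> n; have n0 : 0 < n.+1%:R^-1 :> R by rewrite invr_gt0 ltr0n.
have [t tI' [tt tn]] := null_set_complement_dense (measurable_set1 (tau : mR))
  (lebesgue_measure_set1 tau) tI n0.
by exists t; split => //; exact/eqP.
Qed.

Let q_seq_cvg tau s (t : nat -> R) : tau \in `[0, 1] -> G s ->
  (forall n, [/\ t n \in `[0, 1], t n != tau & `|t n - tau| < n.+1%:R^-1]) ->
  (fun n => q tau (t n) s) @ \oo --> pderiv k tau s.
Proof.
move=> tI Gs tP; apply/cvgrPdist_le => e e0.
have [d d0 dP] := q_cvg tI Gs e0.
apply: filterS (near_infty_natSinv_lt (PosNum d0)) => n /= nd.
have [tnI tnt tn] := tP n.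
by rewrite distrC; apply: dP => //; exact: lt_trans nd.
Qed.

Lemma measurable_pderiv_section tau : tau \in `[0, 1] ->
  measurable_fun G (pderiv k tau : mR -> mR).
Proof.
move=> tI; have [t tP] := approach tI.
apply: (@measurable_fun_cvg _ _ _ _ (fun n => q tau (t n))) => [n|s Gs].
  by have [tnI _ _] := tP n; exact: mq.
exact: q_seq_cvg.
Qed.

(** As limits of difference quotients, the derivatives obey the bounds at every point of [G], with
    no exceptional set depending on [tau]. *)
Lemma pderiv_bounds tau s : tau \in `[0, 1] -> G s -> 0 <= pderiv k tau s <= Psi s.
Proof.
move=> tI Gs; have [t tP] := approach tI.
have cv := q_seq_cvg tI Gs tP.
have bnd n : 0 <= q tau (t n) s <= Psi s.
  by have [tnI tnt _] := tP n; exact: q_bounds.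
apply/andP; split; rewrite -(cvg_lim _ cv)//.
  by apply: limr_ge; [apply/cvg_ex; exists (pderiv k tau s)|apply: nearW => n; case/andP: (bnd n)].
by apply: limr_le; [apply/cvg_ex; exists (pderiv k tau s)|apply: nearW => n; case/andP: (bnd n)].
Qed.

(** Like [pderiv_L1], this is convergence in L^1 of the kernel itself, before any function is
    integrated against it; the estimates derived from both are uniform in [g] bounded by [M]. *)
Lemma quotient_L1 tau : tau \in `[0, 1] -> forall e : R, 0 < e ->
  exists2 d : R, 0 < d & forall t, t \in `[0, 1] -> t != tau -> `|t - tau| < d ->
    \int[mu]_(s in G) `|q tau t s - pderiv k tau s| < e.
Proof.
move=> tI; apply: (dominated_convergence_within mG) iPsi _ _.
- by move=> t tI' _; exact: mq.
- exact: measurable_pderiv_section.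
- move=> t s tI' tt Gs; have /andP[h1 h2] := q_bounds tI tI' tt Gs.
  by rewrite ger0_norm.
by apply: nearW => s Gs; exact: q_cvg.
Qed.

Lemma pderiv_L1 tau : tau \in `[0, 1] -> forall e : R, 0 < e ->
  exists2 d : R, 0 < d & forall t, t \in `[0, 1] -> t != tau -> `|t - tau| < d ->
    \int[mu]_(s in G) `|pderiv k t s - pderiv k tau s| < e.
Proof.
move=> tI; apply: (dominated_convergence_within mG) iPsi _ _.
- by move=> t tI' _; exact: measurable_pderiv_section.
- exact: measurable_pderiv_section.
- move=> t s tI' tt Gs; have /andP[h1 h2] := pderiv_bounds tI' Gs.
  by rewrite ger0_norm.
apply: ae_imply (kdc tI) => s h Gs e e0; have [d d0 dP] := h (GI Gs) e e0.
by exists d => // t tI' _ td; apply/ltW/dP.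
Qed.

Definition Kop (g : R -> R) t := \int[mu]_(s in G) (k t s * g s).
Definition Kop' (g : R -> R) t := \int[mu]_(s in G) (pderiv k t s * g s).

Variables (g : R -> R) (M : R).
Hypothesis mg : measurable_fun G (g : mR -> mR).
Hypothesis gM : forall s, G s -> `|g s| <= M.

Let intMg (f F : R -> R) : measurable_fun G (f : mR -> mR) ->
  mu.-integrable G (EFin \o F) -> (forall s, G s -> `|f s| <= F s) ->
  mu.-integrable G (EFin \o (fun s => f s * g s)) /\
  `|\int[mu]_(s in G) (f s * g s)| <= M * \int[mu]_(s in G) `|f s|.
Proof.
move=> mf iF fF; have iF' := le_Rintegrable mG mf iF fF.
have mfg : measurable_fun G ((fun s => f s * g s) : mR -> mR) by exact: measurable_funM.
have iaf : mu.-integrable G (EFin \o (fun s => `|f s|)).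
  by apply: (le_Rintegrable mG _ iF) => [|s Gs]; [exact: measurableT_comp|rewrite normr_id fF].
have iMf : mu.-integrable G (EFin \o (fun s => M * `|f s|)).
  have := integrableZl mG M iaf; apply: eq_integrable => // s _.
have le s : G s -> `|f s * g s| <= M * `|f s|.
  by move=> Gs; rewrite normrM mulrC ler_wpM2r// gM.
have ifg := le_Rintegrable mG mfg iMf le.
split => //; apply: le_trans (le_normr_Rintegral mG ifg) _.
rewrite -RintegralZl//; apply: le_Rintegral => //.
apply: (le_Rintegrable mG _ iMf) => [|s Gs]; first exact: measurableT_comp.
by rewrite normr_id le.
Qed.

Lemma integrable_Kop t : t \in `[0, 1] ->
  mu.-integrable G (EFin \o (fun s => k t s * g s)).
Proof.
move=> tI; have [] // := intMg (mk tI) iPhi.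
by move=> s Gs; have /andP[h1 h2] := kPhi tI Gs; rewrite ger0_norm.
Qed.

Lemma integrable_Kop' t : t \in `[0, 1] ->
  mu.-integrable G (EFin \o (fun s => pderiv k t s * g s)).
Proof.
move=> tI; have [] // := intMg (measurable_pderiv_section tI) iPsi.
by move=> s Gs; have /andP[h1 h2] := pderiv_bounds tI Gs; rewrite ger0_norm.
Qed.

Let iPsi2 : mu.-integrable G (EFin \o (fun s => Psi s + Psi s)).
Proof. by have := integrableD mG iPsi iPsi; apply: eq_integrable. Qed.

Lemma Kop_has_deriv01 t : t \in `[0, 1] -> has_deriv01 (Kop g) t (Kop' g t).
Proof.
move=> tI e e0; have M1 : 0 < `|M| + 1 by rewrite ltr_pwDr.
have [d d0 dP] := quotient_L1 tI (divr_gt0 e0 M1); exists d => // y yI yd.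
have [->|yt] := eqVneq y t.
  by rewrite !subrr mulr0 subrr normr0 mulr0.
have yt0 : y - t != 0 by rewrite subr_eq0.
have [i1 le] : mu.-integrable G (EFin \o (fun s => (q t y s - pderiv k t s) * g s)) /\
    `|\int[mu]_(s in G) ((q t y s - pderiv k t s) * g s)|
      <= M * \int[mu]_(s in G) `|q t y s - pderiv k t s|.
  apply: intMg iPsi2 _.
    by apply: measurable_funB; [exact: mq|exact: measurable_pderiv_section].
  move=> s Gs; have /andP[h1 h2] := q_bounds tI yI yt Gs.
  have /andP[h3 h4] := pderiv_bounds tI Gs.
  by rewrite ler_norml; apply/andP; split; lra.
have -> : Kop g y - Kop g t - Kop' g t * (y - t) =
    (y - t) * \int[mu]_(s in G) ((q t y s - pderiv k t s) * g s).
  rewrite -RintegralZl// /Kop /Kop' -RintegralZr//; last exact: integrable_Kop'.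
  rewrite -!RintegralB//; try exact: integrable_Kop.
  - apply: eq_Rintegral => s _.
    have E : q t y s * (y - t) = k y s - k t s by rewrite /q /diffquot divfK.
    transitivity ((q t y s * (y - t) - pderiv k t s * (y - t)) * g s); last by ring.
    by rewrite E; ring.
  - by have := integrableB mG (integrable_Kop yI) (integrable_Kop tI); apply: eq_integrable.
  by have := integrableZr mG (y - t) (integrable_Kop' tI); apply: eq_integrable.
rewrite normrM mulrC ler_wpM2r//; apply: le_trans le _.
apply: (@le_trans _ _ ((`|M| + 1) * (e / (`|M| + 1)))); last first.
  by rewrite mulrC divfK// gt_eqF.
have I0 : 0 <= \int[mu]_(s in G) `|q t y s - pderiv k t s| by exact: Rintegral_ge0.
apply: (@le_trans _ _ ((`|M| + 1) * \int[mu]_(s in G) `|q t y s - pderiv k t s|)).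
  by rewrite ler_wpM2r//; have := ler_norm M; lra.
by rewrite ler_wpM2l ?(ltW M1)// ltW// dP.
Qed.

Lemma Kop'_modulus t y : t \in `[0, 1] -> y \in `[0, 1] ->
  `|Kop' g y - Kop' g t| <= M * \int[mu]_(s in G) `|pderiv k y s - pderiv k t s|.
Proof.
move=> tI yI; rewrite /Kop' -RintegralB//; try exact: integrable_Kop'.
under eq_Rintegral do rewrite -mulrBl.
have [] // := @intMg (fun s => pderiv k y s - pderiv k t s) _ _ iPsi2.
  by apply: measurable_funB; exact: measurable_pderiv_section.
move=> s Gs; have /andP[h1 h2] := pderiv_bounds yI Gs.
have /andP[h3 h4] := pderiv_bounds tI Gs.
by rewrite ler_norml; apply/andP; split; lra.
Qed.

Lemma Kop_le t : t \in `[0, 1] -> `|Kop g t| <= M * \int[mu]_(s in G) k t s.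
Proof.
move=> tI; have kb s : G s -> `|k t s| = k t s.
  by move=> Gs; have /andP[h1 h2] := kPhi tI Gs; rewrite ger0_norm.
have [_ h] : mu.-integrable G (EFin \o (fun s => k t s * g s)) /\
    `|\int[mu]_(s in G) (k t s * g s)| <= M * \int[mu]_(s in G) `|k t s|.
  by apply: intMg (mk tI) iPhi _ => s Gs; rewrite kb//; case/andP: (kPhi tI Gs).
by apply: le_trans h _; under eq_Rintegral => s /set_mem /kb -> do [].
Qed.

Lemma Kop'_le t : t \in `[0, 1] -> `|Kop' g t| <= M * \int[mu]_(s in G) pderiv k t s.
Proof.
move=> tI; have kb s : G s -> `|pderiv k t s| = pderiv k t s.
  by move=> Gs; have /andP[h1 h2] := pderiv_bounds tI Gs; rewrite ger0_norm.
have [_ h] : mu.-integrable G (EFin \o (fun s => pderiv k t s * g s)) /\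
    `|\int[mu]_(s in G) (pderiv k t s * g s)| <= M * \int[mu]_(s in G) `|pderiv k t s|.
  apply: intMg (measurable_pderiv_section tI) iPsi _ => s Gs.
  by rewrite kb//; case/andP: (pderiv_bounds tI Gs).
by apply: le_trans h _; under eq_Rintegral => s /set_mem /kb -> do [].
Qed.

End Operator.

(** * Compactness in C^1 *)

Section Ascoli.
Context {R : realType}.
Implicit Types (u g : R -> R).

Lemma has_deriv01_nondecreasing u (u' : R -> R) a b :
  (forall t, t \in `[0, 1] -> has_deriv01 u t (u' t)) ->
  (forall t, a <= t <= b -> 0 <= u' t) ->
  0 <= a -> a <= b -> b <= 1 -> u a <= u b.
Proof.
move=> ud u'0; apply: has_deriv01_ae_ge0 ud _.
by apply: (@null_set_ae _ set0) => // t _; exact: u'0.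
Qed.

(** Both [u t + (e - c) * t] and [- u t + (c + e) * t] are nondecreasing on [[a, b]]. *)
Lemma mean_value01 u (u' : R -> R) a b c e :
  (forall t, t \in `[0, 1] -> has_deriv01 u t (u' t)) ->
  (forall t, a <= t <= b -> `|u' t - c| <= e) ->
  0 <= a -> a <= b -> b <= 1 -> `|u b - u a - c * (b - a)| <= e * (b - a).
Proof.
move=> ud u'c a0 ab b1.
have mono (s w : R) : (forall t, a <= t <= b -> 0 <= s * u' t + w) ->
    s * u a + w * a <= s * u b + w * b.
  move=> h; pose F : R -> R := s *: u + (w *: (id : R -> R) + cst 0).
  have : F a <= F b.
    apply: (@has_deriv01_nondecreasing F (fun t => s * u' t + (w * 1 + 0))) => // t tI.
      apply: has_deriv01_lin; first exact: ud.
      by apply: has_deriv01_lin; [exact: has_deriv01_id|exact: has_deriv01_cst].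
    by have := h t tI; lra.
  by rewrite /F !lin_funE /cst; lra.
have h1 : 1 * u a + (e - c) * a <= 1 * u b + (e - c) * b.
  by apply: mono => t /u'c; rewrite ler_norml; lra.
have h2 : -1 * u a + (c + e) * a <= -1 * u b + (c + e) * b.
  by apply: mono => t /u'c; rewrite ler_norml; lra.
by rewrite ler_norml; apply/andP; split; lra.
Qed.

Lemma mean_value01_sym u (u' : R -> R) t y c e :
  (forall t, t \in `[0, 1] -> has_deriv01 u t (u' t)) ->
  (forall s, s \in `[0, 1] -> `|s - t| <= `|y - t| -> `|u' s - c| <= e) ->
  t \in `[0, 1] -> y \in `[0, 1] ->
  `|u y - u t - c * (y - t)| <= e * `|y - t|.
Proof.
move=> ud u'c; rewrite !in_itv/= => /andP[t0 t1] /andP[y0 y1].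
have [ty|yt] := leP t y.
  have E : `|y - t| = y - t by rewrite ger0_norm// subr_ge0.
  rewrite E in u'c *; apply: (mean_value01 ud _ t0 ty y1) => s sI.
  have /andP[ts sy] := sI.
  apply: u'c; first by rewrite in_itv/=; apply/andP; split; lra.
  by rewrite ger0_norm ?subr_ge0//; lra.
have E : `|y - t| = t - y by rewrite ler0_norm ?opprB// subr_le0 ltW.
rewrite E in u'c *.
have := @mean_value01 u u' y t c e ud _ y0 (ltW yt) t1.
have -> : u t - u y - c * (t - y) = - (u y - u t - c * (y - t)) by ring.
rewrite normrN; apply => s sI.
have /andP[ys st] := sI.
apply: u'c; first by rewrite in_itv/=; apply/andP; split; lra.
by rewrite ler0_norm ?subr_le0//; lra.
Qed.

Definition ultra_lim (U : set_system nat) (f : nat -> R) (l : R) :=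
  forall e : R, 0 < e -> \forall n \near U, `|f n - l| < e.

Lemma ultra_lim_lin (U : set_system nat) (f g : nat -> R) (a l m : R) :
  Filter U -> ultra_lim U f l -> ultra_lim U g m ->
  ultra_lim U (fun n => a * f n + g n) (a * l + m).
Proof.
move=> FU fl gm e e0; have a0 : 0 < `|a| + 1 by rewrite ltr_pwDr.
have e1 : 0 < e / 2 / (`|a| + 1) by rewrite !divr_gt0.
have e2 : 0 < e / 2 by rewrite divr_gt0.
have := near_and FU (fl _ e1) (gm _ e2); apply: filterS => n [h1 h2].
have -> : a * f n + g n - (a * l + m) = a * (f n - l) + (g n - m) by ring.
apply: le_lt_trans (ler_normD _ _) _; rewrite normrM.
have : `|a| * `|f n - l| <= e / 2.
  apply: (@le_trans _ _ ((`|a| + 1) * (e / 2 / (`|a| + 1)))).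
    by apply: ler_pM => //; lra.
  by rewrite mulrC divfK ?gt_eqF.
lra.
Qed.

Lemma ultra_lim_norm_le (U : set_system nat) (f : nat -> R) (l e : R) :
  ProperFilter U -> ultra_lim U f l -> (\forall n \near U, `|f n| <= e) -> `|l| <= e.
Proof.
move=> UP fl fe; apply/ler_addgt0Pl => d d0.
have [n [h1 h2]] := near_ex UP (near_and UP (fl d d0) fe).
by rewrite distrC in h1; have := ler_normD (l - f n) (f n); rewrite subrK; lra.
Qed.

(** Ascoli's theorem for the derivatives. Pointwise limits along [U] exist by boundedness, and the
    mean value inequality, passed to the limit, shows that the limit of the derivatives is the
    derivative of [z]. Equicontinuity and compactness of [0,1] make the derivatives converge
    uniformly; the functions are then controlled by their values at 0. *)
Lemma C1_ultra_compact (U : set_system nat) (v : nat -> R -> R) (M : R) :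
  UltraFilter U -> (forall n, C1_01 (v n)) ->
  (forall n t, t \in `[0, 1] -> `|v n t| <= M /\ `|deriv01 (v n) t| <= M) ->
  (forall tau, tau \in `[0, 1] -> forall e : R, 0 < e -> exists2 d : R, 0 < d &
     forall n t, t \in `[0, 1] -> `|t - tau| < d ->
       `|deriv01 (v n) t - deriv01 (v n) tau| <= e) ->
  exists z, [/\ C1_01 z,
    forall t, t \in `[0, 1] -> ultra_lim U (v ^~ t) (z t),
    forall t, t \in `[0, 1] -> ultra_lim U (fun n => deriv01 (v n) t) (deriv01 z t)
  & ultra_lim U (fun n => C1norm (v n - z)) 0].
Proof.
move=> UU vC vM equi; have UP := @ultra_proper _ _ UU; have UF : Filter U by typeclasses eauto.
have /choice[z zP] : forall t, exists l, t \in `[0, 1] -> ultra_lim U (v ^~ t) l.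
  move=> t; have [tI|_] := boolP (t \in `[0, 1]); last by exists 0.
  have [|l lP] := @ultra_bounded_cvg _ _ U (v ^~ t) M UU; last by exists l.
  by move=> n; have [] := vM n t tI.
have /choice[z1 z1P] : forall t, exists l, t \in `[0, 1] ->
    ultra_lim U (fun n => deriv01 (v n) t) l.
  move=> t; have [tI|_] := boolP (t \in `[0, 1]); last by exists 0.
  have [|l lP] := @ultra_bounded_cvg _ _ U (fun n => deriv01 (v n) t) M UU; last by exists l.
  by move=> n; have [] := vM n t tI.
have z1eq tau : tau \in `[0, 1] -> forall e : R, 0 < e -> exists2 d : R, 0 < d &
    forall t, t \in `[0, 1] -> `|t - tau| < d -> `|z1 t - z1 tau| <= e.
  move=> tauI e e0; have [d d0 dP] := equi tau tauI e e0; exists d => // t tI td.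
  have lim := ultra_lim_lin (-1) UF (z1P tau tauI) (z1P t tI).
  have -> : z1 t - z1 tau = -1 * z1 tau + z1 t by ring.
  apply: (ultra_lim_norm_le UP lim); apply: filterE => n.
  by rewrite mulN1r addrC; exact: dP.
have zd t : t \in `[0, 1] -> has_deriv01 z t (z1 t).
  move=> tI e e0; have [d d0 dP] := equi t tI e e0; exists d => // y yI yd.
  have lim := ultra_lim_lin (- (y - t)) UF (z1P t tI)
    (ultra_lim_lin (-1) UF (zP t tI) (zP y yI)).
  have -> : z y - z t - z1 t * (y - t) = - (y - t) * z1 t + (-1 * z t + z y) by ring.
  apply: (ultra_lim_norm_le UP lim); apply: filterE => n.
  have -> : - (y - t) * deriv01 (v n) t + (-1 * v n t + v n y) =
    v n y - v n t - deriv01 (v n) t * (y - t) by ring.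
  apply: mean_value01_sym (fun s => C1_has_deriv (vC n)) _ tI yI => s sI st.
  by apply: dP => //; exact: le_lt_trans yd.
have z1c t : t \in `[0, 1] -> cont01 z1 t.
  move=> tI e e0; have e20 : 0 < e / 2 by rewrite divr_gt0.
  have [d d0 dP] := z1eq t tI _ e20; exists d => // y yI yd.
  by have := dP y yI yd; lra.
have zC : C1_01 z by apply/C1_01P; exists z1.
have zE t : t \in `[0, 1] -> deriv01 z t = z1 t.
  by move=> tI; have [] := has_deriv01P tI (zd t tI).
exists z; split => // [t tI|e e0]; first by rewrite zE//; exact: z1P.
have e40 : 0 < e / 4 by rewrite divr_gt0.
have unif : \forall n \near U, `[0, 1]%classic `<=`
    [set t | t \in `[0, 1] -> `|deriv01 (v n) t - z1 t| < e / 4].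
  have /compact_near_coveringP cov := @segment_compact R 0 1.
  (* Near [tau] the error is at most three times [e / 16]: two moduli of continuity and the
     convergence at [tau]. *)
  apply: cov => tau tauI; have e16 : 0 < e / 16 by rewrite divr_gt0.
  have [d d0 dP] := equi tau tauI _ e16; have [d' d'0 d'P] := z1eq tau tauI _ e16.
  exists (ball tau (Num.min d d'), [set n | `|deriv01 (v n) tau - z1 tau| < e / 16]).
    by split; [apply: nbhsx_ballx; rewrite lt_min d0|exact: z1P].
  move=> [t n] [/= td hn] tI; move: td; rewrite /ball/= lt_min distrC => /andP[td td'].
  have h1 := dP n t tI td; have h2 := d'P t tI td'.
  move: h1 h2 hn; rewrite !ler_norml !ltr_norml => h1 h2 hn.
  by apply/andP; split; lra.
have := near_and UP unif (zP 0 itv01_0 _ e40); apply: filterS => n [hd h0].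
have wC : C1_01 (v n - z) by rewrite addrC -scaleN1r; exact: C1_lin.
have wd t : t \in `[0, 1] -> deriv01 (v n - z) t = deriv01 (v n) t - z1 t.
  move=> tI; rewrite -zE// addrC -scaleN1r deriv01_lin//; ring.
have hd' t : t \in `[0, 1] -> `|deriv01 (v n - z) t| <= e / 4.
  by move=> tI; rewrite wd// ltW// hd.
rewrite subr0 ger0_norm; last exact: C1norm_ge0.
apply: (@le_lt_trans _ _ (e / 2)); last by lra.
apply: C1norm_le => t tI; split; last by have := hd' t tI; lra.
have := @mean_value01_sym (v n - z) (deriv01 (v n - z)) 0 t 0 (e / 4)
  (fun s => C1_has_deriv wC) _ itv01_0 tI.
move=> h.
have {}h : `|(v n - z) t - (v n - z) 0| <= e / 4 * `|t - 0|.
  have <- : (v n - z) t - (v n - z) 0 - 0 * (t - 0) = (v n - z) t - (v n - z) 0.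
    by rewrite mul0r subr0.
  by apply: h => s sI _; rewrite subr0; exact: hd'.
have t1 : `|t - 0| <= 1 by move: tI; rewrite in_itv/= subr0 => /andP[? ?]; rewrite ger0_norm.
have : e / 4 * `|t - 0| <= e / 4 by rewrite ler_piMr// ltW.
have h0' : `|(v n - z) 0| < e / 4 := h0.
have := ler_normD ((v n - z) t - (v n - z) 0) ((v n - z) 0); rewrite subrK.
lra.
Qed.
End Ascoli.

(** * The Hammerstein operator *)

Section Nonlinearity.
Context {R : realType}.
Variable f : R -> R -> R -> R.
Hypothesis f_cont : nonlinearity_assumption f.

Let D : set (R * R * R) := `[0, 1] `*` `[0, +oo[ `*` `[0, +oo[.

Let in_D t a b : t \in `[0, 1] -> 0 <= a -> 0 <= b -> D (t, a, b).
Proof. by move=> tI a0 b0; split; [split|]; rewrite //= in_itv/= ?a0 ?b0. Qed.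

Lemma nonlinearity_ge0 t a b : t \in `[0, 1] -> 0 <= a -> 0 <= b -> 0 <= f t a b.
Proof. by move=> tI a0 b0; exact: f_cont.1 (in_D tI a0 b0). Qed.

Lemma nonlinearity_cont t a b : t \in `[0, 1] -> 0 <= a -> 0 <= b ->
  forall e : R, 0 < e -> exists2 d : R, 0 < d & forall t' a' b',
    t' \in `[0, 1] -> 0 <= a' -> 0 <= b' ->
    `|t' - t| < d -> `|a' - a| < d -> `|b' - b| < d -> `|f t' a' b' - f t a b| < e.
Proof.
move=> tI a0 b0 e e0; have [_ /subspace_continuousP fc] := f_cont.
have /cvgrPdist_lt/(_ e e0) := fc (t, a, b) (in_D tI a0 b0).
move=> /nbhs_ballP[d /= d0 dP]; exists d => // t' a' b' tI' a0' b0' td ad bd.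
rewrite distrC; apply: (dP (t', a', b')); last exact: in_D.
by split => /=; [split|]; rewrite /ball/= distrC.
Qed.

Variable rho : R.

Let box_ge0 t a b : box rho (t, a, b) -> [/\ t \in `[0, 1], 0 <= a & 0 <= b].
Proof. by move=> [[/= tI]]; rewrite !in_itv/= => /andP[a0 _] /andP[b0 _]. Qed.

Let compact_box : compact (box rho : set (R * R * R)).
Proof.
apply: compact_setX; last exact: segment_compact.
by apply: compact_setX; exact: segment_compact.
Qed.

(** Uniformity in [t] as well comes from compactness of the box, with [1 / (n + 1)] in the role of
    [d] in the covering argument. Both points share [t], as they do when two superpositions are
    compared. *)
Lemma nonlinearity_unif_cont (e : R) : 0 < e -> exists2 d : R, 0 < d &
  forall t a b a' b', box rho (t, a, b) -> box rho (t, a', b') ->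
    `|a' - a| < d -> `|b' - b| < d -> `|f t a' b' - f t a b| < e.
Proof.
move=> e0; have e20 : 0 < e / 2 by rewrite divr_gt0.
pose P (n : nat) (z : R * R * R) := box rho z -> forall a' b', box rho (z.1.1, a', b') ->
  `|a' - z.1.2| < n.+1%:R^-1 -> `|b' - z.2| < n.+1%:R^-1 ->
  `|f z.1.1 a' b' - f z.1.1 z.1.2 z.2| < e.
have /compact_near_coveringP cov := compact_box.
have [] := cov nat \oo P _ _; last first.
  move=> n _ /(_ n (leqnn n)) H; exists n.+1%:R^-1; first by rewrite invr_gt0 ltr0n.
  by move=> t a b a' b' bz bz' ad bd; exact: (H (t, a, b) bz bz).
move=> [[t a] b] /box_ge0[tI a0 b0].
have [d d0 dP] := nonlinearity_cont tI a0 b0 e20.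
have d20 : 0 < d / 2 by rewrite divr_gt0.
have core (w t1 a1 b1 a' b' : R) : w < d / 2 -> t1 \in `[0, 1] ->
    0 <= a1 -> 0 <= b1 -> 0 <= a' -> 0 <= b' ->
    `|t - t1| < d / 2 -> `|a - a1| < d / 2 -> `|b - b1| < d / 2 ->
    `|a' - a1| < w -> `|b' - b1| < w -> `|f t1 a' b' - f t1 a1 b1| < e.
  move=> wd t1I a10 b10 a'0 b'0.
  rewrite ![`|_ - t1|]distrC ![`|a - a1|]distrC ![`|b - b1|]distrC.
  move=> t1d a1d b1d ad bd.
  have h1 : `|f t1 a1 b1 - f t a b| < e / 2 by apply: dP => //; lra.
  have ha : `|a' - a| < d by have := ler_distD a1 a' a; lra.
  have hb : `|b' - b| < d by have := ler_distD b1 b' b; lra.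
  have h2 : `|f t1 a' b' - f t a b| < e / 2 by apply: dP => //; lra.
  have := ler_distD (f t a b) (f t1 a' b') (f t1 a1 b1).
  by rewrite [`|f t a b - _|]distrC; lra.
exists (ball (t, a, b) (d / 2), [set n : nat | n.+1%:R^-1 < d / 2]).
  by split; [exact: nbhsx_ballx|exact: near_infty_natSinv_lt (PosNum d20)].
move=> [[[t1 a1] b1] n] [/= [[t1d a1d] b1d] nd] /box_ge0[t1I a10 b10] a' b'.
move=> /box_ge0[_ a'0 b'0] /= ad bd.
exact: (core _ t1 a1 b1 a' b' nd).
Qed.

Lemma le_fmax t a b : box rho (t, a, b) -> f t a b <= fmax f rho.
Proof.
move=> bz; apply: ub_le_sup; last by exists (t, a, b).
have bD : box rho `<=` D.
  move=> [[t' a'] b'] /[dup] /box_ge0[tI a0 b0] _; exact: in_D.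
have := continuous_compact (continuous_subspaceW bD f_cont.2) compact_box.
move=> /(@compact_bounded R R)[M [_ MP]]; exists (M + 1) => y yf.
have M1 : M < M + 1 by lra.
by apply: le_trans (MP _ M1 y yf); exact: ler_norm.
Qed.

Lemma fmin_le t a b : box rho (t, a, b) -> fmin f rho <= f t a b.
Proof.
move=> bz; apply: ge_inf; last by exists (t, a, b).
exists 0 => _ [[[t' a'] b'] /box_ge0[tI a0 b0] <-]; exact: nonlinearity_ge0.
Qed.

Lemma fmin_ge0 : 0 <= rho -> 0 <= fmin f rho.
Proof.
move=> rho0; apply: lb_le_inf.
  exists (f 0 0 0), (0, 0, 0) => //.
  by split; [split|]; rewrite /= in_itv/= lexx ?ler01.
move=> _ [[[t' a'] b'] /box_ge0[tI a0 b0] <-]; exact: nonlinearity_ge0.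
Qed.

(** The Nemytskii operator of [f]. *)
Definition superpose (u : R -> R) (s : R) : R := f s (u s) (deriv01 u s).

Lemma coneP_box u s : coneP u -> C1norm u <= rho -> s \in `[0, 1] ->
  box rho (s, u s, deriv01 u s).
Proof.
move=> [uC u0] ur sI; have [us us'] := u0 s sI.
split; [split|]; rewrite //= in_itv/= ?us ?us'/=.
  by apply: le_trans ur; apply: le_trans (le_C1norm uC sI); exact: ler_norm.
by apply: le_trans ur; apply: le_trans (le_C1norm_deriv uC sI); exact: ler_norm.
Qed.

Lemma superpose_cont u t : coneP u -> t \in `[0, 1] -> cont01 (superpose u) t.
Proof.
move=> [uC u0] tI e e0; have [ut ut'] := u0 t tI.
have [d d0 dP] := nonlinearity_cont tI ut ut' e0.
have [d1 d10 d1P] := C1_cont uC tI d0.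
have [d2 d20 d2P] := C1_cont_deriv uC tI d0.
exists (Num.min d (Num.min d1 d2)) => [|y yI]; first by rewrite !lt_min d0 d10.
rewrite !lt_min => /and3P[yd yd1 yd2]; have [uy uy'] := u0 y yI.
by apply: dP => //; [exact: d1P|exact: d2P].
Qed.

Lemma measurable_superpose u (G : set (measurableTypeR R)) : coneP u ->
  measurable G -> G `<=` `[0, 1]%classic ->
  measurable_fun G (superpose u : measurableTypeR R -> measurableTypeR R).
Proof.
move=> uP mG GI; have mI := mitv (`[0, 1] : interval R).
apply: (measurable_funS mI GI); apply: subspace_continuous_measurable_fun => //.
by apply/within_cont01P => t tI; exact: superpose_cont.
Qed.
End Nonlinearity.

(** * Estimates for the integral operator in the C^1 norm *)

Section KopC1.
Context {R : realType}.
Local Notation mu := (@lebesgue_measure R).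
Local Notation mR := (measurableTypeR R).
Variables (G : set mR) (k : R -> R -> R) (Phi Psi : R -> R).
Hypothesis reg : regular_on G k Phi Psi.
Local Notation Q := (Kop G k).
Local Notation Q' := (Kop' G k).

Definition bounded_meas (g : R -> R) (M : R) :=
  measurable_fun G (g : mR -> mR) /\ forall s, G s -> `|g s| <= M.

(** [d] is chosen before [g]: the modulus comes from [pderiv_L1] and depends on [g] only through
    [M]. This is the source of the compactness of the operator. *)
Lemma Kop'_equicontinuous (M t : R) : t \in `[0, 1] -> forall e : R, 0 < e ->
  exists2 d : R, 0 < d & forall g, bounded_meas g M -> forall y, y \in `[0, 1] ->
    `|y - t| < d -> `|Q' g y - Q' g t| <= e.
Proof.
move=> tI e e0; have M1 : 0 < `|M| + 1 by rewrite ltr_pwDr.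
have [d d0 dP] := pderiv_L1 reg tI (divr_gt0 e0 M1); exists d => // g [mg gM] y yI yd.
have [->|yt] := eqVneq y t; first by rewrite subrr normr0 ltW.
apply: le_trans (Kop'_modulus reg mg gM tI yI) _.
have := dP y yI yt yd.
set I := Rintegral _ _ _ => hI.
have I0 : 0 <= I by exact: Rintegral_ge0.
apply: (@le_trans _ _ ((`|M| + 1) * I)).
  by rewrite ler_wpM2r//; have := ler_norm M; lra.
by rewrite mulrC -ler_pdivlMr// ltW.
Qed.

Lemma Kop_C1 g M : bounded_meas g M -> C1_01 (Q g).
Proof.
move=> gM; apply/C1_01P; exists (Q' g) => t tI.
  by have [mg gb] := gM; exact (@Kop_has_deriv01 _ _ _ _ _ reg g M mg gb t tI).
move=> e e0; have e20 : 0 < e / 2 by rewrite divr_gt0.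
have [d d0 dP] := Kop'_equicontinuous M tI e20; exists d => // y yI yd.
by have := dP g gM y yI yd; lra.
Qed.

Lemma deriv01_Kop g M t : bounded_meas g M -> t \in `[0, 1] -> deriv01 (Q g) t = Q' g t.
Proof.
by move=> [mg gb] tI; have [] := has_deriv01P tI (@Kop_has_deriv01 _ _ _ _ _ reg g M mg gb t tI).
Qed.

Let integrable_k t : t \in `[0, 1] -> mu.-integrable G (EFin \o k t).
Proof.
move=> tI; apply: (le_Rintegrable (reg_measurable reg) _ (reg_Phi reg)).
  exact: (reg_section reg tI).
by move=> s Gs; have /andP[h1 h2] := reg_bound reg tI Gs; rewrite ger0_norm.
Qed.

Let integrable_pderiv t : t \in `[0, 1] -> mu.-integrable G (EFin \o pderiv k t).
Proof.
move=> tI; apply: (le_Rintegrable (reg_measurable reg) _ (reg_Psi reg)).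
  exact: (measurable_pderiv_section reg tI).
by move=> s Gs; have /andP[h1 h2] := pderiv_bounds reg tI Gs; rewrite ger0_norm.
Qed.

(** The kernel is nondecreasing in [t], which is why [Kint] is taken at [t = 1]. *)
Lemma int_kernel_le1 t : t \in `[0, 1] -> \int[mu]_(s in G) k t s <= \int[mu]_(s in G) k 1 s.
Proof.
move=> tI; apply: le_Rintegral; [exact: (reg_measurable reg)|exact: integrable_k|..].
  exact: (integrable_k itv01_1).
move=> s Gs; move: tI; rewrite in_itv/= => /andP[t0 t1].
by have /andP[] := reg_lip reg Gs t0 t1 (lexx _); rewrite subr_ge0.
Qed.

Lemma int_kernel_ge0 t : t \in `[0, 1] -> 0 <= \int[mu]_(s in G) k t s.
Proof. by move=> tI; apply: Rintegral_ge0 => s Gs; case/andP: (reg_bound reg tI Gs). Qed.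

Lemma int_pderiv_ge0 t : t \in `[0, 1] -> 0 <= \int[mu]_(s in G) pderiv k t s.
Proof. by move=> tI; apply: Rintegral_ge0 => s Gs; case/andP: (pderiv_bounds reg tI Gs). Qed.

Lemma Kint_regular : Kint k = \int[mu]_(s in G) k 1 s.
Proof. exact: (Rintegral_regular reg). Qed.

Lemma le_Kstar t : t \in `[0, 1] -> \int[mu]_(s in G) pderiv k t s <= Kstar k.
Proof.
move=> tI; rewrite -(Rintegral_regular reg); apply: ub_le_sup; last by exists t.
(* This bound makes the supremum [Kstar] an actual upper bound. *)
exists (\int[mu]_(s in G) Psi s) => _ [y yI <-]; rewrite (Rintegral_regular reg).
apply: le_Rintegral; [exact: (reg_measurable reg)|exact: integrable_pderiv|exact: (reg_Psi reg)|].
by move=> s Gs; case/andP: (pderiv_bounds reg yI Gs).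
Qed.

Lemma Kint_ge0 : 0 <= Kint k.
Proof. by rewrite Kint_regular; exact: (int_kernel_ge0 itv01_1). Qed.

Lemma Kstar_ge0 : 0 <= Kstar k.
Proof. exact: le_trans (int_pderiv_ge0 itv01_0) (le_Kstar itv01_0). Qed.

Lemma Kop_ge0 g t : (forall s, G s -> 0 <= g s) -> t \in `[0, 1] -> 0 <= Q g t.
Proof.
move=> g0 tI; apply: Rintegral_ge0 => s Gs; rewrite mulr_ge0 ?g0//.
by case/andP: (reg_bound reg tI Gs).
Qed.

Lemma Kop'_ge0 g t : (forall s, G s -> 0 <= g s) -> t \in `[0, 1] -> 0 <= Q' g t.
Proof.
move=> g0 tI; apply: Rintegral_ge0 => s Gs; rewrite mulr_ge0 ?g0//.
by case/andP: (pderiv_bounds reg tI Gs).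
Qed.

Lemma norm_Kop_le g M t : bounded_meas g M -> 0 <= M -> t \in `[0, 1] ->
  `|Q g t| <= M * Kint k.
Proof.
move=> [mg gM] M0 tI; apply: le_trans (Kop_le reg mg gM tI) _.
by rewrite ler_wpM2l// Kint_regular int_kernel_le1.
Qed.

Lemma norm_Kop'_le g M t : bounded_meas g M -> 0 <= M -> t \in `[0, 1] ->
  `|Q' g t| <= M * Kstar k.
Proof.
move=> [mg gM] M0 tI; apply: le_trans (Kop'_le reg mg gM tI) _.
by rewrite ler_wpM2l// le_Kstar.
Qed.

Lemma Kop_ge_cst g M c : bounded_meas g M -> (forall s, G s -> c <= g s) ->
  c * Kint k <= Q g 1.
Proof.
move=> [mg gM] cg; rewrite Kint_regular.
have mG := reg_measurable reg; have ik := integrable_k itv01_1.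
rewrite -RintegralZl//; apply: le_Rintegral => //.
- by have := integrableZl mG c ik; apply: eq_integrable.
- exact: (integrable_Kop reg mg gM itv01_1).
move=> s Gs; rewrite mulrC ler_wpM2l ?cg//.
by case/andP: (reg_bound reg itv01_1 Gs).
Qed.

Lemma C1norm_KopB g1 g2 M1 M2 M : bounded_meas g1 M1 -> bounded_meas g2 M2 -> 0 <= M ->
  (forall s, G s -> `|g1 s - g2 s| <= M) ->
  C1norm (Q g1 - Q g2) <= M * (Kint k + Kstar k).
Proof.
move=> b1 b2 M0 gM; have mG := reg_measurable reg.
have [[m1 l1] [m2 l2]] := (b1, b2).
have b : bounded_meas (fun s => g1 s - g2 s) M by split => //; exact: measurable_funB.
have QB t : t \in `[0, 1] -> Q g1 t - Q g2 t = Q (fun s => g1 s - g2 s) t.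
  move=> tI; rewrite /Kop -RintegralB//.
  - by apply: eq_Rintegral => s _; rewrite mulrBr.
  - exact: (integrable_Kop reg m1 l1 tI).
  - exact: (integrable_Kop reg m2 l2 tI).
have Q'B t : t \in `[0, 1] -> Q' g1 t - Q' g2 t = Q' (fun s => g1 s - g2 s) t.
  move=> tI; rewrite /Kop' -RintegralB//.
  - by apply: eq_Rintegral => s _; rewrite mulrBr.
  - exact: (integrable_Kop' reg m1 l1 tI).
  - exact: (integrable_Kop' reg m2 l2 tI).
have [C1 C2] := (Kop_C1 b1, Kop_C1 b2).
apply: C1norm_le => t tI; split.
  have -> : (Q g1 - Q g2) t = Q (fun s => g1 s - g2 s) t by rewrite -QB.
  apply: le_trans (norm_Kop_le b M0 tI) _.
  by rewrite ler_wpM2l// lerDl Kstar_ge0.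
have -> : deriv01 (Q g1 - Q g2) t = Q' (fun s => g1 s - g2 s) t.
  rewrite -Q'B// addrC -scaleN1r deriv01_lin// (deriv01_Kop b1)// (deriv01_Kop b2)//; ring.
apply: le_trans (norm_Kop'_le b M0 tI) _.
by rewrite ler_wpM2l// lerDr Kint_ge0.
Qed.
End KopC1.

(** * Fixed points of the Hammerstein operator *)

Section Solution.
Context {R : realType}.
Local Notation mu := (@lebesgue_measure R).
Local Notation mR := (measurableTypeR R).
Variables (k : R -> R -> R) (f : R -> R -> R -> R) (gamma1 gamma2 : R -> R)
  (eta1 eta2 lam : R) (h1 h2 : (R -> R) -> R).
Variables (G : set mR) (Phi Psi : R -> R).
Hypothesis reg : regular_on G k Phi Psi.
Hypothesis f_cont : nonlinearity_assumption f.
Hypotheses (gamma1_C1 : gamma_assumption gamma1) (gamma2_C1 : gamma_assumption gamma2).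
Hypotheses (eta1_ge0 : 0 <= eta1) (eta2_ge0 : 0 <= eta2) (lam_ge0 : 0 <= lam).
Hypotheses (h1_cont : functional_assumption h1) (h2_cont : functional_assumption h2).

(** The integral in [Kop] runs over [G], where the integrand is measurable; [Rintegral_regular]
    turns it back into the integral over [0,1]. The nesting suits the lemmas on [a *: u + v]. *)
Definition Hammerstein (u : R -> R) : R -> R :=
  (eta1 * h1 u) *: gamma1 + ((eta2 * h2 u) *: gamma2 + lam *: Kop G k (superpose f u)).

Local Notation T := Hammerstein.

Lemma HammersteinE u t : T u t = eta1 * gamma1 t * h1 u + eta2 * gamma2 t * h2 u
  + lam * Kop G k (superpose f u) t.
Proof.
have -> : T u t = (eta1 * h1 u) * gamma1 t + ((eta2 * h2 u) * gamma2 t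
  + lam * Kop G k (superpose f u) t) by [].
ring.
Qed.

Variable rho : R.
Hypothesis rho_gt0 : 0 < rho.
Let ball u := coneP u /\ C1norm u <= rho.

Let GI s : G s -> s \in `[0, 1]. Proof. by move=> /(reg_sub reg). Qed.

Let box00 : box rho (0, 0, 0).
Proof. by split; [split|]; rewrite /= in_itv/= lexx ?ler01 ?ltW. Qed.

Let fmax_ge0 : 0 <= fmax f rho.
Proof.
by apply: le_trans (le_fmax f_cont box00); apply: nonlinearity_ge0; rewrite ?itv01_0.
Qed.

Let superpose_ge0 u s : coneP u -> G s -> 0 <= superpose f u s.
Proof.
move=> uP Gs; have [u0 u'0] := uP.2 s (GI Gs).
by apply: nonlinearity_ge0 => //; exact: GI.
Qed.

Let superpose_bounded u : ball u -> bounded_meas G (superpose f u) (fmax f rho).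
Proof.
move=> [uP ur]; split.
  exact: (measurable_superpose f_cont uP (reg_measurable reg) (reg_sub reg)).
move=> s Gs; rewrite ger0_norm ?superpose_ge0//.
exact: (le_fmax f_cont (coneP_box uP ur (GI Gs))).
Qed.

Let Kop_superpose_C1 u : ball u -> C1_01 (Kop G k (superpose f u)).
Proof. by move=> /superpose_bounded /(Kop_C1 reg). Qed.

Let C1Z (a : R) (u : R -> R) : C1_01 u -> C1_01 (a *: u).
Proof. by move=> uC; have := C1_lin a uC C1_0; rewrite addr0. Qed.

Let T_C1 u : ball u -> C1_01 (T u).
Proof.
move=> ub; apply: C1_lin; first exact: gamma1_C1.1.
by apply: C1_lin; [exact: gamma2_C1.1|exact/C1Z/Kop_superpose_C1].
Qed.

Let deriv01_T u t : ball u -> t \in `[0, 1] -> deriv01 (T u) t =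
  eta1 * deriv01 gamma1 t * h1 u + eta2 * deriv01 gamma2 t * h2 u
  + lam * Kop' G k (superpose f u) t.
Proof.
move=> ub tI; have KC := Kop_superpose_C1 ub.
rewrite /T deriv01_lin//; [|exact: gamma1_C1.1|]; last first.
  by apply: C1_lin; [exact: gamma2_C1.1|exact: C1Z].
rewrite deriv01_lin//; [|exact: gamma2_C1.1|exact: C1Z].
have := deriv01_lin lam tI KC C1_0; rewrite addr0 deriv01_0// addr0 => ->.
rewrite (deriv01_Kop reg (superpose_bounded ub) tI); ring.
Qed.

Let h_ge0 u : coneP u -> 0 <= h1 u /\ 0 <= h2 u.
Proof. by move=> uP; have [? _ _] := h1_cont; have [? _ _] := h2_cont; split; auto. Qed.

Lemma Hammerstein_cone u : coneP u -> C1norm u <= rho -> coneP (T u).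
Proof.
move=> uP ur; have ub : ball u by [].
have [h10 h20] := h_ge0 uP; split; first exact: T_C1.
move=> t tI; have [g1 g1'] := gamma1_C1.2 t tI; have [g2 g2'] := gamma2_C1.2 t tI.
have s0 s : G s -> 0 <= superpose f u s by exact: superpose_ge0.
split.
  rewrite HammersteinE; apply: addr_ge0; last by rewrite mulr_ge0// (Kop_ge0 reg).
  by rewrite addr_ge0// !mulr_ge0.
rewrite deriv01_T//; apply: addr_ge0; last by rewrite mulr_ge0// (Kop'_ge0 reg).
by rewrite addr_ge0// !mulr_ge0.
Qed.

Let h_bounded (h : (R -> R) -> R) : functional_assumption h -> exists2 M : R, 0 <= M &
  forall u, ball u -> `|h u| <= M.
Proof.
move=> [_ _ hb]; have [||M MP] := hb [set u | ball u]; first by move=> u [].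
  by exists rho => u [].
exists (Num.max 0 M) => [|u ub]; first by rewrite le_max lexx.
by rewrite le_max MP// orbT.
Qed.

Let Kop_superpose_cont u : ball u -> forall e : R, 0 < e -> exists2 d : R, 0 < d &
  forall v, ball v -> C1norm (v - u) < d ->
    C1norm (Kop G k (superpose f v) - Kop G k (superpose f u)) <= e.
Proof.
move=> ub e e0; have K0 := Kint_ge0 reg; have K'0 := Kstar_ge0 reg.
have B0 : 0 < Kint k + Kstar k + 1 by lra.
have [d d0 dP] := nonlinearity_unif_cont f_cont rho (divr_gt0 e0 B0).
exists d => // v vb vu; have [[uP ur] [vP vr]] := (ub, vb).
have [uC vC] := (uP.1, vP.1).
have wC : C1_01 (v - u) by rewrite addrC -scaleN1r; exact: C1_lin.
have eB : 0 <= e / (Kint k + Kstar k + 1) by rewrite divr_ge0 ?ltW.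
apply: le_trans (C1norm_KopB reg (superpose_bounded vb) (superpose_bounded ub) eB _) _.
  move=> s /GI sI; apply/ltW/dP; try exact: coneP_box.
    exact: le_lt_trans (le_C1norm wC sI) vu.
  have <- : deriv01 (v - u) s = deriv01 v s - deriv01 u s.
    rewrite addrC -scaleN1r deriv01_lin//; ring.
  exact: le_lt_trans (le_C1norm_deriv wC sI) vu.
rewrite mulrAC ler_pdivrMr// ler_wpM2l ?ltW//; lra.
Qed.

Lemma Hammerstein_cont u : coneP u -> C1norm u <= rho -> forall e : R, 0 < e ->
  exists2 d : R, 0 < d & forall v, coneP v -> C1norm v <= rho ->
    C1norm (v - u) < d -> C1norm (T v - T u) < e.
Proof.
move=> uP ur e e0; have ub : ball u by [].
have gC1 := gamma1_C1.1; have gC2 := gamma2_C1.1.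
(* Each of the three terms will get at most [e / 4]; the added 1 keeps the divisors positive. *)
have N1 : 0 < eta1 * C1norm gamma1 + 1 by rewrite ltr_pwDr// mulr_ge0// C1norm_ge0.
have N2 : 0 < eta2 * C1norm gamma2 + 1 by rewrite ltr_pwDr// mulr_ge0// C1norm_ge0.
have N3 : 0 < lam + 1 by rewrite ltr_pwDr.
have e4 : 0 < e / 4 by rewrite divr_gt0.
have [_ h1c _] := h1_cont; have [_ h2c _] := h2_cont.
have [d1 d10 d1P] := h1c u uP _ (divr_gt0 e4 N1).
have [d2 d20 d2P] := h2c u uP _ (divr_gt0 e4 N2).
have [d3 d30 d3P] := Kop_superpose_cont ub (divr_gt0 e4 N3).
exists (Num.min d1 (Num.min d2 d3)) => [|v vP vr]; first by rewrite !lt_min d10 d20.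
rewrite !lt_min => /and3P[/(d1P v vP) H1 /(d2P v vP) H2 /d3P H3].
have vb : ball v by [].
have {}H3 := H3 vb.
have KC : C1_01 (Kop G k (superpose f v) - Kop G k (superpose f u)).
  by rewrite addrC -scaleN1r; apply: C1_lin; exact: Kop_superpose_C1.
have -> : T v - T u = (eta1 * (h1 v - h1 u)) *: gamma1 + ((eta2 * (h2 v - h2 u)) *: gamma2
    + lam *: (Kop G k (superpose f v) - Kop G k (superpose f u))).
  apply/funext => t.
  have Bfun (a b : R -> R) : (a - b) t = a t - b t by [].
  by rewrite Bfun !lin_funE /T !lin_funE !lin_scaleE Bfun; ring.
have lC := C1Z lam KC; have g2C := C1Z (eta2 * (h2 v - h2 u)) gC2.
have g1C := C1Z (eta1 * (h1 v - h1 u)) gC1.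
have g2lC : C1_01 ((eta2 * (h2 v - h2 u)) *: gamma2 +
    lam *: (Kop G k (superpose f v) - Kop G k (superpose f u))) by exact: C1_lin.
apply: le_lt_trans (C1norm_tri g1C g2lC) _.
have := C1norm_tri g2C lC; rewrite !C1norm_hom// !normrM.
rewrite (ger0_norm eta1_ge0) (ger0_norm eta2_ge0) (ger0_norm lam_ge0).
have frac (N x : R) : 0 <= N -> 0 <= x -> x <= e / 4 / (N + 1) -> N * x <= e / 4.
  move=> N0 x0; rewrite ler_pdivlMr; last by lra.
  move=> h; apply: le_trans h; rewrite mulrC ler_wpM2l//; lra.
have n1 := C1norm_ge0 gC1; have n2 := C1norm_ge0 gC2.
have f1 := frac _ _ (mulr_ge0 eta1_ge0 n1) (normr_ge0 _) (ltW H1).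
have f2 := frac _ _ (mulr_ge0 eta2_ge0 n2) (normr_ge0 _) (ltW H2).
have f3 := frac _ _ lam_ge0 (C1norm_ge0 KC) H3.
rewrite mulrAC in f1; rewrite mulrAC in f2.
lra.
Qed.

(** On the ball [h1] and [h2] are bounded, so the first two terms stay in a bounded part of the span
    of [gamma1] and [gamma2]; the derivatives of the integral term are equicontinuous by
    [Kop'_equicontinuous]. The limit is in the cone because the inequalities pass to the pointwise
    limits of values and derivatives. *)
Lemma Hammerstein_compact (x : nat -> R -> R) :
  (forall n, coneP (x n) /\ C1norm (x n) <= rho) ->
  forall U : set_system nat, UltraFilter U -> \oo `<=` U ->
  exists2 z, coneP z & forall e : R, 0 < e ->
    \forall n \near U, C1norm (T (x n) - z) < e.
Proof.
move=> xb U UU _; have UP := @ultra_proper _ _ UU.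
have gC1 := gamma1_C1.1; have gC2 := gamma2_C1.1.
have [M1 M10 M1P] := h_bounded h1_cont; have [M2 M20 M2P] := h_bounded h2_cont.
have K0 := Kint_ge0 reg; have K'0 := Kstar_ge0 reg.
have n1 := C1norm_ge0 gC1; have n2 := C1norm_ge0 gC2.
have Tb n t : t \in `[0, 1] -> `|T (x n) t| <= eta1 * C1norm gamma1 * M1
    + eta2 * C1norm gamma2 * M2 + lam * (fmax f rho * (Kint k + Kstar k)) /\
    `|deriv01 (T (x n)) t| <= eta1 * C1norm gamma1 * M1
    + eta2 * C1norm gamma2 * M2 + lam * (fmax f rho * (Kint k + Kstar k)).
  move=> tI; have h1b := M1P _ (xb n); have h2b := M2P _ (xb n).
  have sb := superpose_bounded (xb n).
  have bnd (a b c : R) : `|a| <= C1norm gamma1 -> `|b| <= C1norm gamma2 ->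
      `|c| <= fmax f rho * (Kint k + Kstar k) ->
      `|eta1 * a * h1 (x n) + eta2 * b * h2 (x n) + lam * c| <=
      eta1 * C1norm gamma1 * M1 + eta2 * C1norm gamma2 * M2
        + lam * (fmax f rho * (Kint k + Kstar k)).
    move=> ha hb hc; apply: le_trans (ler_normD _ _) _; apply: lerD.
      apply: le_trans (ler_normD _ _) _; rewrite !normrM.
      rewrite (ger0_norm eta1_ge0) (ger0_norm eta2_ge0); apply: lerD.
        by apply: ler_pM => //; [exact: mulr_ge0|exact: ler_wpM2l].
      by apply: ler_pM => //; [exact: mulr_ge0|exact: ler_wpM2l].
    by rewrite normrM (ger0_norm lam_ge0) ler_wpM2l.
  split.
    rewrite HammersteinE; apply: bnd; [exact: le_C1norm|exact: le_C1norm|].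
    apply: le_trans (norm_Kop_le reg sb fmax_ge0 tI) _.
    by rewrite ler_wpM2l// lerDl.
  rewrite deriv01_T//; apply: bnd; [exact: le_C1norm_deriv|exact: le_C1norm_deriv|].
  apply: le_trans (norm_Kop'_le reg sb fmax_ge0 tI) _.
  by rewrite ler_wpM2l// lerDr.
have equi tau : tau \in `[0, 1] -> forall e : R, 0 < e -> exists2 d : R, 0 < d &
    forall n t, t \in `[0, 1] -> `|t - tau| < d ->
    `|deriv01 (T (x n)) t - deriv01 (T (x n)) tau| <= e.
  move=> tauI e e0; have e3 : 0 < e / 3 by rewrite divr_gt0.
  have [A0 B0] : 0 <= eta1 * M1 /\ 0 <= eta2 * M2 by rewrite !mulr_ge0.
  have A1 : 0 < eta1 * M1 + 1 by lra.
  have B1 : 0 < eta2 * M2 + 1 by lra.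
  have L1 : 0 < lam + 1 by rewrite ltr_pwDr.
  have [d1 d10 d1P] := C1_cont_deriv gC1 tauI (divr_gt0 e3 A1).
  have [d2 d20 d2P] := C1_cont_deriv gC2 tauI (divr_gt0 e3 B1).
  have [d3 d30 d3P] := Kop'_equicontinuous reg (fmax f rho) tauI (divr_gt0 e3 L1).
  exists (Num.min d1 (Num.min d2 d3)) => [|n t tI]; first by rewrite !lt_min d10 d20.
  rewrite !lt_min => /and3P[/(d1P t tI) H1 /(d2P t tI) H2 td3].
  have H3 := d3P _ (superpose_bounded (xb n)) t tI td3.
  have h1b := M1P _ (xb n); have h2b := M2P _ (xb n).
  rewrite !deriv01_T//.
  set a := deriv01 gamma1 t; set a' := deriv01 gamma1 tau.
  set b := deriv01 gamma2 t; set b' := deriv01 gamma2 tau.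
  set c := Kop' _ _ _ t; set c' := Kop' _ _ _ tau.
  have -> : eta1 * a * h1 (x n) + eta2 * b * h2 (x n) + lam * c -
      (eta1 * a' * h1 (x n) + eta2 * b' * h2 (x n) + lam * c') =
      (eta1 * h1 (x n)) * (a - a') + (eta2 * h2 (x n)) * (b - b') + lam * (c - c') by ring.
  have frac (N y w : R) : 0 <= N -> 0 <= y -> `|w| <= N -> y <= e / 3 / (N + 1) -> `|w| * y <= e / 3.
    move=> N0 y0 wN; rewrite ler_pdivlMr; last by lra.
    move=> h; apply: le_trans h; rewrite mulrC ler_wpM2l//; lra.
  have f1 : `|eta1 * h1 (x n)| * `|a - a'| <= e / 3.
    by apply: (frac (eta1 * M1)) => //; [rewrite normrM (ger0_norm eta1_ge0) ler_wpM2l|exact: ltW].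
  have f2 : `|eta2 * h2 (x n)| * `|b - b'| <= e / 3.
    by apply: (frac (eta2 * M2)) => //; [rewrite normrM (ger0_norm eta2_ge0) ler_wpM2l|exact: ltW].
  have f3 : `|lam| * `|c - c'| <= e / 3.
    by apply: (frac lam) => //; rewrite ger0_norm.
  rewrite -!normrM in f1 f2 f3.
  apply: le_trans (ler_normD _ _) _.
  have := ler_normD (eta1 * h1 (x n) * (a - a')) (eta2 * h2 (x n) * (b - b')).
  lra.
have [z [zC zl z'l zN]] := C1_ultra_compact UU (fun n => T_C1 (xb n)) Tb equi.
exists z; last first.
  move=> e e0; apply: filterS (zN e e0) => n; rewrite subr0; apply: le_lt_trans.
  exact: ler_norm.
split => // t tI; have Tc n := Hammerstein_cone (proj1 (xb n)) (proj2 (xb n)).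
split.
  by apply: (ultra_ge UP (zl t tI)); apply: filterE => n; have [] := (Tc n).2 t tI.
by apply: (ultra_ge UP (z'l t tI)); apply: filterE => n; have [] := (Tc n).2 t tI.
Qed.

Let gamma_le1 (g : R -> R) (t : R) : gamma_assumption g -> t \in `[0, 1] -> g t <= g 1.
Proof.
move=> [gC g0] tI; move: (tI); rewrite in_itv/= => /andP[t0 t1].
apply: (has_deriv01_nondecreasing (fun s => C1_has_deriv gC)) => // s /andP[ts s1].
by have [] := g0 s; rewrite ?in_itv/= ?(le_trans t0 ts).
Qed.

Let h_le_Hsup (h : (R -> R) -> R) (u : R -> R) : functional_assumption h -> sphereP rho u -> h u <= Hsup h rho.
Proof.
move=> hf us; apply: ub_le_sup; last by exists u.
have [M _ MP] := h_bounded hf; exists M => _ [v [vP vr] <-].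
apply: le_trans (ler_norm _) (MP v _); split => //.
by rewrite [C1norm v]vr.
Qed.

Lemma Hammerstein_sphere u : coneP u -> C1norm u = rho ->
  C1norm (T u) <= Num.max
    (lam * fmax f rho * Kint k
     + (eta1 * gamma1 1 * Hsup h1 rho + eta2 * gamma2 1 * Hsup h2 rho))
    (lam * fmax f rho * Kstar k
     + (eta1 * supnorm (deriv01 gamma1) * Hsup h1 rho
        + eta2 * supnorm (deriv01 gamma2) * Hsup h2 rho)).
Proof.
move=> uP ur; have ub : ball u by split => //; rewrite ur.
have us : sphereP rho u by split.
have H1 := h_le_Hsup h1_cont us; have H2 := h_le_Hsup h2_cont us.
have [h10 h20] := h_ge0 uP.
have sb := superpose_bounded ub.
have [TuC Tu0] := Hammerstein_cone uP ub.2.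
have bnd (a b c a1 b1 c1 : R) : 0 <= a -> 0 <= b -> a <= a1 -> b <= b1 -> c <= c1 ->
    eta1 * a * h1 u + eta2 * b * h2 u + lam * c <=
    lam * c1 + (eta1 * a1 * Hsup h1 rho + eta2 * b1 * Hsup h2 rho).
  move=> a0 b0 aa bb cc; rewrite addrC lerD// ?ler_wpM2l// lerD//.
    by apply: ler_pM => //; [exact: mulr_ge0|exact: ler_wpM2l].
  by apply: ler_pM => //; [exact: mulr_ge0|exact: ler_wpM2l].
rewrite ge_max; apply/andP; split; rewrite le_max; apply/orP; [left|right].
  apply: supnorm_le => t tI; have [g1 _] := gamma1_C1.2 t tI; have [g2 _] := gamma2_C1.2 t tI.
  rewrite ger0_norm; last by have [] := Tu0 t tI.
  rewrite HammersteinE -(mulrA lam); apply: bnd => //; [exact: gamma_le1|exact: gamma_le1|].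
  exact: le_trans (ler_norm _) (norm_Kop_le reg sb fmax_ge0 tI).
apply: supnorm_le => t tI; have [_ g1] := gamma1_C1.2 t tI; have [_ g2] := gamma2_C1.2 t tI.
rewrite ger0_norm; last by have [] := Tu0 t tI.
rewrite deriv01_T// -(mulrA lam); apply: bnd => //.
- apply: le_trans (ler_norm _) (cont_le_supnorm _ tI) => s; exact: C1_cont_deriv gamma1_C1.1.
- apply: le_trans (ler_norm _) (cont_le_supnorm _ tI) => s; exact: C1_cont_deriv gamma2_C1.1.
exact: le_trans (ler_norm _) (norm_Kop'_le reg sb fmax_ge0 tI).
Qed.

(** Two radii occur: [rho] bounds the superposition and makes it integrable, while [r] is the radius
    of the box on which [f] is minimized. The terms with [gamma1] and [gamma2] are nonnegative and
    dropped. *)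
Lemma Hammerstein_ge u r : coneP u -> C1norm u <= rho -> C1norm u <= r ->
  lam * fmin f r * Kint k <= T u 1.
Proof.
move=> uP ur1 ur; have [h10 h20] := h_ge0 uP.
have [g1 _] := gamma1_C1.2 1 itv01_1; have [g2 _] := gamma2_C1.2 1 itv01_1.
rewrite HammersteinE -mulrA -[leLHS]add0r lerD//; first by rewrite addr_ge0// !mulr_ge0.
rewrite ler_wpM2l//; apply: (Kop_ge_cst reg (superpose_bounded (conj uP ur1))) => s Gs.
exact: (fmin_le f_cont (coneP_box uP ur (GI Gs))).
Qed.

Lemma coneP0 : coneP (0 : R -> R).
Proof. by split => [|t tI]; [exact: C1_0|rewrite deriv01_0]. Qed.

Lemma coneP_lin (a : R) (u v : R -> R) : 0 <= a -> coneP u -> coneP v -> coneP (a *: u + v).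
Proof.
move=> a0 [uC u0] [vC v0]; split => [|t tI]; first exact: C1_lin.
have [u1 u2] := u0 t tI; have [v1 v2] := v0 t tI.
by rewrite deriv01_lin// lin_funE !addr_ge0// mulr_ge0.
Qed.

Lemma Hammerstein_fixed_point :
  (forall u, coneP u -> C1norm u = rho -> C1norm (T u) <= rho) ->
  exists u, [/\ coneP u, C1norm u <= rho & forall t, t \in `[0, 1] -> T u t = u t].
Proof.
move=> bdry.
have [u [uP ur Tu]] := @rothe R (R -> R) (@C1_01 R) (@C1norm R) C1_0 (@C1_lin R)
  (@C1norm_tri R) (@C1norm_hom R) coneP rho T (fun u uP => uP.1) coneP0 coneP_lin
  rho_gt0 Hammerstein_cone Hammerstein_cont Hammerstein_compact bdry.
(* A vanishing seminorm gives equality on [0,1] only. *)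
exists u; split => // t tI.
have wC : C1_01 (T u - u).
  rewrite addrC -scaleN1r; apply: C1_lin; [exact: uP.1|exact: T_C1].
have := le_C1norm wC tI; rewrite Tu normr_le0 => /eqP E.
by apply/eqP; rewrite -subr_eq0; apply/eqP.
Qed.
End Solution.

Unset Implicit Arguments.

Theorem theorem2p2 (R : realType)
  (k : R -> R -> R) (f : R -> R -> R -> R) (gamma1 gamma2 : R -> R)
  (eta1 eta2 lam : R) (h1 h2 : (R -> R) -> R)
  (k_kernel : kernel_assumption k)
  (k_deriv : kernel_deriv_assumption k)
  (f_cont : nonlinearity_assumption f)
  (gamma1_C1 : gamma_assumption gamma1) (gamma2_C1 : gamma_assumption gamma2)
  (eta1_ge0 : 0 <= eta1) (eta2_ge0 : 0 <= eta2) (lam_ge0 : 0 <= lam)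
  (h1_cont : functional_assumption h1) (h2_cont : functional_assumption h2)
  (rmin rmax : R) (rmin_gt0 : 0 < rmin) (rmin_lt_rmax : rmin < rmax)
  (upper :
    Num.max
      (lam * fmax f rmax * Kint k
       + (eta1 * gamma1 1 * Hsup h1 rmax + eta2 * gamma2 1 * Hsup h2 rmax))
      (lam * fmax f rmax * Kstar k
       + (eta1 * supnorm (deriv01 gamma1) * Hsup h1 rmax
          + eta2 * supnorm (deriv01 gamma2) * Hsup h2 rmax))
    <= rmax)
  (lower : rmin <= lam * fmin f rmin * Num.min (Kint k) (Kstar k)) :
  exists u : R -> R,
    [/\ coneP u,
        forall t : R, t \in `[0, 1] ->
          u t = eta1 * gamma1 t * h1 u + eta2 * gamma2 t * h2 u
                + lam * \int[@lebesgue_measure R]_(s in `[0, 1])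
                          (k t s * f s (u s) (deriv01 u s))
      & rmin <= C1norm u <= rmax].
Proof.
have [G [Phi [Psi reg]]] := regular_kernel k_kernel k_deriv.
have rmax_gt0 := lt_trans rmin_gt0 rmin_lt_rmax.
have [u [uP ur Tu]] := @Hammerstein_fixed_point R k f gamma1 gamma2 eta1 eta2 lam h1 h2
  G Phi Psi reg f_cont gamma1_C1 gamma2_C1 eta1_ge0 eta2_ge0 lam_ge0 h1_cont h2_cont
  rmax rmax_gt0 (fun u uP ur => le_trans (Hammerstein_sphere reg f_cont gamma1_C1 gamma2_C1
    eta1_ge0 eta2_ge0 lam_ge0 h1_cont h2_cont rmax_gt0 uP ur) upper).
exists u; split => // [t tI|].
  by rewrite (Rintegral_regular reg) -[LHS]Tu// HammersteinE.
rewrite ur andbT leNgt; apply/negP => lt.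
have := le_lt_trans (le_C1norm uP.1 itv01_1) lt.
apply/negP; rewrite -leNgt -(Tu _ itv01_1); apply: le_trans (ler_norm _).
have := Hammerstein_ge reg f_cont gamma1_C1 gamma2_C1 eta1_ge0 eta2_ge0 lam_ge0
  h1_cont h2_cont uP ur (ltW lt).
apply: le_trans; apply: le_trans lower _.
rewrite ler_wpM2l ?ge_min ?lexx// mulr_ge0// (fmin_ge0 f_cont)//; exact: ltW.
Qed.
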